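(* Let $n\ge 1$. The monoid $STVB_n$ of singular twisted virtual braids on $n$ strands (equivalence classes of singular twisted virtual braid diagrams on $n$ strands, multiplied by concatenation) has the monoid presentation with generators $\sigma_i,\sigma_i^{-1},v_i,\tau_i$ $(1\le i\le n-1)$ and $\gamma_i$ $(1\le i\le n)$, and the following relations, for all indices for which the symbols are defined ($e$ is the identity): $$\sigma_i\sigma_j=\sigma_j\sigma_i,\quad v_iv_j=v_jv_i,\quad \sigma_iv_j=v_j\sigma_i,\quad \tau_i\tau_j=\tau_j\tau_i,\quad \sigma_i\tau_j=\tau_j\sigma_i,\quad \tau_iv_j=v_j\tau_i\qquad(|i-j|>1);$$ $$\sigma_i\sigma_{i+1}\sigma_i=\sigma_{i+1}\sigma_i\sigma_{i+1},\quad v_iv_{i+1}v_i=v_{i+1}v_iv_{i+1},\quad v_i\sigma_{i+1}v_i=v_{i+1}\sigma_iv_{i+1}\qquad(1\le i\le n-2);$$ $$\sigma_i\sigma_{i+1}\tau_i=\tau_{i+1}\sigma_i\sigma_{i+1},\quad v_i\tau_{i+1}v_i=v_{i+1}\tau_iv_{i+1}\qquad(1\le i\le n-2);$$ $$v_i^2=e,\quad \sigma_i\sigma_i^{-1}=\sigma_i^{-1}\sigma_i=e,\quad \sigma_i\tau_i=\tau_i\sigma_i\qquad(1\le i\le n-1);$$ $$\gamma_i^2=e\quad(1\le i\le n),\qquad \gamma_i\gamma_j=\gamma_j\gamma_i\quad(1\le i,j\le n);$$ $$\gamma_jv_i=v_i\gamma_j,\quad \sigma_i\gamma_j=\gamma_j\sigma_i,\quad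 \tau_i\gamma_j=\gamma_j\tau_i\qquad(j\ne i,i+1);$$ $$\gamma_{i+1}v_i=v_i\gamma_i,\quad v_i\sigma_iv_i=\gamma_{i+1}\gamma_i\sigma_i\gamma_i\gamma_{i+1},\quad v_i\tau_iv_i=\gamma_{i+1}\gamma_i\tau_i\gamma_i\gamma_{i+1}\qquad(1\le i\le n-1).$$
   Context: A singular twisted virtual braid diagram on $n$ strands is a union of $n$ smooth or polygonal curves (strands) in $\mathbb{R}^2$ connecting the points $(i,1)$ to $(q_i,0)$, $i=1,\dots,n$, where $(q_1,\dots,q_n)$ is a permutation of $(1,\dots,n)$; the strands are monotonic with respect to the second coordinate, they intersect only in transverse double points, each labelled as a positive, negative, virtual or singular crossing, and the strands may carry finitely many bars (short arcs crossing a strand transversely, away from the crossings). Elementary diagrams: $\sigma_i^{\pm1}$ (resp. $v_i$, $\tau_i$) has a single crossing, between the strands in positions $i,i+1$, which is positive/negative (resp. virtual, singular); $\gamma_i$ is the trivial diagram with one bar on the $i$-th strand. The product $ab$ is the diagram obtained by stacking $a$ on top of $b$ and rescaling. Two diagrams are equivalent if they are related by a finite sequence of isotopies of the plane region through braid diagrams (including interchanging the heights of crossings and bars at disjoint places) and the following local moves, written as pictures of words in elementary diagrams: (classical) $\sigma_i\sigma_i^{-1}\leftrightarrow e\leftrightarrow\sigma_i^{-1}\sigma_i$, $\sigma_i\sigma_{i+1}\sigma_i\leftrightarrow\sigma_{i+1}\sigma_i\sigma_{i+1}$; (virtual) $v_i^2\leftrightarrow e$, $v_iv_{i+1}v_i\leftrightarrow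 v_{i+1}v_iv_{i+1}$, $v_i\sigma_{i+1}v_i\leftrightarrow v_{i+1}\sigma_iv_{i+1}$; (twisted) $\gamma_i^2\leftrightarrow e$ (two consecutive bars on a strand cancel), $\gamma_{i+1}v_i\leftrightarrow v_i\gamma_i$ (a bar slides along its strand through a virtual crossing), $v_i\sigma_iv_i\leftrightarrow\gamma_{i+1}\gamma_i\sigma_i\gamma_i\gamma_{i+1}$; (singular) $\sigma_i\tau_i\leftrightarrow\tau_i\sigma_i$, $\sigma_i\sigma_{i+1}\tau_i\leftrightarrow\tau_{i+1}\sigma_i\sigma_{i+1}$, $v_i\tau_{i+1}v_i\leftrightarrow v_{i+1}\tau_iv_{i+1}$, $v_i\tau_iv_i\leftrightarrow\gamma_{i+1}\gamma_i\tau_i\gamma_i\gamma_{i+1}$. A singular twisted virtual braid is an equivalence class of diagrams. *)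

(* Defs.v *)
From HB Require Import structures.
From mathcomp Require Import all_boot all_order all_algebra.
From mathcomp Require Import perm generic_quotient.
From mathcomp Require Import all_classical all_reals all_analysis.
From mathcomp Require Import lra.
From Stdlib Require Import Relation_Operators.

Set Implicit Arguments.
Unset Strict Implicit.
Unset Printing Implicit Defensive.

Import Order.TTheory GRing.Theory Num.Theory.
Import numFieldNormedType.Exports.

Local Open Scope classical_set_scope.
Local Open Scope ring_scope.
Local Open Scope quotient_scope.

Definition rewrite_step (X : Type) (rel : seq X -> seq X -> Prop)
    (u v : seq X) : Prop :=
  exists a b l r, [/\ rel l r, u = a ++ l ++ b & v = a ++ r ++ b].

Definition word_congruence (X : Type) (rel : seq X -> seq X -> Prop) :
    seq X -> seq X -> Prop :=
  clos_refl_sym_trans (seq X) (rewrite_step rel).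

Definition eval_word (M X : Type) (mul : M -> M -> M) (one : M) (g : X -> M)
    (w : seq X) : M :=
  foldr mul one (map g w).

(* (M, mul, one) is a monoid, and the canonical map from words in X to M
   induced by g identifies M with the quotient of the free monoid on X by the
   congruence generated by rel. *)
Definition monoid_presented_by (M X : Type) (mul : M -> M -> M) (one : M)
    (g : X -> M) (rel : seq X -> seq X -> Prop) : Prop :=
  [/\ associative mul, left_id one mul, right_id one mul,
      (forall m, exists w, eval_word mul one g w = m) &
      (forall u v, eval_word mul one g u = eval_word mul one g v <->
                   word_congruence rel u v)].

(* Indices start from 0: i : 'I_n.-1 stands for the pair of positions
   (pos_l i, pos_r i) = (i, i + 1). *)
Lemma pos_r_subproof (n : nat) (i : 'I_n.-1) : (i.+1 < n)%N.
Proof. by case: n i => [|n] [i hi]. Qed.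

Definition pos_l (n : nat) (i : 'I_n.-1) : 'I_n := widen_ord (leq_pred n) i.
Definition pos_r (n : nat) (i : 'I_n.-1) : 'I_n := Ordinal (pos_r_subproof i).

Inductive stvb_gen (n : nat) : Type :=
  | sigma of 'I_n.-1
  | sigmaV of 'I_n.-1
  | virt of 'I_n.-1
  | tau of 'I_n.-1
  | gamma of 'I_n.

Section Relations.
Variable n : nat.
Implicit Types (i j : 'I_n.-1) (k l : 'I_n).
Local Notation s := (@sigma n).
Local Notation sV := (@sigmaV n).
Local Notation v := (@virt n).
Local Notation t := (@tau n).
Local Notation g := (@gamma n).

Inductive stvb_move : seq (stvb_gen n) -> seq (stvb_gen n) -> Prop :=
  | move_s_sV i : stvb_move [:: s i; sV i] [::]
  | move_sV_s i : stvb_move [:: sV i; s i] [::]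
  | move_sss i j : j = i.+1 :> nat ->
      stvb_move [:: s i; s j; s i] [:: s j; s i; s j]
  | move_v2 i : stvb_move [:: v i; v i] [::]
  | move_vvv i j : j = i.+1 :> nat ->
      stvb_move [:: v i; v j; v i] [:: v j; v i; v j]
  | move_vsv i j : j = i.+1 :> nat ->
      stvb_move [:: v i; s j; v i] [:: v j; s i; v j]
  | move_g2 k : stvb_move [:: g k; g k] [::]
  | move_gv i : stvb_move [:: g (pos_r i); v i] [:: v i; g (pos_l i)]
  | move_tw_s i : stvb_move [:: v i; s i; v i]
      [:: g (pos_r i); g (pos_l i); s i; g (pos_l i); g (pos_r i)]
  | move_st i : stvb_move [:: s i; t i] [:: t i; s i]
  | move_sst i j : j = i.+1 :> nat ->
      stvb_move [:: s i; s j; t i] [:: t j; s i; s j]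
  | move_vtv i j : j = i.+1 :> nat ->
      stvb_move [:: v i; t j; v i] [:: v j; t i; v j]
  | move_tw_t i : stvb_move [:: v i; t i; v i]
      [:: g (pos_r i); g (pos_l i); t i; g (pos_l i); g (pos_r i)].

Definition far i j : bool := (i.+1 < j)%N || (j.+1 < i)%N.

Inductive stvb_rel : seq (stvb_gen n) -> seq (stvb_gen n) -> Prop :=
  | rel_far_ss i j : far i j -> stvb_rel [:: s i; s j] [:: s j; s i]
  | rel_far_vv i j : far i j -> stvb_rel [:: v i; v j] [:: v j; v i]
  | rel_far_sv i j : far i j -> stvb_rel [:: s i; v j] [:: v j; s i]
  | rel_far_tt i j : far i j -> stvb_rel [:: t i; t j] [:: t j; t i]
  | rel_far_st i j : far i j -> stvb_rel [:: s i; t j] [:: t j; s i]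
  | rel_far_tv i j : far i j -> stvb_rel [:: t i; v j] [:: v j; t i]
  | rel_sss i j : j = i.+1 :> nat ->
      stvb_rel [:: s i; s j; s i] [:: s j; s i; s j]
  | rel_vvv i j : j = i.+1 :> nat ->
      stvb_rel [:: v i; v j; v i] [:: v j; v i; v j]
  | rel_vsv i j : j = i.+1 :> nat ->
      stvb_rel [:: v i; s j; v i] [:: v j; s i; v j]
  | rel_sst i j : j = i.+1 :> nat ->
      stvb_rel [:: s i; s j; t i] [:: t j; s i; s j]
  | rel_vtv i j : j = i.+1 :> nat ->
      stvb_rel [:: v i; t j; v i] [:: v j; t i; v j]
  | rel_v2 i : stvb_rel [:: v i; v i] [::]
  | rel_s_sV i : stvb_rel [:: s i; sV i] [::]
  | rel_sV_s i : stvb_rel [:: sV i; s i] [::]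
  | rel_st i : stvb_rel [:: s i; t i] [:: t i; s i]
  | rel_g2 k : stvb_rel [:: g k; g k] [::]
  | rel_gg k l : stvb_rel [:: g k; g l] [:: g l; g k]
  | rel_far_gv i k : k != pos_l i -> k != pos_r i ->
      stvb_rel [:: g k; v i] [:: v i; g k]
  | rel_far_sg i k : k != pos_l i -> k != pos_r i ->
      stvb_rel [:: s i; g k] [:: g k; s i]
  | rel_far_tg i k : k != pos_l i -> k != pos_r i ->
      stvb_rel [:: t i; g k] [:: g k; t i]
  | rel_gv i : stvb_rel [:: g (pos_r i); v i] [:: v i; g (pos_l i)]
  | rel_tw_s i : stvb_rel [:: v i; s i; v i]
      [:: g (pos_r i); g (pos_l i); s i; g (pos_l i); g (pos_r i)]
  | rel_tw_t i : stvb_rel [:: v i; t i; v i]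
      [:: g (pos_r i); g (pos_l i); t i; g (pos_l i); g (pos_r i)].

End Relations.

Definition smooth (R : realType) (f : R -> R) : Prop :=
  forall m x, derivable (derive1n m f) x 1.

(* This class contains the smooth and the polygonal strands and, unlike the
   class of smooth ones, is closed under stacking. *)
Inductive piecewise_smooth (R : realType) (f : R -> R) : R -> R -> Prop :=
  | psmooth_piece a b h : a <= b -> smooth h -> {in `[a, b], f =1 h} ->
      piecewise_smooth f a b
  | psmooth_glue a b c : piecewise_smooth f a b -> piecewise_smooth f b c ->
      piecewise_smooth f a c.

Lemma is_derive_affine (R : realType) (c d x : R) :
  is_derive x 1 (fun y : R => c * y + d) c.
Proof.
have -> : (fun z : R => c * z + d) = (c \*: (@id R)) + cst d by [].
by apply: is_derive_eq; rewrite addr0 scaler1.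
Qed.

Lemma derive1n_affine (R : realType) (c d : R) m :
  derive1n m (fun y : R => c * y + d) =
  if m is m'.+1 then cst (if m' == 0 then c else 0) else fun y => c * y + d.
Proof.
elim: m => [|m IH]; first by rewrite derive1n0.
rewrite derive1nS IH; apply/funext => y; rewrite derive1E.
case: m {IH} => [|m] /=; last exact: derive_cst.
by have [] := is_derive_affine c d y.
Qed.

Lemma smooth_affine (R : realType) (c d : R) :
  smooth (fun y : R => c * y + d).
Proof.
move=> m x; rewrite derive1n_affine; case: m => [|m] /=.
  by have [] := is_derive_affine c d x.
exact: derivable_cst.
Qed.

Lemma is_derive_comp_affine (R : realType) (h : R -> R) (c d x dh : R) :
  is_derive (c * x + d) 1 h dh ->
  is_derive x 1 (fun y : R => h (c * y + d)) (c * dh).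
Proof.
move=> hh.
have := @is_derive1_comp R h (fun y => c * y + d) x dh c hh
  (is_derive_affine c d x).
by rewrite mulrC.
Qed.

Lemma smooth_comp_affine (R : realType) (h : R -> R) (c d : R) :
  smooth h -> smooth (fun y => h (c * y + d)).
Proof.
move=> hh.
have D (m : nat) (x : R) :
    is_derive x 1 (fun y : R => c ^+ m * derive1n m h (c * y + d))
    (c ^+ m.+1 * derive1n m.+1 h (c * x + d)).
  have E : is_derive (c * x + d) 1 (derive1n m h) (derive1n m.+1 h (c * x + d)).
    by rewrite derive1nS derive1E; apply: derivableP; exact: hh.
  rewrite exprSr -mulrA; apply: (@is_deriveZ _ _ _ _ (c ^+ m)).
  exact: is_derive_comp_affine.
have E m : derive1n m (fun y => h (c * y + d)) =
           (fun y => c ^+ m * derive1n m h (c * y + d)).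
  elim: m => [|m IH]; first by apply/funext => y; rewrite expr0 mul1r.
  rewrite derive1nS IH; apply/funext => y; rewrite derive1E.
  by have [] := D m y.
by move=> m x; rewrite E; have [] := D m x.
Qed.

Lemma psmooth_le (R : realType) (f : R -> R) a b :
  piecewise_smooth f a b -> a <= b.
Proof. by elim=> // {}a {}b c _ ab _; exact: le_trans. Qed.

Lemma psmooth_eq (R : realType) (f g : R -> R) a b :
  piecewise_smooth f a b -> {in `[a, b], f =1 g} -> piecewise_smooth g a b.
Proof.
elim=> [{}a {}b h ab hh fh fg|{}a {}b c fab IH1 fbc IH2 fg].
  apply: (psmooth_piece ab hh) => y yab.
  by rewrite -fg// fh.
have [ab bc] := (psmooth_le fab, psmooth_le fbc).
apply: (@psmooth_glue _ _ _ b).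
- apply: IH1 => y; rewrite in_itv/= => /andP[ay yb]; apply: fg.
  by rewrite in_itv/= ay (le_trans yb).
- apply: IH2 => y; rewrite in_itv/= => /andP[ay yb]; apply: fg.
  by rewrite in_itv/= yb andbT (le_trans ab).
Qed.

Lemma psmooth_comp_affine (R : realType) (f : R -> R) a b c d : 0 < c ->
  piecewise_smooth f a b ->
  piecewise_smooth (fun y => f (c * y + d)) ((a - d) / c) ((b - d) / c).
Proof.
move=> c0; elim=> [{}a {}b h ab hh fh|{}a {}b e _ IH1 _ IH2]; last first.
  exact: psmooth_glue IH1 IH2.
apply: (psmooth_piece (h := fun y => h (c * y + d))) => [||y].
- by rewrite ler_pM2r ?invr_gt0// lerD2r.
- exact: smooth_comp_affine.
- rewrite in_itv/= ler_pdivrMr// ler_pdivlMr// => /andP[ay yb].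
  by apply: fh; rewrite in_itv/=; apply/andP; split; lra.
Qed.

Inductive crossing_type : Set := Positive | Negative | Virtual | Singular.

Definition endpoint (R : realType) (n : nat) (j : 'I_n) : R := j.+1%:R.

(* Since the strands are monotonic in the second coordinate, they are graphs
   over it: the j-th strand is {(strand j y, y) | 0 <= y <= 1}.  The values of
   strand j outside [0, 1], and those of label away from the double points,
   are irrelevant.  A bar is recorded by the point where it meets its strand. *)
Record diagram (R : realType) (n : nat) : Type := Diagram {
  strand : 'I_n -> R -> R;
  strand_perm : {perm 'I_n};
  label : R * R -> crossing_type;
  bars : set (R * R);
  strand_top : forall j, strand j 1 = endpoint R j;
  strand_bottom : forall j, strand j 0 = endpoint R (strand_perm j);
  strand_psmooth : forall j, piecewise_smooth (strand j) 0 1;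
  strand_double : forall (j k l : 'I_n) (y : R), 0 <= y <= 1 ->
    j != k -> k != l -> j != l ->
    ~ (strand j y = strand k y /\ strand k y = strand l y);
  strand_transverse : forall (j k : 'I_n) (y : R), 0 <= y <= 1 ->
    j != k -> strand j y = strand k y ->
    exists a b : R, [/\ is_derive y 1 (strand j) a,
                        is_derive y 1 (strand k) b & a != b];
  bars_finite : finite_set bars;
  bars_on : forall p, bars p -> 0 < p.2 < 1 /\
    exists j, strand j p.2 = p.1 /\
      forall k, k != j -> strand k p.2 != p.1 }.

Section Diagrams.
Context {R : realType}.

Definition strip : set (R * R) := [set p | 0 <= p.2 <= 1].

Definition on_strand n (D : diagram R n) (j : 'I_n) (p : R * R) : Prop :=
  strip p /\ strand D j p.2 = p.1.

Definition double_point n (D : diagram R n) (p : R * R) : Prop :=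
  exists j k, [/\ j != k, on_strand D j p & on_strand D k p].

(* The part of D in the set A is carried by h onto the part of D' in the
   set h(A), the j-th strand of D going into the (iota j)-th strand of D'. *)
Definition carries (A : set (R * R)) (h : R * R -> R * R) m n
    (iota : 'I_m -> 'I_n) (D : diagram R m) (D' : diagram R n) : Prop :=
  forall p, A p ->
    [/\ forall l, on_strand D' l (h p) <->
                  exists2 j, l = iota j & on_strand D j p,
        double_point D p -> label D' (h p) = label D p &
        bars D' (h p) <-> bars D p].

Definition straight n (s : {perm 'I_n}) (j : 'I_n) (y : R) : R :=
  (endpoint R j - endpoint R (s j)) * y + endpoint R (s j).

Lemma endpoint_inj n : injective (@endpoint R n).
Proof.
by move=> j k /eqP; rewrite /endpoint eqr_nat eqSS => /eqP /val_inj.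
Qed.

Lemma straight_top n s (j : 'I_n) : straight s j 1 = endpoint R j.
Proof. by rewrite /straight mulr1 subrK. Qed.

Lemma straight_bottom n s (j : 'I_n) :
  straight s j 0 = endpoint R (s j).
Proof. by rewrite /straight mulr0 add0r. Qed.

Lemma straight_psmooth n s (j : 'I_n) : piecewise_smooth (straight s j) 0 1.
Proof.
by apply: (psmooth_piece (h := straight s j)) => //; exact: smooth_affine.
Qed.

Lemma straight_transverse n s (j k : 'I_n) (y : R) : 0 <= y <= 1 ->
  j != k -> straight s j y = straight s k y ->
  exists a b : R, [/\ is_derive y 1 (straight s j) a,
                      is_derive y 1 (straight s k) b & a != b].
Proof.
move=> _ jk; rewrite /straight => E.
exists (endpoint R j - endpoint R (s j)), (endpoint R k - endpoint R (s k)).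
split; [exact: is_derive_affine|exact: is_derive_affine|].
apply/eqP => ab; move/eqP: jk; apply; apply: endpoint_inj.
rewrite ab in E; move/addrI: E => E.
by move: ab; rewrite E => /addIr.
Qed.

Lemma straight_id n (j : 'I_n) y : straight 1%g j y = endpoint R j.
Proof. by rewrite /straight perm1 subrr mul0r add0r. Qed.

Lemma straight_id_double n (j k l : 'I_n) (y : R) : 0 <= y <= 1 ->
  j != k -> k != l -> j != l ->
  ~ (straight 1%g j y = straight 1%g k y /\
     straight 1%g k y = straight 1%g l y).
Proof.
by move=> _ /eqP jk _ _ []; rewrite !straight_id => /endpoint_inj /jk.
Qed.

Definition swap n (i : 'I_n.-1) : {perm 'I_n} := tperm (pos_l i) (pos_r i).

Lemma endpoint_pos_r n (i : 'I_n.-1) :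
  endpoint R (pos_r i) = endpoint R (pos_l i) + 1.
Proof. by rewrite /endpoint/= [in LHS]mulrSr. Qed.

Lemma straight_swap_meet n (i : 'I_n.-1) (j k : 'I_n) (y : R) :
  0 <= y <= 1 -> j != k -> straight (swap i) j y = straight (swap i) k y ->
  k = pos_l i \/ k = pos_r i.
Proof.
move=> /andP[y0 y1] jk E.
case: (eqVneq k (pos_l i)) => [|kl]; first by left.
case: (eqVneq k (pos_r i)) => [|kr]; first by right.
exfalso; move: E; rewrite [in RHS]/straight tpermD 1?eq_sym//.
rewrite subrr mul0r add0r => E.
case: (eqVneq j (pos_l i)) => [jl|jl].
  move: E; rewrite jl /straight tpermL endpoint_pos_r => E.
  have h1 : endpoint R (pos_l i) <= endpoint R k by nra.
  have h2 : endpoint R k <= endpoint R (pos_r i) by rewrite endpoint_pos_r; nra.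
  move: h1 h2; rewrite /endpoint !ler_nat !ltnS leq_eqVlt => /orP[/eqP e|lt] h2.
    by move/eqP: kl; apply; apply: val_inj.
  by move/eqP: kr; apply; apply: val_inj; apply/eqP; rewrite eqn_leq h2.
case: (eqVneq j (pos_r i)) => [jr|jr].
  move: E; rewrite jr /straight tpermR endpoint_pos_r => E.
  have h1 : endpoint R (pos_l i) <= endpoint R k by nra.
  have h2 : endpoint R k <= endpoint R (pos_r i) by rewrite endpoint_pos_r; nra.
  move: h1 h2; rewrite /endpoint !ler_nat !ltnS leq_eqVlt => /orP[/eqP e|lt] h2.
    by move/eqP: kl; apply; apply: val_inj.
  by move/eqP: kr; apply; apply: val_inj; apply/eqP; rewrite eqn_leq h2.
move: E; rewrite /straight tpermD 1?eq_sym// subrr mul0r add0r.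
by move/endpoint_inj/eqP; apply/negP.
Qed.

Lemma straight_swap_double n (i : 'I_n.-1) (j k l : 'I_n) (y : R) :
  0 <= y <= 1 -> j != k -> k != l -> j != l ->
  ~ (straight (swap i) j y = straight (swap i) k y /\
     straight (swap i) k y = straight (swap i) l y).
Proof.
move=> y01 jk kl jl [jyk kyl].
have := straight_swap_meet y01 jk jyk.
have := straight_swap_meet y01 kl kyl.
have := @straight_swap_meet n i l j y y01.
rewrite eq_sym => /(_ jl); rewrite jyk kyl => /(_ erefl).
by move: jk kl jl => /eqP jk /eqP kl /eqP jl [] ? [] ? [] ?; congruence.
Qed.

Lemma no_bars n (P : R * R -> 'I_n -> Prop) (p : R * R) :
  set0 p -> 0 < p.2 < 1 /\ exists j, P p j.
Proof. by []. Qed.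

Definition trivial_diagram n : diagram R n :=
  @Diagram R n (straight 1%g) 1%g (fun=> Virtual) set0
    (straight_top 1%g) (straight_bottom 1%g) (straight_psmooth 1%g)
    (@straight_id_double n) (straight_transverse (s := 1%g))
    (finite_set0 _) (@no_bars n _).

Definition crossing_diagram n (c : crossing_type) (i : 'I_n.-1) : diagram R n :=
  @Diagram R n (straight (swap i)) (swap i) (fun=> c) set0
    (straight_top _) (straight_bottom _) (straight_psmooth _)
    (@straight_swap_double n i) (straight_transverse (s := swap i))
    (finite_set0 _) (@no_bars n _).

Lemma bar_on n (k : 'I_n) (p : R * R) : [set (endpoint R k, 2^-1)] p ->
  0 < p.2 < 1 /\ exists j : 'I_n, straight 1%g j p.2 = p.1 /\
    forall l : 'I_n, l != j -> straight 1%g l p.2 != p.1.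
Proof.
move=> -> /=; split; first by apply/andP; split; lra.
exists k; split; first by rewrite straight_id.
by move=> l lk; rewrite straight_id (inj_eq (@endpoint_inj n)).
Qed.

Definition bar_diagram n (k : 'I_n) : diagram R n :=
  @Diagram R n (straight 1%g) 1%g (fun=> Virtual) [set (endpoint R k, 2^-1)]
    (straight_top 1%g) (straight_bottom 1%g) (straight_psmooth 1%g)
    (@straight_id_double n) (straight_transverse (s := 1%g))
    (finite_set1 _) (@bar_on n k).

Definition elementary_diagram n (x : stvb_gen n) : diagram R n :=
  match x with
  | sigma i => crossing_diagram Positive i
  | sigmaV i => crossing_diagram Negative i
  | virt i => crossing_diagram Virtual i
  | tau i => crossing_diagram Singular i
  | gamma k => bar_diagram k
  end.

Section Stack.
Variables (n : nat) (D E : diagram R n).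

Definition stack_perm : {perm 'I_n} := (strand_perm D * strand_perm E)%g.

Definition stack_strand (j : 'I_n) (y : R) : R :=
  if 2^-1 <= y then strand D j (2 * y - 1)
  else strand E (strand_perm D j) (2 * y).

Definition stack_label (p : R * R) : crossing_type :=
  if 2^-1 <= p.2 then label D (p.1, 2 * p.2 - 1) else label E (p.1, 2 * p.2).

Definition stack_bars : set (R * R) :=
  (fun p => (p.1, (p.2 + 1) / 2)) @` bars D `|`
  (fun p => (p.1, p.2 / 2)) @` bars E.

Lemma stack_strand_upper j y : 2^-1 <= y ->
  stack_strand j y = strand D j (2 * y - 1).
Proof. by rewrite /stack_strand => ->. Qed.

Lemma stack_strand_lower j y : y <= 2^-1 ->
  stack_strand j y = strand E (strand_perm D j) (2 * y).
Proof.
rewrite le_eqVlt => /orP[/eqP ->|yh]; rewrite /stack_strand.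
  rewrite lexx; have -> : 2 * 2^-1 - 1 = 0 :> R by lra.
  have -> : 2 * 2^-1 = 1 :> R by lra.
  by rewrite strand_bottom strand_top.
by rewrite leNgt yh.
Qed.

Lemma stack_top j : stack_strand j 1 = endpoint R j.
Proof.
rewrite stack_strand_upper; last lra.
have -> : 2 * 1 - 1 = 1 :> R by lra.
exact: strand_top.
Qed.

Lemma stack_bottom j : stack_strand j 0 = endpoint R (stack_perm j).
Proof.
rewrite stack_strand_lower; last lra.
by rewrite mulr0 strand_bottom permM.
Qed.

Lemma stack_psmooth j : piecewise_smooth (stack_strand j) 0 1.
Proof.
apply: (@psmooth_glue _ _ _ 2^-1).
- have := psmooth_comp_affine 0 (ltr0Sn R 1)
    (strand_psmooth E (strand_perm D j)).
  rewrite !subr0 mul0r mul1r => /psmooth_eq; apply => y.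
  by rewrite in_itv/= addr0 => /andP[_ yh]; rewrite stack_strand_lower.
- have := psmooth_comp_affine (-1) (ltr0Sn R 1) (strand_psmooth D j).
  have -> : (0 - -1) / 2 = 2^-1 :> R by lra.
  have -> : (1 - -1) / 2 = 1 :> R by lra.
  move=> /psmooth_eq; apply => y.
  by rewrite in_itv/= => /andP[yh _]; rewrite stack_strand_upper.
Qed.

Lemma stack_double (j k l : 'I_n) (y : R) : 0 <= y <= 1 ->
  j != k -> k != l -> j != l ->
  ~ (stack_strand j y = stack_strand k y /\
     stack_strand k y = stack_strand l y).
Proof.
move=> /andP[y0 y1] jk kl jl; case: (leP 2^-1 y) => yh.
  rewrite !stack_strand_upper//; apply: strand_double => //.
  by apply/andP; split; lra.
rewrite !stack_strand_lower ?(ltW yh)//; apply: strand_double.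
- by apply/andP; split; lra.
- by rewrite (inj_eq perm_inj).
- by rewrite (inj_eq perm_inj).
- by rewrite (inj_eq perm_inj).
Qed.

Lemma stack_transverse (j k : 'I_n) (y : R) : 0 <= y <= 1 ->
  j != k -> stack_strand j y = stack_strand k y ->
  exists a b : R, [/\ is_derive y 1 (stack_strand j) a,
                      is_derive y 1 (stack_strand k) b & a != b].
Proof.
move=> /andP[y0 y1] jk; case: (ltgtP 2^-1 y) => yh.
- rewrite !stack_strand_upper ?(ltW yh)// => e.
  have [|a [b [da db ab]]] := strand_transverse _ jk e.
    by apply/andP; split; lra.
  have upper l dl : is_derive (2 * y - 1) 1 (strand D l) dl ->
      is_derive y 1 (stack_strand l) (2 * dl).
    move=> /is_derive_comp_affine; apply: near_eq_is_derive.
    near=> z; rewrite stack_strand_upper//; apply/ltW.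
    by near: z; exact: (cvgr_gt y cvg_id).
  exists (2 * a), (2 * b); split; [exact: upper|exact: upper|].
  by apply: contra ab => /eqP/mulfI; rewrite pnatr_eq0 => /(_ isT) ->.
- rewrite !stack_strand_lower ?(ltW yh)// => e.
  have jk' : strand_perm D j != strand_perm D k by rewrite (inj_eq perm_inj).
  have [|a [b [da db ab]]] := strand_transverse _ jk' e.
    by apply/andP; split; lra.
  have lower l dl : is_derive (2 * y) 1 (strand E (strand_perm D l)) dl ->
      is_derive y 1 (stack_strand l) (2 * dl).
    rewrite -[2 * y]addr0 => /is_derive_comp_affine; apply: near_eq_is_derive.
    near=> z; rewrite addr0 stack_strand_lower//; apply/ltW.
    by near: z; exact: lt_nbhsl.
  exists (2 * a), (2 * b); split; [exact: lower|exact: lower|].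
  by apply: contra ab => /eqP/mulfI; rewrite pnatr_eq0 => /(_ isT) ->.
- rewrite -yh !stack_strand_lower// divff// !strand_top.
  by move=> /endpoint_inj /perm_inj /eqP; rewrite (negPf jk).
Unshelve. all: by end_near. Qed.

Lemma stack_bars_finite : finite_set stack_bars.
Proof.
by rewrite finite_setU; split; apply: finite_image; exact: bars_finite.
Qed.

Lemma stack_bars_on p : stack_bars p -> 0 < p.2 < 1 /\
  exists j, stack_strand j p.2 = p.1 /\
    forall k, k != j -> stack_strand k p.2 != p.1.
Proof.
case=> -[q bq <-] /=; have [/andP[q0 q1] [j [ej nj]]] := bars_on bq.
- split; first by apply/andP; split; lra.
  have e k : stack_strand k ((q.2 + 1) / 2) = strand D k q.2.
    by rewrite stack_strand_upper; [congr strand; lra|lra].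
  by exists j; rewrite e; split=> // k kj; rewrite e nj.
- split; first by apply/andP; split; lra.
  have e k : stack_strand k (q.2 / 2) = strand E (strand_perm D k) q.2.
    by rewrite stack_strand_lower; [congr strand; lra|lra].
  exists ((strand_perm D)^-1%g j); rewrite e permKV; split=> // k kj.
  by rewrite e nj// -(permKV (strand_perm D) j) (inj_eq perm_inj).
Qed.

Definition stack : diagram R n :=
  @Diagram R n stack_strand stack_perm stack_label stack_bars
    stack_top stack_bottom stack_psmooth stack_double stack_transverse
    stack_bars_finite stack_bars_on.

End Stack.

Definition word_diagram n (w : seq (stvb_gen n)) : diagram R n :=
  eval_word (@stack n) (trivial_diagram n) (@elementary_diagram n) w.

Definition self_homeomorphism (A : set (R * R)) (h : R * R -> R * R) : Prop :=
  {within A, continuous h} /\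
  exists2 g : R * R -> R * R, {within A, continuous g} &
    forall p, A p -> [/\ A (h p), A (g p), g (h p) = p & h (g p) = p].

(* Ambient isotopies of the strip, fixing its boundary, that carry D to D'
   through braid diagrams. *)
Definition isotopic n (D D' : diagram R n) : Prop :=
  exists H : R -> R * R -> R * R,
  [/\ {within `[0, 1] `*` strip,
         continuous (fun q : R * (R * R) => H q.1 q.2)},
      forall t, 0 <= t <= 1 ->
        [/\ self_homeomorphism strip (H t),
            forall p, p.2 = 0 \/ p.2 = 1 -> H t p = p &
            exists Dt : diagram R n, carries strip (H t) id D Dt],
      forall p, strip p -> H 0 p = p &
      carries strip (H 1) id D D'].

(* [0, k + 1] x [0, 1], a box around the diagrams of words on k strands *)
Definition box (k : nat) : set (R * R) :=
  [set p | 0 <= p.1 <= k.+1%:R /\ 0 <= p.2 <= 1].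

(* D' is obtained from D by replacing, inside some rectangle in the strip, a
   rescaled copy of the diagram P on k strands by a rescaled copy of P'. *)
Definition local_replacement k n (P P' : diagram R k) (D D' : diagram R n) :
    Prop :=
  exists (a b c d : R) (iota : 'I_k -> 'I_n),
  let A (p : R * R) := (a + b * p.1, c + d * p.2) in
  [/\ [/\ 0 < b, 0 < d, 0 <= c & c + d <= 1],
      carries (box k) A iota P D,
      carries (box k) A iota P' D' &
      carries (strip `\` (A @` box k)) id id D D'].

Definition diagram_step n (D D' : diagram R n) : Prop :=
  isotopic D D' \/
  exists (k : nat) (u v : seq (stvb_gen k)),
    stvb_move u v /\
    local_replacement (word_diagram u) (word_diagram v) D D'.

Definition diagram_equiv n : diagram R n -> diagram R n -> Prop :=
  clos_refl_sym_trans (diagram R n) (@diagram_step n).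

End Diagrams.

HB.instance Definition _ (R : realType) (n : nat) :=
  gen_eqMixin (diagram R n).
HB.instance Definition _ (R : realType) (n : nat) :=
  gen_choiceMixin (diagram R n).

Definition diagram_eqb (R : realType) (n : nat) : rel (diagram R n) :=
  fun D D' => `[< diagram_equiv D D' >].

Lemma diagram_eqb_refl (R : realType) n : reflexive (@diagram_eqb R n).
Proof. by move=> D; apply/asboolP; exact: rst_refl. Qed.

Lemma diagram_eqb_sym (R : realType) n : symmetric (@diagram_eqb R n).
Proof. by move=> D D'; apply/asboolP/asboolP; exact: rst_sym. Qed.

Lemma diagram_eqb_trans (R : realType) n : transitive (@diagram_eqb R n).
Proof.
by move=> D2 D1 D3 /asboolP h1 /asboolP h2; apply/asboolP; exact: rst_trans h2.
Qed.

Canonical diagram_equiv_rel (R : realType) (n : nat) :=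
  EquivRel (@diagram_eqb R n) (@diagram_eqb_refl R n) (@diagram_eqb_sym R n)
    (@diagram_eqb_trans R n).

Definition STVB (R : realType) (n : nat) : Type :=
  {eq_quot diagram_equiv_rel R n}.

HB.instance Definition _ (R : realType) (n : nat) :=
  EqQuotient.on (STVB R n).

Definition braid_class (R : realType) (n : nat) (D : diagram R n) : STVB R n :=
  \pi_(STVB R n) D.

Definition stvb_mul (R : realType) (n : nat) (x y : STVB R n) : STVB R n :=
  braid_class (stack (repr x) (repr y)).

Definition stvb_one (R : realType) (n : nat) : STVB R n :=
  braid_class (trivial_diagram n).

Definition elementary_braid (R : realType) (n : nat) (x : stvb_gen n) :
    STVB R n :=
  braid_class (elementary_diagram x).

(* Main.v *)
(* Read a diagram from top to bottom: each double point and each bar (an event)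
   gives a letter, whose index is the number of strands on its left.

   Equivalent diagrams give congruent words.  An isotopy preserves the side of a
   strand on which an event lies, hence the letters; and if it inverts the
   heights of two events, then at some time they are at the same height, so that
   they involve separated positions and their letters commute.  In a local
   replacement the events beside the box commute with those inside, so that the
   latter can be made consecutive, where they read a shifted copy of the move.

   Conversely, diagrams that read the same word are equivalent.  A vertical
   isotopy makes the heights of the events distinct, a second one aligns them
   with those of the other diagram.  Then the strands are in the same order at
   every height, and the diagrams are joined by the linear interpolation
   D_t = (1 - t) D + t D', which is carried by the ambient isotopy
   H_t(x, y) = ((1 - t) x + t psi(x, y), y), where psi(x, y) is the minimum over
   the strands j of D'_j(y) + max(M (x - D_j(y)), (x - D_j(y)) / M); transversality
   and compactness bound the ratio of the gaps of D' to those of D between 1 / M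
   and M, which ensures that psi(D_j(y), y) = D'_j(y).  Finally each defining
   relation relates two words that are read on equivalent diagrams: a local move,
   or, for a commutation, a single diagram with two events at the same height. *)

Require Import Defs.
From mathcomp Require Import all_boot all_order all_algebra.
From mathcomp Require Import all_classical all_reals all_analysis.
From mathcomp Require Import perm generic_quotient zify ring lra.
From Stdlib Require Import Relation_Operators.

Set Implicit Arguments.
Unset Strict Implicit.
Unset Printing Implicit Defensive.

Import Order.TTheory GRing.Theory Num.Theory.
Import numFieldNormedType.Exports.

(** * Words *)

Section Words.
Variable n : nat.
Implicit Types (x y : stvb_gen n) (u v w a b : seq (stvb_gen n)).

(** A diagram has no canonical word: events at one height can be listed in any order. So [reads] is
    a relation, and words are compared up to congruence. Every reordering of events is reduced to
    [trace_congr], where only the inverted pairs have to commute.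

    In the horizontal isotopy the obstacle is the boundary, which must be fixed pointwise. A
    constant bound [M] greater than 1 would not make psi the identity there, so the bound depends on
    the height: it is [1 + K * slack D D' y], where [slack] is the sum of the |D'_j - D_j| plus y (1
    - y). This vanishes at both ends and is positive in between. Near the ends it still dominates
    the deviation of the gap ratios from 1, because the gaps at the ends are at least 1.

    Vertical isotopies must preserve transversality, which is stated with derivatives. Hence a
    change of height is piecewise affine with its breaks away from the crossings, and the two
    strands of a crossing are reparametrized there with the same slope. *)

Definition congr u v : Prop := word_congruence (@stvb_rel n) u v.

Lemma congr_refl u : congr u u.
Proof. exact: rst_refl. Qed.

Lemma congr_sym u v : congr u v -> congr v u.
Proof. exact: rst_sym. Qed.

Lemma congr_trans v u w : congr u v -> congr v w -> congr u w.
Proof. exact: rst_trans. Qed.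

Lemma congr_rel u v : stvb_rel u v -> congr u v.
Proof. by move=> uv; apply: rst_step; exists [::], [::], u, v; rewrite !cats0. Qed.

Lemma congr_ctx a b u v : congr u v -> congr (a ++ u ++ b) (a ++ v ++ b).
Proof.
elim=> [{}u {}v [a' [b' [l [r [lr -> ->]]]]]|{}u|{}u {}v _ ?|{}u {}v w _ uv _ vw].
- by apply: rst_step; exists (a ++ a'), (b' ++ b), l, r; rewrite !catA.
- exact: congr_refl.
- exact: congr_sym.
- exact: congr_trans vw.
Qed.

Lemma congr_cat u u' v v' : congr u u' -> congr v v' -> congr (u ++ v) (u' ++ v').
Proof.
move=> uu' vv'; apply: (@congr_trans (u' ++ v)).
  exact: (@congr_ctx [::] v).
by have := @congr_ctx u' [::] _ _ vv'; rewrite !cats0.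
Qed.

Lemma congr_cons x u v : congr u v -> congr (x :: u) (x :: v).
Proof. by move=> uv; apply: (@congr_cat [:: x] [:: x]); [exact: congr_refl|]. Qed.

Definition kind x : option crossing_type :=
  match x with
  | sigma _ => Some Positive
  | sigmaV _ => Some Negative
  | virt _ => Some Virtual
  | tau _ => Some Singular
  | gamma _ => None
  end.

Definition idx x : nat :=
  match x with
  | sigma i => i | sigmaV i => i | virt i => i | tau i => i | gamma k => k
  end.

Definition width x : nat := if kind x is Some _ then 2 else 1.

Lemma kind_idx_inj x y : kind x = kind y -> idx x = idx y -> x = y.
Proof. by case: x y => i [] j //= _ /val_inj ->. Qed.

Lemma idx_width x : (idx x + width x <= n)%N.
Proof.
by case: x => i; rewrite /width/= ?addn2 ?addn1; case: n i => [[]|m [i hi]].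
Qed.

Lemma gen_of_crossing c i : (i.+1 < n)%N -> exists2 x, kind x = Some c & idx x = i.
Proof.
move=> hi; have hi' : (i < n.-1)%N by case: n hi.
by case: c; [exists (sigma (Ordinal hi'))|exists (sigmaV (Ordinal hi'))
  |exists (virt (Ordinal hi'))|exists (tau (Ordinal hi'))].
Qed.

Definition commute_words x y : Prop := congr [:: x; y] [:: y; x].

Lemma commute_words_sym x y : commute_words x y -> commute_words y x.
Proof. exact: congr_sym. Qed.

(** The presentation lists no commutation for [sigmaV]. It follows from that of [sigma] by inserting
    [x x'] on the right, commuting [x] with [y], and cancelling [x' x] on the left. *)
Lemma commute_cancel x x' y : congr [:: x; x'] [::] -> congr [:: x'; x] [::] ->
  commute_words x y -> commute_words x' y.
Proof.
move=> xx' x'x xy; apply: (@congr_trans [:: x'; y; x; x']).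
  by have := @congr_ctx [:: x'; y] [::] _ _ (congr_sym xx'); rewrite /= ?cats0.
apply: (@congr_trans [:: x'; x; y; x']).
  exact: (@congr_ctx [:: x'] [:: x'] _ _ (congr_sym xy)).
exact: (@congr_ctx [::] [:: y; x'] _ _ x'x).
Qed.

(** A letter occupies the positions from [idx] up to [idx + width], excluded. Disjointness of these
    intervals treats crossings and bars uniformly. *)
Definition separated x y : bool :=
  (idx x + width x <= idx y)%N || (idx y + width y <= idx x)%N.

Lemma separated_commute x y : separated x y -> commute_words x y.
Proof.
have sV i z : commute_words (sigma i) z -> commute_words (sigmaV i) z.
  by apply: commute_cancel; apply: congr_rel; constructor.
have sV' i z : commute_words z (sigma i) -> commute_words z (sigmaV i).
  by move=> /commute_words_sym/sV/commute_words_sym.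
have far_sym (i j : 'I_n.-1) : far i j = far j i by rewrite /far orbC.
have bar (i : 'I_n.-1) (k : 'I_n) :
    (i + 2 <= k)%N || (k + 1 <= i)%N -> (k != pos_l i) && (k != pos_r i).
  by rewrite -!val_eqE /=; lia.
(* Each [sigmaV] is first turned into [sigma]; the remaining commutations are relations, possibly
   read from right to left or with the indices exchanged. *)
rewrite /separated; case: x => i; case: y => j; rewrite /width /= => h;
  do ?[apply: sV|apply: sV'];
  try (have {h}h : far i j by move: h; rewrite /far; lia);
  try (have {h}/andP[h1 h2] := bar _ _ h);
  try (rewrite orbC in h; have {h}/andP[h1 h2] := bar _ _ h);
  try (by apply: congr_rel; constructor);
  by apply: congr_sym; apply: congr_rel; constructor; rewrite // far_sym.
Qed.

(* Bubble sort: the entries preceding the head of the first list in the second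
   one are inverted with it, hence commute with it. *)
Lemma trace_congr (T : eqType) (f : T -> stvb_gen n) (r r' : rel T) s s' :
  uniq s -> perm_eq s s' -> pairwise r s -> pairwise r' s' ->
  (forall p q, p \in s -> q \in s -> p != q -> r p q -> r' q p ->
    commute_words (f p) (f q)) ->
  congr (map f s) (map f s').
Proof.
elim: s s' => [|e s IH] s' us pss' rs rs' inv.
  by move: pss'; rewrite perm_sym => /perm_nilP ->; exact: congr_refl.
have es' : e \in s' by rewrite -(perm_mem pss') mem_head.
case/splitPr: es' pss' rs' => A B pss' rs'.
have {}pss' : perm_eq s (A ++ B).
  by move: pss'; rewrite -[e :: B]cat1s perm_sym perm_catCA perm_sym perm_cons.
move: us => /= /andP[es us]; move: rs => /= /andP[/allP res rs].
have IHs : congr (map f s) (map f (A ++ B)).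
  apply: IH => //.
    move: rs'; rewrite !pairwise_cat => /and3P[/allrelP rAB -> /= /andP[_ ->]].
    by rewrite !andbT; apply/allrelP => p q pA qB; apply: rAB; rewrite ?inE ?qB ?orbT.
  by move=> p q ps qs; apply: inv; rewrite inE ?ps ?qs orbT.
apply: (@congr_trans (f e :: map f (A ++ B))); first exact: congr_cons.
suff h : congr (f e :: map f A) (map f A ++ [:: f e]).
  by have := @congr_ctx [::] (map f B) _ _ h; rewrite !map_cat /= -catA.
have {}inv p : p \in A -> commute_words (f e) (f p).
  move=> pA; have ps : p \in s by rewrite (perm_mem pss') mem_cat pA.
  apply: inv; rewrite ?mem_head ?inE ?ps ?orbT//.
  - by apply: contraNneq es => ->.
  - exact: res.
  - move: rs'; rewrite pairwise_cat => /and3P[/allrelP rAB _ _].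
    by apply: rAB => //; exact: mem_head.
elim: A {rs' pss' IHs} inv => [|p A IHA] inv; first exact: congr_refl.
apply: (@congr_trans (f p :: f e :: map f A)).
  by apply: (@congr_ctx [::] (map f A) _ _ (inv p _)); exact: mem_head.
by apply: congr_cons; apply: IHA => q qA; apply: inv; rewrite inE qA orbT.
Qed.

End Words.

(** * Words placed on more strands *)

Section ShiftWords.
Variables (k n m : nat) (hmk : (m + k <= n)%N).

Lemma shift_cross_subproof (i : 'I_k.-1) : (m + i < n.-1)%N.
Proof.
have hi := pos_r_subproof i.
have h : ((m + i).+1 < n)%N by apply: leq_trans hmk; rewrite -addnS ltn_add2l.
by case: n h.
Qed.

Lemma shift_bar_subproof (i : 'I_k) : (m + i < n)%N.
Proof. by apply: leq_trans hmk; rewrite ltn_add2l. Qed.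

Definition shift_gen (x : stvb_gen k) : stvb_gen n :=
  match x with
  | sigma i => sigma (Ordinal (shift_cross_subproof i))
  | sigmaV i => sigmaV (Ordinal (shift_cross_subproof i))
  | virt i => virt (Ordinal (shift_cross_subproof i))
  | tau i => tau (Ordinal (shift_cross_subproof i))
  | gamma i => gamma (Ordinal (shift_bar_subproof i))
  end.

Lemma kind_shift x : kind (shift_gen x) = kind x.
Proof. by case: x. Qed.

Lemma idx_shift x : idx (shift_gen x) = (m + idx x)%N.
Proof. by case: x. Qed.

(** Every local move is one of the defining relations, and shifting all indices by [m] gives an
    instance of the same relation. *)
Lemma move_shift u v : stvb_move u v ->
  congr (map shift_gen u) (map shift_gen v).
Proof.
have pl (i : 'I_k.-1) : Ordinal (shift_bar_subproof (pos_l i)) =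
    pos_l (Ordinal (shift_cross_subproof i)) by exact: val_inj.
have pr (i : 'I_k.-1) : Ordinal (shift_bar_subproof (pos_r i)) =
    pos_r (Ordinal (shift_cross_subproof i)) by apply: val_inj; rewrite /= addnS.
by case=> * /=; rewrite ?pl ?pr; apply: congr_rel; constructor => //=;
  rewrite -addnS; congr addn.
Qed.

End ShiftWords.

Local Open Scope classical_set_scope.
Local Open Scope ring_scope.

(** * Letters of a diagram *)

(** Paths clamped into the strip are defined and continuous on the whole line. Composing with them
    turns continuity within the strip into plain continuity, in which the intermediate value theorem
    is applied below. *)
Lemma continuous_within_comp (X Y Z : topologicalType) (A : set Y) (h : Y -> Z)
    (q : X -> Y) :
  {within A, continuous h} -> continuous q -> (forall z, A (q z)) ->
  continuous (h \o q).
Proof.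
move=> /subspace_continuousP hA cq Aq z; apply: cvg_trans (hA _ (Aq z)).
move=> B; rewrite /= !nbhs_simpl /within /= => hB.
have := cq z _ hB.
by move=> /(@filterS _ (nbhs z)); apply => z' /(_ (Aq z')).
Qed.

Lemma continuous_pair (X Y Z : topologicalType) (f : X -> Y) (g : X -> Z) :
  continuous f -> continuous g -> continuous (fun x => (f x, g x)).
Proof. by move=> cf cg x; exact: (cvg_pair (cf x) (cg x)). Qed.

Section Clamp.
Context {R : realType}.
Implicit Types (a b x y : R) (f g : R -> R).

(** A retraction onto [a, b] when [a <= b]. It replaces a strand, whose values outside [0, 1] are
    arbitrary, by a function that is continuous on all of R. *)
Definition clamp a b y : R := Num.max a (Num.min b y).

Lemma clamp_id a b y : a <= y <= b -> clamp a b y = y.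
Proof.
by rewrite /clamp => /andP[ay yb]; rewrite (min_idPr yb) (max_idPr ay).
Qed.

Lemma clamp_itv a b y : a <= b -> a <= clamp a b y <= b.
Proof.
by move=> ab; rewrite /clamp le_max lexx /= ge_max ab ge_min lexx.
Qed.

Lemma continuous_clamp a b : continuous (clamp a b).
Proof.
by move=> y; apply: continuous_max; [exact: cst_continuous|];
  apply: continuous_min; [exact: cst_continuous|exact: cvg_id].
Qed.

(** At every [y] one of the two clamps on the right equals [b]. Gluing thus becomes a sum, to which
    continuity passes without one-sided limits. *)
Lemma clamp_glue f a b c y : a <= b -> b <= c ->
  f (clamp a c y) = f (clamp a b y) + f (clamp b c y) - f b.
Proof.
move=> ab bc; case: (leP y b) => yb.
  have -> : clamp b c y = b.
    by rewrite /clamp (min_idPr (le_trans yb bc)) (max_idPl yb).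
  by rewrite addrK /clamp (min_idPr yb) (min_idPr (le_trans yb bc)).
have -> : clamp a b y = b by rewrite /clamp (min_idPl (ltW yb)) (max_idPr ab).
rewrite addrC addKr /clamp.
have bm : b <= Num.min c y by rewrite le_min bc (ltW yb).
by rewrite (max_idPr bm) (max_idPr (le_trans ab bm)).
Qed.

Lemma smooth_continuous f : smooth f -> continuous f.
Proof.
move=> sf x; apply: differentiable_continuous; apply/derivable1_diffP.
exact: (sf 0%N x).
Qed.

Lemma psmooth_continuous f a b : piecewise_smooth f a b ->
  continuous (f \o clamp a b).
Proof.
elim=> [{}a {}b h ab hh fh|{}a {}b c fab IH1 fbc IH2].
  have -> : f \o clamp a b = h \o clamp a b.
    by apply/funext => y /=; rewrite fh// in_itv/= clamp_itv.
  move=> y; apply: continuous_comp; first exact: continuous_clamp.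
  exact: smooth_continuous.
have [ab bc] := (psmooth_le fab, psmooth_le fbc).
have -> : f \o clamp a c = (f \o clamp a b) \+ (f \o clamp b c) \- cst (f b).
  by apply/funext => y /=; rewrite (clamp_glue _ _ ab bc).
move=> y; apply: continuousB; last exact: cst_continuous.
by apply: continuousD; [exact: IH1|exact: IH2].
Qed.

Lemma no_zero_mul f a b : continuous f -> a <= b ->
  (forall y, a <= y <= b -> f y != 0) -> 0 < f a * f b.
Proof.
move=> cf ab f0; rewrite lt_neqAle eq_sym mulf_neq0 ?f0 ?lexx ?ab//=.
rewrite leNgt; apply/negP => fab.
have [|c] := @IVT _ f a b 0 ab (continuous_subspaceT cf).
  rewrite ge_min le_max; move: fab; case: (ltgtP (f a) 0) => fa.
  - by rewrite nmulr_rlt0//= => /ltW ->; rewrite ?orbT.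
  - by rewrite pmulr_rlt0//= => /ltW ->; rewrite ?orbT.
  - by rewrite fa mul0r ltxx.
by rewrite in_itv/= => /f0/eqP.
Qed.

End Clamp.

Section Letters.
Context {R : realType} {n : nat}.
Implicit Types (D : diagram R n) (p q : R * R) (l : 'I_n).

Definition strandc D l : R -> R := strand D l \o clamp 0 1.

Lemma strandc_continuous D l : continuous (strandc D l).
Proof. exact: psmooth_continuous (strand_psmooth D l). Qed.

Lemma strandcE D l y : 0 <= y <= 1 -> strandc D l y = strand D l y.
Proof. by rewrite /strandc /= => /clamp_id ->. Qed.

Definition event D p : Prop := double_point D p \/ bars D p.

Lemma event_strip D p : event D p -> 0 < p.2 < 1.
Proof.
case=> [[j [k [jk [/andP[p0 p1] jp] [_ kp]]]]|/bars_on[]//].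
have jkp : strand D j p.2 = strand D k p.2 by rewrite jp kp.
rewrite !lt_neqAle p0 p1 !andbT; apply/andP; split; apply/eqP => e.
  move: jkp jk; rewrite -e !strand_bottom => /endpoint_inj/perm_inj ->.
  by rewrite eqxx.
by move: jkp jk; rewrite e !strand_top => /endpoint_inj ->; rewrite eqxx.
Qed.

Lemma lt01_le01 (y : R) : 0 < y < 1 -> 0 <= y <= 1.
Proof. by case/andP => /ltW -> /ltW ->. Qed.

Lemma bar_not_double D p : bars D p -> ~ double_point D p.
Proof.
move=> /bars_on[_ [j [_ jp]]] [k [l [kl [_ kp] [_ lp]]]].
have E m : strand D m p.2 = p.1 -> m = j.
  by move=> mp; apply/eqP; apply: contraPT (mp) => /jp/eqP.
by move: kl; rewrite (E k)// (E l)// eqxx.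
Qed.

(* The number of strands on the left of p. *)
Definition pos D p : nat := #|[pred l | strand D l p.2 < p.1]|.

Definition cpos D p : nat := #|[pred l | strand D l p.2 <= p.1]|.

Definition kind_at D p : option crossing_type :=
  if `[< double_point D p >] then Some (label D p) else None.

Definition width_at D p : nat := if kind_at D p is Some _ then 2 else 1.

(** The strands through [p], two at a double point and one at a bar, are counted by [cpos] and not
    by [pos]. Hence the letter of [p] fits on [n] strands. *)
Lemma pos_width D p : event D p -> (pos D p + width_at D p <= cpos D p)%N.
Proof.
move=> ep; rewrite /width_at /kind_at; case: asboolP => dp.
  have [j [k [jk [_ jp] [_ kp]]]] := dp.
  have <- : #|[:: j; k]| = 2%N by rewrite (card_uniqP _)//= inE jk.
  rewrite -cardUI [X in (_ + X)%N]eq_card0 ?addn0 => [|l].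
    apply: subset_leq_card; apply/fintype.subsetP => l; rewrite !inE.
    by case/orP => [/ltW//|/orP[]/eqP ->]; rewrite ?jp ?kp.
  rewrite !inE; apply/negP => /andP[+ /orP[]/eqP le];
    by rewrite le ?jp ?kp ltxx.
case: ep => [//|bp]; have [_ [j [jp _]]] := bars_on bp.
rewrite addn1; apply: proper_card; apply/properP; split.
  by apply/fintype.subsetP => l; rewrite !inE => /ltW.
by exists j; rewrite !inE jp ?ltxx.
Qed.

Definition is_letter D p (x : stvb_gen n) : Prop :=
  kind x = kind_at D p /\ idx x = pos D p.

Lemma is_letter_width D p x : is_letter D p x -> width x = width_at D p.
Proof. by rewrite /width /width_at => -[->]. Qed.

Lemma is_letter_exists D p : event D p -> exists x, is_letter D p x.
Proof.
move=> ep; have := pos_width ep.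
have : (cpos D p <= n)%N by rewrite -[X in (_ <= X)%N]card_ord max_card.
rewrite /is_letter /width_at /kind_at; case: asboolP => dp cn pw.
  have [|x kx ix] := @gen_of_crossing n (label D p) (pos D p).
    by move: (leq_trans pw cn); rewrite addn2.
  by exists x.
by move: (leq_trans pw cn); rewrite addn1 => pn; exists (gamma (Ordinal pn)).
Qed.

Variable hn : (0 < n)%N.

(* The value at a point that is not an event is irrelevant. *)
Definition letter D p : stvb_gen n :=
  if pselect (exists x, is_letter D p x) is left ex then sval (cid ex)
  else gamma (Ordinal hn).

Lemma letterP D p : event D p -> is_letter D p (letter D p).
Proof.
move=> /is_letter_exists ex; rewrite /letter; case: pselect => // ex'.
by case: cid.
Qed.

Lemma is_letter_uniq D D' p p' x x' : is_letter D p x -> is_letter D' p' x' ->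
  kind_at D p = kind_at D' p' -> pos D p = pos D' p' -> x = x'.
Proof.
by move=> [kx ix] [kx' ix'] kk pp; apply: kind_idx_inj; rewrite ?kx ?ix ?kk ?pp.
Qed.

Lemma letterE D p x : is_letter D p x -> letter D p = x.
Proof.
move=> px; rewrite /letter; case: pselect => [ex|[]]; last by exists x.
by case: cid => y /= py; exact: is_letter_uniq py px erefl erefl.
Qed.

(** A strand that passes through the left event or to its left is strictly left of the right one, so
    [cpos] of the first is at most [pos] of the second. *)
Lemma same_height_separated D p q : event D p -> event D q -> p != q ->
  p.2 = q.2 -> separated (letter D p) (letter D q).
Proof.
have key p' q' : event D p' -> event D q' -> p'.2 = q'.2 -> p'.1 < q'.1 ->
    (idx (letter D p') + width (letter D p') <= idx (letter D q'))%N.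
  move=> ep eq pq2 pq1; have /is_letter_width -> := letterP ep.
  have [_ ->] := letterP ep; have [_ ->] := letterP eq.
  apply: leq_trans (pos_width ep) _; rewrite /cpos /pos.
  apply: subset_leq_card; apply/fintype.subsetP => l.
  by rewrite !inE pq2 => /le_lt_trans; apply.
move=> ep eq pq pq2; rewrite /separated; case: (ltgtP p.1 q.1) => pq1.
- by rewrite key.
- by rewrite orbC key.
- by case: p q pq pq2 pq1 {ep eq} => [? ?] [? ?] /= /eqP + e1 e2; rewrite e1 e2.
Qed.

(** The order is not strict: events at a common height may be listed either way, so a diagram can
    have several readings. *)
Definition reading D (ps : seq (R * R)) : Prop :=
  [/\ uniq ps, sorted (fun p q => q.2 <= p.2) ps & forall p, p \in ps <-> event D p].

Definition reads D (w : seq (stvb_gen n)) : Prop :=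
  exists2 ps, reading D ps & w = map (letter D) ps.

Lemma reading_pairwise D ps : reading D ps -> pairwise (fun p q => q.2 <= p.2) ps.
Proof.
case=> _ + _; rewrite sorted_pairwise//.
by move=> q p r /= pq qr; exact: le_trans qr pq.
Qed.

End Letters.

Section Carry.
Context {R : realType} {n : nat}.
Variables (D D' : diagram R n) (h : R * R -> R * R).
Hypotheses (hh : self_homeomorphism strip h)
  (hb : forall p, p.2 = 0 \/ p.2 = 1 -> h p = p)
  (hc : carries strip h id D D').
Implicit Types (p q : R * R) (l : 'I_n).

Lemma carry_strip p : strip p -> strip (h p).
Proof. by move=> sp; have [_ [g _ /(_ p sp)[]]] := hh. Qed.

Lemma carry_inj p q : strip p -> strip q -> h p = h q -> p = q.
Proof.
have [_ [g _ hg]] := hh.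
move=> /hg[_ _ + _] /hg[_ _ + _] e.
by rewrite e => -> ->.
Qed.

Lemma carry_surj q : strip q -> exists2 p, strip p & h p = q.
Proof. by have [_ [g _ hg]] := hh; move=> /hg[_ ? _ ?]; exists (g q). Qed.

Lemma carry_on l p : strip p -> on_strand D' l (h p) <-> on_strand D l p.
Proof.
move=> sp; have [-> _ _] := hc sp; split=> [[j -> //]|lp].
by exists l.
Qed.

Lemma carry_double p : strip p -> double_point D' (h p) <-> double_point D p.
Proof.
by move=> sp; split=> -[j [k [jk jp kp]]]; exists j, k; split=> //;
  apply/carry_on.
Qed.

(* The parallel of the strand through p leads, off the strand, to a point of
   the top boundary, which h fixes. *)
Lemma carry_side l p : strip p ->
  0 < (p.1 - strand D l p.2) * ((h p).1 - strand D' l (h p).2) \/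
  p.1 = strand D l p.2 /\ (h p).1 = strand D' l (h p).2.
Proof.
move=> sp; have [e|ne] := eqVneq p.1 (strand D l p.2).
  by right; split=> //; have [_ ->] := (carry_on l sp).2 (conj sp (esym e)).
left; set d := p.1 - strand D l p.2.
have d0 : d != 0 by rewrite subr_eq0.
pose q (z : R) := (strandc D l z + d, clamp 0 1 z).
have sq z : strip (q z) by rewrite /strip/= clamp_itv.
pose f z := (h (q z)).1 - strandc D' l (h (q z)).2.
have cq : continuous q.
  apply: continuous_pair; last exact: continuous_clamp.
  by move=> z; apply: cvgD; [exact: strandc_continuous|exact: cvg_cst].
have chq : continuous (h \o q).
  by apply: continuous_within_comp cq sq; have [] := hh.
have cf : continuous f.
  have c1 : continuous (fst \o (h \o q)).
    by move=> z; apply: continuous_comp (chq z) _; exact: cvg_fst.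
  have c2 : continuous (strandc D' l \o (snd \o (h \o q))).
    move=> z; apply: continuous_comp; last exact: strandc_continuous.
    by apply: continuous_comp (chq z) _; exact: cvg_snd.
  by move=> z; exact: cvgB (c1 z) (c2 z).
have fE z : f z = (h (q z)).1 - strand D' l (h (q z)).2.
  by rewrite /f strandcE//; exact: carry_strip.
have i1 : 0 <= (1 : R) <= 1 by rewrite ler01 lexx.
have qp : q p.2 = p.
  by rewrite /q strandcE// clamp_id// /d addrC subrK -surjective_pairing.
have q1 : q 1 = (endpoint R l + d, 1).
  by rewrite /q strandcE// clamp_id// strand_top.
have f1 : f 1 = d.
  by rewrite fE q1 hb/= ?strand_top ?(addrC _ d) ?addrK//; right.
have /andP[p0 p1] := sp; have := @no_zero_mul _ f p.2 1 cf p1.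
rewrite f1 fE qp.
rewrite mulrC; apply => z /andP[pz z1]; apply: contra d0.
rewrite fE subr_eq0 => /eqP e.
have : on_strand D' l (h (q z)) by split; [exact: carry_strip|].
move=> /(carry_on l (sq z))[_] /=; rewrite /strandc /=.
by rewrite -{1}[strand _ _ _]addr0 => /addrI <-.
Qed.

Lemma carry_lt l p : strip p ->
  (strand D' l (h p).2 < (h p).1) = (strand D l p.2 < p.1).
Proof.
move=> sp; rewrite -subr_gt0 -[RHS]subr_gt0.
have [|[e e']] := carry_side l sp; last by rewrite e e' !subrr.
case: (ltgtP (p.1 - strand D l p.2) 0) => d0.
- by rewrite nmulr_rgt0// => /ltW; rewrite ltNge => ->.
- by rewrite pmulr_rgt0// => ->.
- by rewrite d0 mul0r ltxx.
Qed.

Lemma carry_pos p : strip p -> pos D' (h p) = pos D p.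
Proof. by move=> sp; apply: eq_card => l; rewrite !inE carry_lt. Qed.

Lemma carry_kind p : strip p -> kind_at D' (h p) = kind_at D p.
Proof.
move=> sp; rewrite /kind_at; have [_ hl _] := hc sp.
case: asboolP => d'; case: asboolP => d //.
- by rewrite hl.
- by move/carry_double: d' => /(_ sp).
- by move/carry_double: d => /(_ sp).
Qed.

Lemma carry_event p : strip p -> event D' (h p) <-> event D p.
Proof.
move=> sp; rewrite /event; have [_ _ ->] := hc sp.
by have -> := carry_double sp.
Qed.

Lemma carry_letter hn p : strip p -> event D p ->
  letter hn D' (h p) = letter hn D p.
Proof.
move=> sp ep; apply: letterE; have [kp ip] := letterP hn ep.
by split; rewrite ?carry_kind ?carry_pos.
Qed.

End Carry.

(** * Invariance under isotopy *)

Section DeriveBounds.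
Context {R : realType}.
Implicit Types (f : R -> R) (x y a e : R).

Lemma is_derive_near_le f y a e : is_derive y 1 f a -> 0 < e ->
  \forall z \near y, `|f z - f y - a * (z - y)| <= e * `|z - y|.
Proof.
move=> [df <-] e0; move/cvgrPdist_le: df => /(_ e e0).
rewrite near_withinE => -[d /= d0 hd]; exists d => // z /=.
rewrite distrC => zd; have [->|zy] := eqVneq z y.
  by rewrite !subrr mulr0 subrr normr0 mulr0.
have zy0 : z - y != 0 by rewrite subr_eq0.
have := hd (z - y); rewrite /ball_ /= sub0r normrN => /(_ zd zy0).
rewrite /derive /= !/GRing.scale /= mulr1 subrK => h.
rewrite -(@ler_pM2l _ `|z - y|) ?normr_gt0// in h.
rewrite [leRHS]mulrC; apply: le_trans h; rewrite [leLHS]distrC -normrM.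
by set L := lim _; have -> : (z - y) * (L - (z - y)^-1 * (f z - f y)) =
  L * (z - y) - (f z - f y) by field.
Qed.

Lemma is_derive_sign f y a : is_derive y 1 f a -> a != 0 ->
  \forall z \near y, z != y -> 0 < a * (f z - f y) * (z - y).
Proof.
move=> df a0; have e0 : 0 < `|a| / 2 by rewrite divr_gt0 ?normr_gt0.
apply: filterS (is_derive_near_le df e0) => z hz zy.
have : a * (z - y) != 0 by rewrite mulf_neq0 ?subr_eq0.
move: hz; rewrite mulrAC -normrM mulrAC.
set u := f z - f y; set p := a * (z - y) => h p0.
have {h} /andP[h1 h2] : - (`|p| / 2) <= u - p <= `|p| / 2 by rewrite -ler_norml.
move: h1 h2; case: (ltgtP p 0) p0 => // pz _.
  by rewrite (ltr0_norm pz) => h1 h2; rewrite nmulr_rgt0//; lra.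
by rewrite (gtr0_norm pz) => h1 h2; rewrite pmulr_rgt0//; lra.
Qed.

(* For the filter of the sets of candidates that contain a given finite set,
   local finiteness is a property that holds near every point, so that near
   covering gives a finite set that contains all the zeros. *)
Lemma isolated_finite (K : set R) (Z : set R) : compact K ->
  (forall x, K x -> \forall y \near x, Z y -> y = x) -> finite_set (K `&` Z).
Proof.
move=> /compact_near_coveringP cK iso.
pose F : set_system (set R) :=
  filter_from finite_set (fun S0 : set R => [set S | S0 `<=` S]).
have FF : Filter F.
  apply: filter_from_filter; first by exists set0.
  move=> A B fA fB; exists (A `|` B); first by rewrite finite_setU.
  by move=> S /= ABS; split=> x ?; apply: ABS; [left|right].
have [x Kx|S0 fS0 /(_ S0)/= h] := cK _ F (fun S y => Z y -> S y) FF.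
  exists ([set y | Z y -> y = x], [set S | S x]) => /=.
    split; first exact: iso.
    by exists [set x] => //= S /(_ x); apply.
  by move=> [y S] /= [yx Sx] Zy; rewrite yx.
apply: sub_finite_set fS0 => x [Kx Zx].
by apply: h.
Qed.

End DeriveBounds.

(** * Finiteness of the set of events *)

Section ReadingExists.
Context {R : realType} {n : nat}.
Implicit Types (D : diagram R n).

Lemma strandc_interior D l (y : R) : 0 < y < 1 ->
  \forall z \near y, strand D l z = strandc D l z.
Proof.
move=> /andP[y0 y1]; near=> z; rewrite strandcE//; apply/andP; split; apply/ltW.
  by near: z; exact: lt_nbhsr.
by near: z; exact: lt_nbhsl.
Unshelve. all: by end_near. Qed.

Lemma double_interior D j k (y : R) : 0 <= y <= 1 -> j != k ->
  strand D j y = strand D k y -> 0 < y < 1.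
Proof.
move=> y01 jk e; have := @event_strip R n D (strand D j y, y); apply.
by left; exists j, k; split=> //; split; rewrite //= e.
Qed.

Lemma is_derive_sub (f g : R -> R) (y a b : R) : is_derive y 1 f a -> is_derive y 1 g b ->
  is_derive y 1 (fun z => f z - g z) (a - b).
Proof. by move=> df dg; exact: is_deriveB. Qed.

(** Where the strands meet, their difference has a nonzero derivative by transversality; elsewhere
    it is nonzero nearby by continuity. *)
Lemma strand_isolated D j k (y : R) : 0 <= y <= 1 -> j != k ->
  \forall z \near y, 0 <= z <= 1 -> strand D j z = strand D k z -> z = y.
Proof.
move=> y01 jk; have [e|ne] := eqVneq (strand D j y) (strand D k y).
  have [a [b [da db ab]]] := strand_transverse y01 jk e.
  have ab0 : a - b != 0 by rewrite subr_eq0.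
  apply: filterS (is_derive_sign (is_derive_sub da db) ab0) => z h z01 ez.
  apply/eqP; apply: contraT => /h.
  by rewrite ez e !subrr mulr0 mul0r ltxx.
have c : continuous (fun z => strandc D j z - strandc D k z).
  by move=> z; apply: cvgB; exact: strandc_continuous.
have : strandc D j y - strandc D k y != 0 by rewrite subr_eq0 !strandcE.
move=> /(cvgr_neq0 _ (c y)); apply: filterS => z h z01 ez.
by move: h; rewrite !strandcE// ez subrr eqxx.
Qed.

Lemma finite_events D : finite_set (event D).
Proof.
have dp : finite_set (double_point D).
  pose B (x : 'I_n * 'I_n) := (fun y => (strand D x.1 y, y)) @`
    (`[0, 1] `&` [set y | 0 <= y <= 1 /\ x.1 != x.2 /\ strand D x.1 y = strand D x.2 y]).
  apply: (@sub_finite_set _ _ (\bigcup_(x in [set: 'I_n * 'I_n]) B x)).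
    move=> p [j [k [jk [p01 jp] [_ kp]]]]; exists (j, k) => //=.
    exists p.2; last by rewrite /= jp -surjective_pairing.
    by split; [rewrite /= in_itv|rewrite /= jp kp].
  apply: bigcup_finite => // x _; apply: finite_image.
  have [jk|jk] := eqVneq x.1 x.2.
    by rewrite [X in finite_set X](_ : _ = set0)// -subset0 => y [_ /= []] ? [].
  apply: isolated_finite; first exact: segment_compact.
  move=> y; rewrite /= in_itv/= => y01.
  by apply: filterS (strand_isolated D y01 jk) => z h [z01 [_ e]]; exact: h.
apply: (@sub_finite_set _ _ (double_point D `|` bars D)) => [p|]; first by case; [left|right].
by rewrite finite_setU; split=> //; exact: bars_finite.
Qed.

Lemma reading_exists D : exists ps, reading D ps.
Proof.
have /finite_seqP[s hs] := finite_events D.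
pose r (p q : R * R) := q.2 <= p.2.
exists (sort r (undup s)); split.
- by rewrite sort_uniq undup_uniq.
- by apply: sort_sorted => p q; exact: le_total.
- by move=> p; rewrite mem_sort mem_undup; have := congr1 (@^~ p) hs => /= ->.
Qed.

Lemma reads_exists hn D : exists w, reads hn D w.
Proof. by have [ps rp] := reading_exists D; exists (map (letter hn D) ps), ps. Qed.

End ReadingExists.

Section IsotopyReads.
Context {R : realType} {n : nat} (hn : (0 < n)%N).
Implicit Types (D : diagram R n).

(** Pulled back by [g], the second reading is another ordering of the same events with the same
    letters, to which [trace_congr] applies. This serves for isotopies and, with identity maps, for
    two readings of one diagram. *)
Lemma same_reading_congr D ps (D' : diagram R n) ps' (g h : R * R -> R * R) :
  reading D ps -> reading D' ps' ->
  (forall q, event D' q -> [/\ event D (g q), h (g q) = q &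
     letter hn D (g q) = letter hn D' q]) ->
  (forall p, event D p -> event D' (h p) /\ g (h p) = p) ->
  (forall p q, event D p -> event D q -> p != q -> q.2 <= p.2 ->
     (h p).2 <= (h q).2 -> commute_words (letter hn D p) (letter hn D q)) ->
  congr (map (letter hn D) ps) (map (letter hn D') ps').
Proof.
move=> rp rp' hg hh inv.
have [up _ ep] := rp; have [up' _ ep'] := rp'.
have -> : map (letter hn D') ps' = map (letter hn D) (map g ps').
  rewrite -map_comp; apply/eq_in_map => q /ep' eq /=.
  by have [_ _ ->] := hg _ eq.
have ug : uniq (map g ps').
  rewrite map_inj_in_uniq// => p q /ep' ep1 /ep' eq1 e.
  by have [_ <- _] := hg _ ep1; have [_ <- _] := hg _ eq1; rewrite e.
apply: (@trace_congr _ _ _ (fun p q => q.2 <= p.2) (fun p q => (h q).2 <= (h p).2)).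
- exact: up.
- apply: uniq_perm => // p; apply/idP/mapP => [/ep ep1|[q /ep' eq ->]].
    have [e1 e2] := hh _ ep1; exists (h p); [exact/ep'|by rewrite e2].
  by apply/ep; have [] := hg _ eq.
- exact: reading_pairwise rp.
- rewrite pairwise_map; apply: (@sub_in_pairwise _ (mem ps')) (reading_pairwise rp').
    by move=> p q /ep' e1 /ep' e2 /=; have [_ -> _] := hg _ e1; have [_ -> _] := hg _ e2.
  exact/allP.
- by move=> p q /ep ? /ep ?; exact: inv.
Qed.

Lemma isotopic_congr D D' w w' : isotopic D D' -> reads hn D w -> reads hn D' w' ->
  congr w w'.
Proof.
move=> [H [cH HD H0 H1]] [ps rp ->] [ps' rp' ->].
have i1 : 0 <= (1 : R) <= 1 by rewrite ler01 lexx.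
have [hh hb _] := HD _ i1; have [_ [g _ hg]] := hh.
have ss (E : diagram R n) p : event E p -> strip p.
  by move=> /event_strip/lt01_le01.
apply: (@same_reading_congr _ _ _ _ g (H 1)) rp rp' _ _ _.
- move=> q eq; have sq := ss _ _ eq; have [_ sgq _ hgq] := hg _ sq.
  have egq : event D (g q) by apply/(carry_event H1 sgq); rewrite hgq.
  split=> //; rewrite -[in RHS]hgq; apply/esym.
  exact: (carry_letter hh hb H1).
- move=> p ep; have sp := ss _ _ ep; split; first exact/(carry_event H1 sp).
  by have [] := hg _ sp.
- move=> p q ep eq pq hpq hpq'.
  have [sp sq] := (ss _ _ ep, ss _ _ eq).
  pose f z (t : R) := (H (clamp 0 1 t) z).2.
  have cf z : strip z -> continuous (f z).
    move=> sz; pose c (t : R) := (clamp 0 1 t, z).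
    have cc : continuous c.
      by apply: continuous_pair; [exact: continuous_clamp|exact: cst_continuous].
    have cHc : continuous ((fun r : R * (R * R) => H r.1 r.2) \o c).
      apply: continuous_within_comp cH cc _ => t.
      by split=> //=; rewrite in_itv/= clamp_itv.
    by move=> t; apply: continuous_comp (cHc t) _; exact: cvg_snd.
  have cpq : continuous (fun t => f p t - f q t).
    by move=> t; exact: cvgB (cf p sp t) (cf q sq t).
  have [|t] := @IVT _ _ 0 1 0 ler01 (continuous_subspaceT cpq).
    rewrite /f !clamp_id ?lexx ?ler01// !H0// ge_min le_max !subr_ge0 !subr_le0.
    by rewrite hpq hpq' orbT.
  rewrite in_itv/= => t01 /eqP; rewrite /f clamp_id// subr_eq0 => /eqP e.
  have [hht hbt [Dt ct]] := HD _ t01.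
  rewrite -(carry_letter hht hbt ct hn sp ep) -(carry_letter hht hbt ct hn sq eq).
  apply: separated_commute; apply: same_height_separated e.
  + exact/(carry_event ct sp).
  + exact/(carry_event ct sq).
  + by apply: contra pq => /eqP/(carry_inj hht sp sq) ->.
Qed.

End IsotopyReads.

(** * Words of stacked and elementary diagrams *)

Section StackReads.
Context {R : realType} {n : nat} (hn : (0 < n)%N).
Variables D E : diagram R n.
Implicit Types (p q : R * R).

Let up p : R * R := (p.1, (p.2 + 1) / 2).
Let dn p : R * R := (p.1, p.2 / 2).

Let up_inj : injective up.
Proof. by case=> a b [c d] [/= -> e]; congr pair; lra. Qed.

Let dn_inj : injective dn.
Proof. by case=> a b [c d] [/= -> e]; congr pair; lra. Qed.

Let strand_up j p : strip p -> strand (stack D E) j (up p).2 = strand D j p.2.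
Proof.
move=> /andP[p0 p1] /=; rewrite stack_strand_upper; last by lra.
by congr strand; lra.
Qed.

Let strand_dn j p : strip p ->
  strand (stack D E) j (dn p).2 = strand E (strand_perm D j) p.2.
Proof.
move=> /andP[p0 p1] /=; rewrite stack_strand_lower; last by lra.
by congr strand; lra.
Qed.

Let strip_up p : strip p -> strip (up p).
Proof. by move=> /andP[p0 p1]; rewrite /strip /=; apply/andP; split; lra. Qed.

Let strip_dn p : strip p -> strip (dn p).
Proof. by move=> /andP[p0 p1]; rewrite /strip /=; apply/andP; split; lra. Qed.

Let on_up j p : strip p -> on_strand (stack D E) j (up p) <-> on_strand D j p.
Proof.
by move=> sp; rewrite /on_strand strand_up//; split=> -[_ e]; split=> //; exact: strip_up.
Qed.

Let on_dn j p : strip p ->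
  on_strand (stack D E) j (dn p) <-> on_strand E (strand_perm D j) p.
Proof.
by move=> sp; rewrite /on_strand strand_dn//; split=> -[_ e]; split=> //; exact: strip_dn.
Qed.

Let double_up p : strip p -> double_point (stack D E) (up p) <-> double_point D p.
Proof.
by move=> sp; split=> -[j [k [jk jp kp]]]; exists j, k; split=> //; exact/on_up.
Qed.

Let double_dn p : strip p -> double_point (stack D E) (dn p) <-> double_point E p.
Proof.
move=> sp; split=> -[j [k [jk jp kp]]].
  by exists (strand_perm D j), (strand_perm D k); rewrite (inj_eq perm_inj); split=> //;
    exact/on_dn.
exists ((strand_perm D)^-1%g j), ((strand_perm D)^-1%g k).
by rewrite (inj_eq perm_inj); split=> //; apply/on_dn; rewrite ?permKV.
Qed.

Let bars_up p : 0 < p.2 < 1 -> bars (stack D E) (up p) <-> bars D p.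
Proof.
move=> /andP[p0 p1]; split=> [[[q bq e]|[q /bars_on[/andP[q0 q1] _] [_ e]]]|bp].
- by move/up_inj: e => <-.
- by exfalso; move: e; lra.
- by left; exists p.
Qed.

Let bars_dn p : 0 < p.2 < 1 -> bars (stack D E) (dn p) <-> bars E p.
Proof.
move=> /andP[p0 p1]; split=> [[[q /bars_on[/andP[q0 q1] _] [_ e]]|[q bq e]]|bp].
- by exfalso; move: e; lra.
- by move/dn_inj: e => <-.
- by right; exists p.
Qed.

Let event_up p : 0 < p.2 < 1 -> event (stack D E) (up p) <-> event D p.
Proof.
move=> p01; have sp := lt01_le01 p01.
by rewrite /event; have -> := double_up sp; have -> := bars_up p01.
Qed.

Let event_dn p : 0 < p.2 < 1 -> event (stack D E) (dn p) <-> event E p.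
Proof.
move=> p01; have sp := lt01_le01 p01.
by rewrite /event; have -> := double_dn sp; have -> := bars_dn p01.
Qed.

Let kind_up p : 0 < p.2 < 1 -> kind_at (stack D E) (up p) = kind_at D p.
Proof.
move=> p01; have sp := lt01_le01 p01; rewrite /kind_at.
have -> : `[< double_point (stack D E) (up p) >] = `[< double_point D p >].
  by apply: asbool_equiv_eq; exact: double_up.
case: asboolP => // _; congr Some; rewrite /= /stack_label /=.
have -> : 2^-1 <= (p.2 + 1) / 2 by move/andP: p01 => [? ?]; lra.
by case: p {p01 sp} => a b /=; congr (label D (a, _)); lra.
Qed.

Let kind_dn p : 0 < p.2 < 1 -> kind_at (stack D E) (dn p) = kind_at E p.
Proof.
move=> p01; have sp := lt01_le01 p01; rewrite /kind_at.
have -> : `[< double_point (stack D E) (dn p) >] = `[< double_point E p >].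
  by apply: asbool_equiv_eq; exact: double_dn.
case: asboolP => // _; congr Some; rewrite /= /stack_label /=.
have -> : (2^-1 <= p.2 / 2) = false.
  by apply/negbTE; rewrite -ltNge; move/andP: p01 => [? ?]; lra.
by case: p {p01 sp} => a b /=; congr (label E (a, _)); lra.
Qed.

Let pos_up p : strip p -> pos (stack D E) (up p) = pos D p.
Proof. by move=> sp; apply: eq_card => l; rewrite !inE strand_up. Qed.

Let pos_dn p : strip p -> pos (stack D E) (dn p) = pos E p.
Proof.
move=> sp; rewrite /pos -!sum1_card [RHS](reindex_inj (@perm_inj _ (strand_perm D))).
by apply: eq_bigl => l; rewrite !inE -strand_dn.
Qed.

Let letter_up p : event D p -> letter hn (stack D E) (up p) = letter hn D p.
Proof.
move=> ep; have p01 := event_strip ep; apply: letterE; have [kp ip] := letterP hn ep.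
by split; rewrite ?kind_up// pos_up//; exact: lt01_le01.
Qed.

Let letter_dn p : event E p -> letter hn (stack D E) (dn p) = letter hn E p.
Proof.
move=> ep; have p01 := event_strip ep; apply: letterE; have [kp ip] := letterP hn ep.
by split; rewrite ?kind_dn// pos_dn//; exact: lt01_le01.
Qed.

Lemma reads_stack u v : reads hn D u -> reads hn E v -> reads hn (stack D E) (u ++ v).
Proof.
move=> [ps rp ->] [qs rq ->].
have [[up_ sp ep] [uq sq eq]] := (rp, rq).
exists (map up ps ++ map dn qs); last first.
  rewrite map_cat; congr cat; rewrite -map_comp; apply/eq_in_map.
    by move=> p /ep ? /=; rewrite letter_up.
  by move=> p /eq ? /=; rewrite letter_dn.
have ltdu p q : event D p -> event E q -> (dn q).2 < (up p).2.
  by move=> /event_strip/andP[? ?] /event_strip/andP[? ?] /=; lra.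
split.
- rewrite cat_uniq !map_inj_uniq// up_ uq andbT; apply/hasPn => _ /mapP[q /eq eq' ->].
  apply/mapP => -[p /ep ep' e].
  by have := ltdu _ _ ep' eq'; rewrite e ltxx.
- rewrite sorted_pairwise; last by move=> a b c /= ab bc; exact: le_trans bc ab.
  rewrite pairwise_cat !pairwise_map; apply/and3P; split.
  + apply/allrelP => _ _ /mapP[p /ep ? ->] /mapP[q /eq ? ->].
    exact/ltW/ltdu.
  + apply: sub_pairwise (reading_pairwise rp) => p q /=; by lra.
  + apply: sub_pairwise (reading_pairwise rq) => p q /=; by lra.
- move=> p; rewrite mem_cat; split=> [/orP[]/mapP[q /[dup] qs' + ->]|ep'].
  + by move=> /ep ep'; apply/event_up => //; exact: event_strip ep'.
  + by move=> /eq ep'; apply/event_dn => //; exact: event_strip ep'.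
  have /andP[p0 p1] := event_strip ep'; case: (ltgtP p.2 2^-1) => ph.
  + apply/orP; right; apply/mapP; exists (p.1, 2 * p.2).
      apply/eq/event_dn => /=; first by apply/andP; split; lra.
      by rewrite /dn /= (_ : 2 * p.2 / 2 = p.2) -?surjective_pairing//; lra.
    by rewrite /dn /= (_ : 2 * p.2 / 2 = p.2) -?surjective_pairing//; lra.
  + apply/orP; left; apply/mapP; exists (p.1, 2 * p.2 - 1).
      apply/ep/event_up => /=; first by apply/andP; split; lra.
      by rewrite /up /= (_ : (2 * p.2 - 1 + 1) / 2 = p.2) -?surjective_pairing//; lra.
    by rewrite /up /= (_ : (2 * p.2 - 1 + 1) / 2 = p.2) -?surjective_pairing//; lra.
  (* At the seam, of height 1/2, the strands are at distinct endpoints, and the bars of both factors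
     lie strictly inside their halves. *)
  + exfalso; case: ep' => [[j [k [jk [_ jp] [_ kp]]]]|].
      move: jp; rewrite -kp ph /= !stack_strand_lower// divff// !strand_top.
      by move=> /endpoint_inj/perm_inj/eqP; exact/negP.
    by case=> -[q /bars_on[/andP[? ?] _]] e; move: ph; rewrite -e /=; lra.
Qed.

End StackReads.

Section Elementary.
Context {R : realType} {n : nat}.
Implicit Types (x : stvb_gen n) (l : 'I_n) (p : R * R).

Lemma strand_elementary x :
  strand (elementary_diagram (R := R) x) = straight (strand_perm (elementary_diagram (R := R) x)).
Proof. by case: x. Qed.

Lemma perm_elementary x l : let s := strand_perm (elementary_diagram (R := R) x) in
  (idx x <= l < idx x + width x)%N /\ (idx x <= s l < idx x + width x)%N \/
  ~~ (idx x <= l < idx x + width x)%N /\ s l = l.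
Proof.
have sw (i : 'I_n.-1) : (i <= l < i + 2)%N /\ (i <= swap i l < i + 2)%N \/
    ~~ (i <= l < i + 2)%N /\ swap i l = l.
  rewrite /swap; case: tpermP => [->|->|/eqP + /eqP +]; rewrite -?val_eqE /=.
  - by left; split; lia.
  - by left; split; lia.
  - by move=> ? ?; right; split=> //; lia.
case: x => i /=; rewrite ?perm1; do ?exact: sw.
by case: (boolP (i <= l < i + 1)%N) => h; [left|right].
Qed.

Lemma straight_itv (s : {perm 'I_n}) l (a b y : R) : 0 <= y <= 1 ->
  a <= endpoint R l <= b -> a <= endpoint R (s l) <= b -> a <= straight s l y <= b.
Proof.
by rewrite /straight => /andP[? ?] /andP[? ?] /andP[? ?]; apply/andP; split; nra.
Qed.

Lemma card_ord_lt m : (m <= n)%N -> #|[pred l : 'I_n | (l < m)%N]| = m.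
Proof.
move=> mn; rewrite -sum1_card -[RHS]card_ord -sum1_card.
by rewrite (big_ord_widen n (fun=> 1%N) mn).
Qed.

Lemma endpoint_lt (j k : 'I_n) : (endpoint R j < endpoint R k) = (j < k)%N.
Proof. by rewrite /endpoint ltr_nat ltnS. Qed.

(** For a crossing, of width 2, the added half leads to the midpoint between two neighbouring
    endpoints; for a bar, of width 1, it vanishes. *)
Definition elem_point x : R * R := ((idx x).+1%:R + (width x).-1%:R / 2, 2^-1).

Lemma elementary_double c (i : 'I_n.-1) p :
  double_point (crossing_diagram (R := R) c i) p <-> p = (i.+1%:R + 1%:R / 2, 2^-1).
Proof.
have el : endpoint R (pos_l i) = i.+1%:R by [].
have er : endpoint R (pos_r i) = i.+1%:R + 1 by rewrite endpoint_pos_r el.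
split=> [[j [k [jk [sp jp] [_ kp]]]]|->].
  have e : straight (swap i) j p.2 = straight (swap i) k p.2 := etrans jp (esym kp).
  have hk := straight_swap_meet sp jk e.
  have hj := straight_swap_meet sp (_ : k != j) (esym e).
  rewrite eq_sym in jk; move: (hj jk) => {}hj.
  have {hk hj} : straight (swap i) (pos_l i) p.2 = p.1 /\ straight (swap i) (pos_r i) p.2 = p.1.
    move: jk jp kp => /=; case: hj => ->; case: hk => -> //; by rewrite eqxx.
  rewrite /straight /swap tpermL tpermR el er => -[e1 e2].
  by case: p sp e1 e2 {jp kp e} => a b /= /andP[? ?] e1 e2; congr pair; lra.
exists (pos_l i), (pos_r i); split.
- by rewrite -val_eqE /= neq_ltn ltnSn.
- split; first by rewrite /strip /=; apply/andP; split; lra.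
  by rewrite /= /straight /swap tpermL el er; lra.
- split; first by rewrite /strip /=; apply/andP; split; lra.
  by rewrite /= /straight /swap tpermR el er; lra.
Qed.

Lemma trivial_not_double (D : diagram R n) p :
  strand D = straight 1%g -> ~ double_point D p.
Proof.
move=> eD [j [k [jk [_ jp] [_ kp]]]]; move: jp.
by rewrite -kp eD !straight_id => /endpoint_inj/eqP; exact/negP.
Qed.

Lemma elementary_event x p : event (elementary_diagram x) p <-> p = elem_point x.
Proof.
have cross c (i : 'I_n.-1) : event (crossing_diagram c i) p <-> p = (i.+1%:R + 1%:R / 2, 2^-1).
  rewrite /event; have -> := elementary_double c i p.
  by split=> [[]//|]; left.
case: x => i //=; do ?exact: cross.
rewrite /elem_point /= mul0r addr0; split=> [[/trivial_not_double[]//|//]|->].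
by right.
Qed.

Lemma elementary_is_letter x : is_letter (elementary_diagram x) (elem_point x) x.
Proof.
have cross c (i : 'I_n.-1) : kind_at (crossing_diagram (R := R) c i) (i.+1%:R + 1%:R / 2, 2^-1) = Some c /\
    pos (crossing_diagram (R := R) c i) (i.+1%:R + 1%:R / 2, 2^-1) = i.
  split; first by rewrite /kind_at asboolT//; apply/elementary_double.
  have hi := pos_r_subproof i.
  rewrite /pos -[RHS](@card_ord_lt i) ?(ltnW (ltnW hi))//; apply: eq_card => l.
  rewrite !inE /= /straight /swap; case: tpermP => [->|->|/eqP + /eqP +].
  - by rewrite /endpoint /= ltnn; apply/negbTE; rewrite -leNgt; lra.
  - by rewrite /endpoint /= ltnNge ltnW//=; apply/negbTE; rewrite -leNgt; lra.
  rewrite -!val_eqE /= subrr mul0r add0r /endpoint => h1 h2.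
  case: (ltngtP l i) => li; last by rewrite li eqxx in h1.
    by apply: (lt_le_trans (y := i.+1%:R)); rewrite ?ltr_nat ?ltnS//; lra.
  apply/negbTE; rewrite -leNgt.
  have h : i.+2%:R <= (l.+1%:R : R) by rewrite ler_nat ltnS.
  by apply: le_trans h; rewrite [leRHS]mulrSr; lra.
case: x => i.
- by have [k p] := cross Positive i; split; [exact: esym k|exact: esym p].
- by have [k p] := cross Negative i; split; [exact: esym k|exact: esym p].
- by have [k p] := cross Virtual i; split; [exact: esym k|exact: esym p].
- by have [k p] := cross Singular i; split; [exact: esym k|exact: esym p].
split=> /=.
  by rewrite /kind_at asboolF//; exact: trivial_not_double.
rewrite /pos -[LHS](@card_ord_lt i) ?(ltnW (ltn_ord i))//; apply: eq_card => l.
by rewrite !inE /= straight_id mul0r addr0 -[i.+1%:R]/(endpoint R i) endpoint_lt.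
Qed.

Lemma reads_elementary hn x : reads hn (elementary_diagram (R := R) x) [:: x].
Proof.
exists [:: elem_point x]; last by rewrite /= (letterE hn (elementary_is_letter x)).
split=> // p; rewrite inE; split=> [/eqP|/elementary_event ->//].
by move/elementary_event.
Qed.

Lemma reads_trivial hn : reads hn (trivial_diagram (R := R) n) [::].
Proof.
exists [::] => //; split=> // p; split=> // -[/trivial_not_double|//].
by move=> /(_ erefl).
Qed.

Lemma reads_word hn (w : seq (stvb_gen n)) : reads hn (word_diagram (R := R) w) w.
Proof.
elim: w => [|x w IH]; first exact: reads_trivial.
by apply: (@reads_stack _ _ _ _ _ [:: x]) => //; exact: reads_elementary.
Qed.

(** The vertical sides of [box k] lie one unit further out on each side, so the strands of a word
    never touch them. *)
Lemma word_diagram_itv (w : seq (stvb_gen n)) l (y : R) : 0 <= y <= 1 ->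
  1 <= strand (word_diagram (R := R) w) l y <= n%:R.
Proof.
have end1 (k : 'I_n) : 1 <= endpoint R k <= n%:R.
  by rewrite /endpoint ler_nat ltn_ord -[leLHS]/(1%:R) ler_nat.
elim: w l y => [|x w IH] l y y01; first exact: straight_itv.
have /andP[y0 y1] := y01; rewrite /word_diagram /eval_word /=.
case: (leP 2^-1 y) => yh.
  rewrite stack_strand_upper// strand_elementary; apply: straight_itv => //.
  by apply/andP; split; lra.
rewrite stack_strand_lower; last exact: ltW.
by have /(IH (strand_perm (elementary_diagram (R := R) x) l)) : 0 <= 2 * y <= 1
  by apply/andP; split; lra.
Qed.

Lemma elem_point_itv x : (idx x).+1%:R <= (elem_point x).1 /\
  (elem_point x).1 <= (idx x + width x)%:R.
Proof.
rewrite natrD /elem_point /= mulrSr; move: (idx x)%:R => a.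
by rewrite /width; case: (kind x) => [c|] /=; split; lra.
Qed.

End Elementary.

(** * Two letters at one height *)

Section Beside.
Context {R : realType} {n : nat}.
Variables (x y : stvb_gen n).
Hypothesis hxy : (idx x + width x <= idx y)%N.
Let m := idx y.
Let D : diagram R n := elementary_diagram x.
Let E : diagram R n := elementary_diagram y.

Let mn : (m <= n)%N.
Proof. by apply: leq_trans (idx_width y); exact: leq_addr. Qed.

Let endD (l : 'I_n) : (l < m)%N -> 0 <= endpoint R l <= m%:R.
Proof. by move=> lm; rewrite /endpoint ler_nat lm ler0n. Qed.

Let endE (l : 'I_n) : (m <= l)%N -> m%:R + 1 <= endpoint R l <= n%:R.
Proof. by move=> lm; rewrite /endpoint -mulrSr !ler_nat ltnS lm ltn_ord. Qed.

Let DR (l : 'I_n) z : (m <= l)%N -> strand D l z = endpoint R l.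
Proof.
move=> ml; rewrite strand_elementary /straight.
case: (@perm_elementary R n x l) => /= [[h _]|[_ ->]].
  by move: h hxy; rewrite -/m -?/D -?/E; lia.
by rewrite subrr mul0r add0r.
Qed.

Let DL (l : 'I_n) z : (l < m)%N -> 0 <= z <= 1 -> strand D l z <= m%:R.
Proof.
move=> lm z01; rewrite strand_elementary.
suff : 0 <= straight (strand_perm D) l z <= m%:R by case/andP.
apply: straight_itv z01 (endD lm) _; apply: endD.
case: (@perm_elementary R n x l) => /= [[_ h]|[_ ->]] //.
by move: h hxy; rewrite -/m -?/D -?/E; lia.
Qed.

Let EL (l : 'I_n) z : (l < m)%N -> strand E l z = endpoint R l.
Proof.
move=> lm; rewrite strand_elementary /straight.
case: (@perm_elementary R n y l) => /= [[h _]|[_ ->]].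
  by move: h; rewrite -/m -?/D -?/E; lia.
by rewrite subrr mul0r add0r.
Qed.

Let ER (l : 'I_n) z : (m <= l)%N -> 0 <= z <= 1 -> m%:R + 1 <= strand E l z.
Proof.
move=> ml z01; rewrite strand_elementary.
suff : m%:R + 1 <= straight (strand_perm E) l z <= n%:R by case/andP.
apply: straight_itv z01 (endE ml) _; apply: endE.
case: (@perm_elementary R n y l) => /= [[_ h]|[_ ->]] //.
by move: h; rewrite -/m -?/D -?/E; lia.
Qed.

Let evD : event D (elem_point x). Proof. exact/elementary_event. Qed.
Let evE : event E (elem_point y). Proof. exact/elementary_event. Qed.

Let xD : (elem_point (R := R) x).1 <= m%:R.
Proof.
by apply: le_trans (elem_point_itv x).2 _; rewrite ler_nat.
Qed.

Let xE : m%:R + 1 <= (elem_point (R := R) y).1.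
Proof. by have := (elem_point_itv (R := R) y).1; rewrite [_.+1%:R]mulrSr. Qed.

(** The endpoint of index [j] is at [j + 1]. So the strands of index less than [m] stay at abscissas
    at most [m], the others at least [m + 1], and the band in between separates the two juxtaposed
    elementary diagrams. *)
Let st (j : 'I_n) : R -> R := if (j < m)%N then strand D j else strand E j.

Let st_side (j : 'I_n) z : 0 <= z <= 1 -> if (j < m)%N then st j z <= m%:R else m%:R + 1 <= st j z.
Proof.
by move=> z01; rewrite /st; case: (ltnP j m) => jm; [exact: DL|exact: ER].
Qed.

Let st_meet j k z : 0 <= z <= 1 -> st j z = st k z -> (j < m)%N = (k < m)%N.
Proof.
move=> z01 e; have := st_side j z01; have := st_side k z01; rewrite -e.
by case: (j < m)%N; case: (k < m)%N => // h1 h2; exfalso; lra.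
Qed.

Let st_perm : {perm 'I_n} := (strand_perm D * strand_perm E)%g.

Let st_top j : st j 1 = endpoint R j.
Proof. by rewrite /st; case: ifP => _; rewrite strand_top. Qed.

Let st_bottom j : st j 0 = endpoint R (st_perm j).
Proof.
rewrite /st /st_perm permM; case: (ltnP j m) => jm.
  rewrite strand_bottom; congr endpoint.
  have pm : (strand_perm D j < m)%N.
    case: (@perm_elementary R n x j) => /= [[_ h]|[_ ->]] //.
    by move: h hxy; rewrite -/m -?/D -?/E; lia.
  by have := strand_bottom E (strand_perm D j); rewrite EL// => /endpoint_inj.
rewrite strand_bottom; congr (endpoint _ (_ _)).
by have := strand_bottom D j; rewrite DR// => /endpoint_inj.
Qed.

Let st_psmooth j : piecewise_smooth (st j) 0 1.
Proof. by rewrite /st; case: ifP => _; exact: strand_psmooth. Qed.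

Let st_double (j k l : 'I_n) z : 0 <= z <= 1 -> j != k -> k != l -> j != l ->
  ~ (st j z = st k z /\ st k z = st l z).
Proof.
move=> z01 jk kl jl [e1 e2]; have m1 := st_meet z01 e1; have m2 := st_meet z01 e2.
suff : ~ (st j z = st k z /\ st k z = st l z) by apply; split.
rewrite /st m1 m2; case: ifP => _.
  exact: (@strand_double _ _ D j k l z).
exact: (@strand_double _ _ E j k l z).
Qed.

Let st_transverse (j k : 'I_n) z : 0 <= z <= 1 -> j != k -> st j z = st k z ->
  exists a b : R, [/\ is_derive z 1 (st j) a, is_derive z 1 (st k) b & a != b].
Proof.
move=> z01 jk e; have m1 := st_meet z01 e; move: e.
rewrite /st m1; case: ifP => _ e; first exact: (@strand_transverse _ _ D).
exact: (@strand_transverse _ _ E).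
Qed.

Let st_bars_on p : (bars D `|` bars E) p -> 0 < p.2 < 1 /\
  exists j, st j p.2 = p.1 /\ forall k, k != j -> st k p.2 != p.1.
Proof.
move=> bp; have p01 : 0 < p.2 < 1 by case: bp => /bars_on[].
split=> //; have s01 := lt01_le01 p01.
have [px|px] : p.1 <= m%:R /\ bars D p \/ m%:R + 1 <= p.1 /\ bars E p.
  case: bp => b; [left|right]; split=> //.
    by have /elementary_event -> : event D p := or_intror b.
  by have /elementary_event -> : event E p := or_intror b.
- have [_ [j [jp nj]]] := bars_on px.2.
  have jm : (j < m)%N.
    rewrite ltnNge; apply/negP => mj; have := endE mj.
    by rewrite -(DR p.2 mj) jp => /andP[]; have := px.1; lra.
  exists j; rewrite /st jm; split=> // k kj; case: (ltnP k m) => km; first exact: nj.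
  by apply/eqP => e; have := ER km s01; rewrite e; have := px.1; lra.
- have [_ [j [jp nj]]] := bars_on px.2.
  have jm : (m <= j)%N.
    rewrite leqNgt; apply/negP => mj; have := endD mj.
    by rewrite -(EL p.2 mj) jp => /andP[]; have := px.1; lra.
  exists j; rewrite /st ltnNge jm; split=> // k kj; case: (ltnP k m) => km; last exact: nj.
  by apply/eqP => e; have := DL km s01; rewrite e; have := px.1; lra.
Qed.

Let st_bars_finite : finite_set (bars D `|` bars E).
Proof. by rewrite finite_setU; split; exact: bars_finite. Qed.

Definition beside : diagram R n :=
  @Diagram R n st st_perm (fun p => if p.1 <= m%:R then label D p else label E p)
    (bars D `|` bars E) st_top st_bottom st_psmooth st_double st_transverse
    st_bars_finite st_bars_on.

Let beside_left p : strip p -> p.1 <= m%:R ->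
  [/\ double_point beside p <-> double_point D p, pos beside p = pos D p &
      kind_at beside p = kind_at D p].
Proof.
move=> sp px.
have L j (F : diagram R n) : on_strand beside j p -> (j < m)%N /\ on_strand D j p.
  case=> _ jp; have := st_side j sp; move: jp; rewrite /= /st.
  by case: ifP => jm jp; rewrite ?jp => h; [|exfalso; lra].
have L' j : on_strand D j p -> on_strand beside j p.
  case=> _ jp; split=> //=; rewrite /st; case: ltnP => // mj.
  by have := endE mj; rewrite -(DR p.2 mj) jp => /andP[]; lra.
have dd : double_point beside p <-> double_point D p.
  split=> -[j [k [jk jp kp]]]; exists j, k; split=> //; try exact: L'.
    by have [] := L j D jp.
  by have [] := L k D kp.
split=> //.
  apply: eq_card => l; rewrite !inE /= /st; case: ltnP => // ml.
  rewrite DR//; have /andP[h _] := endE ml; have h' := ER ml sp.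
  by apply/idP/idP; lra.
rewrite /kind_at /= px; by have -> := asbool_equiv_eq dd.
Qed.

Let beside_right p : strip p -> m%:R + 1 <= p.1 ->
  [/\ double_point beside p <-> double_point E p, pos beside p = pos E p &
      kind_at beside p = kind_at E p].
Proof.
move=> sp px.
have L j : on_strand beside j p -> on_strand E j p.
  case=> _ jp; have := st_side j sp; move: jp; rewrite /= /st.
  by case: ifP => jm jp; rewrite ?jp => h; [exfalso; lra|].
have L' j : on_strand E j p -> on_strand beside j p.
  case=> _ jp; split=> //=; rewrite /st; case: ltnP => // mj.
  by have := endD mj; rewrite -(EL p.2 mj) jp => /andP[]; lra.
have dd : double_point beside p <-> double_point E p.
  by split=> -[j [k [jk jp kp]]]; exists j, k; split=> //; do ?[exact: L'|exact: L].
split=> //.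
  apply: eq_card => l; rewrite !inE /= /st; case: ltnP => // ml.
  rewrite EL//; have /andP[_ h] := endD ml; have h' := DL ml sp.
  by apply/idP/idP; lra.
rewrite /kind_at /= (_ : p.1 <= m%:R = false); last by apply/negbTE; rewrite -ltNge; lra.
by have -> := asbool_equiv_eq dd.
Qed.

Let beside_event p : event beside p <-> p = elem_point x \/ p = elem_point y.
Proof.
have sx : strip (elem_point (R := R) x) by apply: lt01_le01; exact: event_strip evD.
have sy : strip (elem_point (R := R) y) by apply: lt01_le01; exact: event_strip evE.
split=> [[dp|[bp|bp]]|[->|->]].
- have [j [k [jk jp kp]]] := dp; have sp : strip p := jp.1.
  case: (leP p.1 m%:R) => px.
    left; apply/elementary_event; left; by have [<-] := beside_left sp px.
  have {}px : m%:R + 1 <= p.1; last first.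
    by right; apply/elementary_event; left; have [<-] := beside_right sp px.
  have := st_side j sp; have := jp.2; rewrite /= => <-.
  by case: ifP => // _ h; exfalso; move: px; rewrite -(jp.2) /=; lra.
- by left; apply/elementary_event; right.
- by right; apply/elementary_event; right.
- case: evD => [d|b]; last by right; left.
  by left; have [-> _ _] := beside_left sx xD.
- case: evE => [d|b]; last by right; right.
  by left; have [-> _ _] := beside_right sy xE.
Qed.

Lemma reads_beside hn : reads hn beside [:: x; y] /\ reads hn beside [:: y; x].
Proof.
have sx : strip (elem_point (R := R) x) by apply: lt01_le01; exact: event_strip evD.
have sy : strip (elem_point (R := R) y) by apply: lt01_le01; exact: event_strip evE.
have lx : letter hn beside (elem_point x) = x.
  apply: letterE; have [k i] := elementary_is_letter (R := R) x.
  by have [_ pe ke] := beside_left sx xD; split; rewrite ?pe ?ke.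
have ly : letter hn beside (elem_point y) = y.
  apply: letterE; have [k i] := elementary_is_letter (R := R) y.
  by have [_ pe ke] := beside_right sy xE; split; rewrite ?pe ?ke.
have ne : elem_point (R := R) x != elem_point y.
  by apply/eqP => e; have := xD; rewrite e; have := xE; lra.
split; [exists [:: elem_point x; elem_point y]|exists [:: elem_point y; elem_point x]];
  rewrite /= ?lx ?ly//; split; rewrite /= ?inE ?andbT ?lexx// 1?eq_sym//.
- move=> p; rewrite !inE beside_event.
  by split=> [/orP[]/eqP ->|[]->]; rewrite ?eqxx ?orbT; [left|right| |].
- move=> p; rewrite !inE beside_event.
  by split=> [/orP[]/eqP ->|[]->]; rewrite ?eqxx ?orbT; [right|left| |].
Qed.

End Beside.

(** * Invariance under local replacement *)

Section Box.
Context {R : realType} {k n : nat} (hk : (0 < k)%N) (hn : (0 < n)%N).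
Variables (P : diagram R k) (D : diagram R n) (a b c d : R) (iota : 'I_k -> 'I_n).
Implicit Types (p q : R * R) (l : 'I_n) (j : 'I_k).
Let A p : R * R := (a + b * p.1, c + d * p.2).
Hypotheses (b0 : 0 < b) (d0 : 0 < d) (c0 : 0 <= c) (cd1 : c + d <= 1).
Hypothesis cP : carries (box k) A iota P D.
Hypothesis hP : forall j (y : R), 0 <= y <= 1 -> 1 <= strand P j y <= k%:R.

Let B : set (R * R) := A @` box k.

Let B_E p : B p <-> a <= p.1 <= a + b * k.+1%:R /\ c <= p.2 <= c + d.
Proof.
split=> [[q [/andP[? ?] /andP[? ?]] <-] /=|[/andP[h1 h2] /andP[h3 h4]]].
  have [? ?] := (b0, d0); by split; apply/andP; split; nra.
exists ((p.1 - a) / b, (p.2 - c) / d); last first.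
  rewrite /A /= !mulrA ![_ * (_ - _)]mulrC -!mulrA !divff ?gt_eqF// !mulr1.
  by rewrite ![_ + (_ - _)]addrC !subrK -surjective_pairing.
split=> /=; apply/andP; split.
- by rewrite divr_ge0 ?subr_ge0// ltW.
- by rewrite ler_pdivrMr// mulrC lerBlDl.
- by rewrite divr_ge0 ?subr_ge0// ltW.
- by rewrite ler_pdivrMr// mul1r lerBlDl.
Qed.

Let A_inj : injective A.
Proof.
case=> x y [x' y'] [] /addrI/mulfI + /addrI/mulfI.
by rewrite !gt_eqF// => -> // ->.
Qed.

Let window_strip p : c <= p.2 <= c + d -> strip p.
Proof. by have [? ?] := (c0, cd1); move=> /andP[? ?]; rewrite /strip /=; apply/andP; split; lra. Qed.

Let box_window p : box k p -> c <= (A p).2 <= c + d.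
Proof. by have ? := d0; case=> _ /andP[? ?] /=; apply/andP; split; nra. Qed.

Let in_box j (y : R) : 0 <= y <= 1 -> box k (strand P j y, y).
Proof.
move=> y01; split=> //=; have /andP[h1 h2] := hP j y01; apply/andP; split; first by lra.
by apply: le_trans h2 _; rewrite ler_nat.
Qed.

Let strand_iota j (y : R) : 0 <= y <= 1 ->
  strand D (iota j) (c + d * y) = a + b * strand P j y.
Proof.
move=> y01; have [/(_ (iota j))[_ h] _ _] := cP (in_box j y01).
by case: h => [|_ ->//]; exists j.
Qed.

Let iota_inj : injective iota.
Proof.
move=> j j' e; have i1 : 0 <= (1 : R) <= 1 by rewrite ler01 lexx.
have := strand_iota j i1; rewrite e strand_iota// !strand_top => /addrI/mulfI.
by rewrite gt_eqF// => /(_ isT)/endpoint_inj ->.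
Qed.

Let unwindow (y : R) : c <= y <= c + d -> exists2 z, 0 <= z <= 1 & y = c + d * z.
Proof.
move=> /andP[h1 h2]; exists ((y - c) / d); last first.
  by rewrite mulrCA divff ?gt_eqF// mulr1 addrC subrK.
by rewrite divr_ge0 ?subr_ge0 ?(ltW d0)//= ler_pdivrMr// mul1r lerBlDl.
Qed.

Let inside l (y : R) : c <= y <= c + d -> B (strand D l y, y) -> l \in codom iota.
Proof.
move=> hy [p pb e]; have [/(_ l)[h _] _ _] := cP pb.
have : on_strand D l (A p) by rewrite e; split=> //; exact: window_strip.
by move=> /h[j -> _]; exact: codom_f.
Qed.

Let strand_codom l (y : R) : c <= y <= c + d -> l \in codom iota ->
  a < strand D l y < a + b * k.+1%:R.
Proof.
move=> /unwindow[z z01 ->] /codomP[j ->]; rewrite strand_iota//.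
have /andP[h1 h2] := hP j z01; rewrite ltrDl ltrD2l ltr_pM2l// mulr_gt0//=; last by lra.
by apply: le_lt_trans h2 _; rewrite ltr_nat.
Qed.

Let sides l (y : R) : c <= y <= c + d -> l \notin codom iota ->
  strand D l y < a \/ a + b * k.+1%:R < strand D l y.
Proof.
move=> hy lc; have : ~ B (strand D l y, y) by move=> /(inside hy); exact/negP.
case: (ltP (strand D l y) a) => h1; first by left.
case: (ltP (a + b * k.+1%:R) (strand D l y)) => h2; first by right.
by case; apply/B_E; rewrite h1 h2.
Qed.

(** A strand that does not come from [P] misses the box at all heights of the window, so by the
    intermediate value theorem it cannot change sides. *)
Let side_const l (y : R) : c <= y <= c + d -> l \notin codom iota ->
  (strand D l y < a) = (strand D l c < a).
Proof.
move=> hy lc; have /andP[cy yd] := hy.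
have ab : a < a + b * k.+1%:R by rewrite ltrDl mulr_gt0.
have h z : c <= z <= c + d -> 0 <= z <= 1 by move=> /(@window_strip (0, z)).
have cc : c <= c <= c + d by rewrite lexx lerDl ltW.
have cf : continuous (fun z => strandc D l z - a).
  by move=> z; apply: cvgB; [exact: strandc_continuous|exact: cvg_cst].
have := no_zero_mul cf cy; rewrite !strandcE ?h//; move=> nz.
have {nz} : 0 < (strand D l c - a) * (strand D l y - a).
  apply: nz => z /andP[cz zy]; have zz : c <= z <= c + d by rewrite cz (le_trans zy).
  rewrite strandcE ?h// subr_eq0; have [] := sides zz lc; first by move/lt_eqF ->.
  by move=> /(lt_trans ab)/gt_eqF ->.
rewrite -[LHS]subr_lt0 -[RHS]subr_lt0.
case: (ltgtP (strand D l c - a) 0) => h0.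
- by rewrite nmulr_rgt0.
- by rewrite pmulr_rgt0// => /ltW; rewrite leNgt => /negbTE.
- by rewrite h0 mul0r ltxx.
Qed.

(** The amount by which positions in [P] are shifted in [D]. By [side_const] the count at the lowest
    height [c] is valid throughout the window. *)
Definition box_left : nat := #|[pred l | (l \notin codom iota) && (strand D l c < a)]|.

Lemma box_left_le : (box_left + k <= n)%N.
Proof.
rewrite -[k in (_ + k)%N]card_ord -(card_codom iota_inj) -[X in (_ <= X)%N]card_ord.
rewrite -cardUI [X in (_ + X)%N]eq_card0 ?addn0 ?max_card// => l.
by rewrite !inE; case: (l \in codom iota); rewrite ?andbF.
Qed.

Let box_double p : box k p -> double_point D (A p) <-> double_point P p.
Proof.
move=> pb; have [h _ hb] := cP pb.
split=> -[l [l' [ll' lp lp']]].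
  move: lp lp' ll' => /h[j -> jp] /h[j' -> jp'] jj'; exists j, j'; split=> //.
  by apply: contra jj' => /eqP ->.
exists (iota l), (iota l'); rewrite (inj_eq iota_inj); split=> //; apply/h.
  by exists l.
by exists l'.
Qed.

Let box_event p : box k p -> event D (A p) <-> event P p.
Proof.
by move=> pb; have [_ _ hb] := cP pb; rewrite /event hb; have -> := box_double pb.
Qed.

Let box_kind p : box k p -> kind_at D (A p) = kind_at P p.
Proof.
move=> pb; rewrite /kind_at (asbool_equiv_eq (box_double pb)).
by case: asboolP => // dp; have [_ -> //] := cP pb.
Qed.

Let box_pos p : box k p -> pos D (A p) = (box_left + pos P p)%N.
Proof.
move=> pb; have hy := box_window pb; have p01 : 0 <= p.2 <= 1 by case: pb.
have -> : pos P p = #|[pred l | (l \in codom iota) && (strand D l (A p).2 < (A p).1)]|.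
  rewrite /pos -(fintype.card_image iota_inj); apply: eq_card => l; rewrite !inE.
  apply/fintype.imageP/andP => [[j + ->]|[/codomP[j ->]]].
    by rewrite inE codom_f strand_iota// ltrD2l ltr_pM2l.
  by rewrite strand_iota// ltrD2l ltr_pM2l// => h; exists j.
rewrite /box_left -cardUI [X in (_ + X)%N]eq_card0 ?addn0; last first.
  by move=> l; rewrite !inE; case: (l \in codom iota); rewrite ?andbF.
apply: eq_card => l; rewrite !inE; case: (boolP (l \in codom iota)) => lc //=.
rewrite orbF -(side_const hy lc).
have [/andP[x0 xk] _] := pb; have [h|h] := sides hy lc.
  by rewrite h (lt_le_trans h)// lerDl mulr_ge0// ltW.
have hx : (A p).1 <= a + b * k.+1%:R by rewrite lerD2l ler_pM2l.
have ha : a <= (A p).1 by rewrite lerDl mulr_ge0// ltW.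
have := le_lt_trans hx h => h'; rewrite !ltNge (ltW h') (ltW (le_lt_trans ha h')).
by [].
Qed.

Let box_letter p : box k p -> event P p ->
  letter hn D (A p) = shift_gen box_left_le (letter hk P p).
Proof.
move=> pb ep; have [kp ip] := letterP hk ep.
by apply: letterE; split; rewrite ?kind_shift ?idx_shift ?box_kind ?box_pos ?kp ?ip.
Qed.

Let event_box p : event P p -> box k p.
Proof.
move=> ep; have p01 := lt01_le01 (event_strip ep).
have [j jp] : exists j, strand P j p.2 = p.1.
  case: ep => [[j [_ [_ [_ jp] _]]]|/bars_on[_ [j [jp _]]]]; by exists j.
by have := in_box j p01; rewrite jp -surjective_pairing.
Qed.

(** The letters of the box use positions between [box_left] and [box_left + k]. An event on the left
    has [cpos] at most [box_left]; one on the right has on its left all strands of the box and all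
    those left of the box. *)
Let window_separated p q : event P p -> event D q -> ~ B q -> c <= q.2 <= c + d ->
  separated (letter hn D q) (letter hn D (A p)).
Proof.
move=> ep eq qB qw; have pb := event_box ep.
have eAp : event D (A p) by apply/box_event.
have [_ iq] := letterP hn eq; have wq := is_letter_width (letterP hn eq).
rewrite /separated box_letter// idx_shift iq wq; apply/orP.
have [ql|ql] : q.1 < a \/ a + b * k.+1%:R < q.1.
  case: (ltP q.1 a) => h1; first by left.
  case: (ltP (a + b * k.+1%:R) q.1) => h2; first by right.
  by case: qB; apply/B_E; rewrite h1 h2.
- left; apply: leq_trans (pos_width eq) _; apply: leq_trans (leq_addr _ _).
  apply: subset_leq_card; apply/fintype.subsetP => l; rewrite !inE => lq.
  have lc : l \notin codom iota.
    apply/negP => /(strand_codom qw)/andP[h _].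
    by have := lt_le_trans h lq; rewrite ltNge (ltW ql).
  by rewrite lc -(side_const qw lc) (le_lt_trans lq).
- right; rewrite /width kind_shift -/(width _) -addnA.
  apply: (@leq_trans (box_left + k)); first by rewrite leq_add2l idx_width.
  rewrite -[k in (_ + k)%N]card_ord -(card_codom iota_inj) -cardUI.
  rewrite [X in (_ + X)%N]eq_card0 ?addn0; last first.
    by move=> l; rewrite !inE; case: (l \in codom iota); rewrite ?andbF.
  apply: subset_leq_card; apply/fintype.subsetP => l; rewrite !inE.
  case: (boolP (l \in codom iota)) => lc /=.
    by have /andP[_ h] := strand_codom qw lc; rewrite (lt_trans h).
  rewrite orbF -(side_const qw lc) => h; apply: lt_trans ql; apply: lt_trans h _.
  by rewrite ltrDl mulr_gt0.
Qed.

(** All events beside the box are read before it, which makes the events of the box consecutive. The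
    lists [lo1] and [lo2] are left arbitrary so that the same ones serve for both diagrams of a
    replacement. *)
Lemma box_reads ps us lo1 lo2 : reading D ps -> reading P us ->
  uniq lo1 -> uniq lo2 ->
  pairwise (fun p q => q.2 <= p.2) lo1 -> pairwise (fun p q => q.2 <= p.2) lo2 ->
  (forall p, p \in lo1 <-> [/\ event D p, ~ B p & c <= p.2]) ->
  (forall p, p \in lo2 <-> [/\ event D p, ~ B p & p.2 < c]) ->
  congr (map (letter hn D) ps) (map (letter hn D) lo1 ++
    map (shift_gen box_left_le) (map (letter hk P) us) ++ map (letter hn D) lo2).
Proof.
move=> rps rus u1 u2 r1 r2 m1 m2.
have [ups _ eps] := rps; have [uus _ eus] := rus.
have -> : map (shift_gen box_left_le) (map (letter hk P) us) =
          map (letter hn D) (map A us).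
  rewrite -!map_comp; apply/eq_in_map => p /eus ep /=.
  by rewrite box_letter//; exact: event_box.
rewrite -!map_cat.
have mA p : p \in map A us <-> event D p /\ B p.
  split=> [/mapP[q /eus eq ->]|[ep [q qb e]]].
    by have qb := event_box eq; split; [exact/box_event|exists q].
  by rewrite -e map_f//; apply/eus/box_event => //; rewrite e.
(* The rearranged list descends in height, except that an event of the box and one beside it may
   come in either order. *)
pose out p q : bool := `[< [/\ B p, ~ B q & c <= q.2 <= c + d] >].
apply: (@trace_congr _ _ _ (fun p q => q.2 <= p.2)
  (fun p q => [|| q.2 <= p.2, out p q | out q p])).
- exact: ups.
- apply: uniq_perm => //.
    rewrite !cat_uniq u1 u2 (map_inj_uniq A_inj) uus /= andbT.
    apply/andP; split; apply/hasPn => p.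
      rewrite mem_cat => /orP[/mA[_ Bp]|/m2[_ _ pc]]; apply/negP => /m1[_ nB cp] //.
      by move: pc; rewrite ltNge cp.
    by move=> /m2[_ nB _]; apply/negP => /mA[].
  move=> p; apply/idP/idP.
    move=> /eps ep; rewrite !mem_cat; have [Bp|nB] := pselect (B p).
      by apply/orP; right; apply/orP; left; apply/mA.
    case: (ltP p.2 c) => pc; last by apply/orP; left; apply/m1.
    by apply/orP; right; apply/orP; right; apply/m2.
  by rewrite !mem_cat => /or3P[/m1[? _ _]|/mA[? _]|/m2[? _ _]]; apply/eps.
- exact: reading_pairwise rps.
- rewrite !pairwise_cat; apply/and3P; split; [|apply: sub_pairwise r1 => p q -> //|].
    apply/allrelP => p q /m1[_ nB cp]; rewrite mem_cat => /orP[/mA[_ Bq]|/m2[_ _ qc]].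
      have /B_E[_ /andP[cq qd]] := Bq.
      case: (leP p.2 (c + d)) => pd; last by rewrite (le_trans qd (ltW pd)).
      apply/or3P; apply: Or33; apply/asboolP; split=> //.
      by rewrite cp pd.
    by rewrite (le_trans (ltW qc) cp).
  apply/and3P; split; [| |apply: sub_pairwise r2 => p q -> //].
    apply/allrelP => p q /mA[_ /B_E[_ /andP[cp _]]] /m2[_ _ qc].
    by rewrite (le_trans (ltW qc) cp).
  rewrite pairwise_map; apply: sub_pairwise (reading_pairwise rus) => p q /= pq.
  by rewrite lerD2l ler_pM2l// pq.
- move=> p q /eps ep /eps eq pq qp /or3P[pq'|/asboolP[Bq nBp pw]|/asboolP[Bp nBq qw]].
  + apply: separated_commute; apply: same_height_separated => //.
    by apply/eqP; rewrite eq_le pq' qp.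
  + have [q' eq' e] : exists2 q', event P q' & A q' = q.
      have [q' qb e] := Bq; exists q' => //; apply/box_event => //.
      by rewrite e.
    by apply: separated_commute; rewrite -e; exact: window_separated.
  + have [p' ep' e] : exists2 p', event P p' & A p' = p.
      have [p' pb e] := Bp; exists p' => //; apply/box_event => //.
      by rewrite e.
    apply: commute_words_sym; apply: separated_commute; rewrite -e.
    exact: window_separated.
Qed.

Lemma box_complement p : B p <-> a <= p.1 <= a + b * k.+1%:R /\ c <= p.2 <= c + d.
Proof. exact: B_E. Qed.

Lemma box_codom l (y : R) : c <= y <= c + d -> B (strand D l y, y) -> l \in codom iota.
Proof. exact: inside. Qed.

End Box.

Section LocalReplacement.
Context {R : realType} {k n : nat} (hk : (0 < k)%N) (hn : (0 < n)%N).
Implicit Types (p q : R * R).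

Lemma local_replacement_congr (u v : seq (stvb_gen k)) (D D' : diagram R n) w w' :
  stvb_move u v -> local_replacement (word_diagram u) (word_diagram v) D D' ->
  reads hn D w -> reads hn D' w' -> congr w w'.
Proof.
move=> uv [a [b [c [d [iota [[b0 d0 c0 cd1] cP cP' cO]]]]]].
move=> [ps rps ->] [ps' rps' ->].
have hP (z : seq (stvb_gen k)) j (y : R) := @word_diagram_itv R k z j y.
set A := (fun p : R * R => (a + b * p.1, c + d * p.2)) in cP cP' cO.
pose B := A @` box k.
have BE p : B p <-> a <= p.1 <= a + b * k.+1%:R /\ c <= p.2 <= c + d.
  exact: box_complement.
have [us rus eu] := reads_word (R := R) hk u.
have [vs rvs ev] := reads_word (R := R) hk v.
have on l p : strip p -> ~ B p -> on_strand D' l p <-> on_strand D l p.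
  move=> sp nB; have [h _ _] := cO p (conj sp nB); rewrite h.
  by split=> [[j ->]|lp] //; exists l.
have eB l y : 0 <= y <= 1 -> ~ B (strand D l y, y) -> strand D' l y = strand D l y.
  by move=> y01 nB; have [_ ->] := (on l (strand D l y, y) y01 nB).2 (conj y01 erefl).
have eB' l y : 0 <= y <= 1 -> ~ B (strand D' l y, y) -> strand D l y = strand D' l y.
  by move=> y01 nB; have [_ ->] := (on l (strand D' l y, y) y01 nB).1 (conj y01 erefl).
have dO p : strip p -> ~ B p -> double_point D' p <-> double_point D p.
  move=> sp nB; split=> -[j [j' [jj' jp jp']]]; by exists j, j'; split=> //; apply/on.
have eO p : strip p -> ~ B p -> event D' p <-> event D p.
  move=> sp nB; rewrite /event; have -> := dO _ sp nB.
  by have [_ _ ->] := cO p (conj sp nB).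
have lO p : event D p -> ~ B p -> letter hn D' p = letter hn D p.
  move=> ep nB; have sp := lt01_le01 (event_strip ep).
  apply: letterE; have [kp ip] := letterP hn ep; split.
    rewrite kp /kind_at (asbool_equiv_eq (dO _ sp nB)); case: asboolP => // dp.
    by have [_ -> //] := cO p (conj sp nB).
  rewrite ip; apply: eq_card => l; rewrite !inE.
  (* A strand can differ in [D] and [D'] only if it is in the box in both of them. Both its points
     are then on the same side of [p], which is beside the box. *)
  have [Bl|nBl] := pselect (B (strand D l p.2, p.2)); last by rewrite eB.
  have [Bl'|nBl'] := pselect (B (strand D' l p.2, p.2)); last by rewrite -eB'.
  have /BE[/andP[/= h1 h2] pw] := Bl; have /BE[/andP[/= h3 h4] _] := Bl'.
  have [pa|pa] : p.1 < a \/ a + b * k.+1%:R < p.1.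
    case: (ltP p.1 a) => g1; first by left.
    case: (ltP (a + b * k.+1%:R) p.1) => g2; first by right.
    by case: nB; apply/BE; rewrite g1 g2.
  - by rewrite !ltNge (ltW (lt_le_trans pa h1)) (ltW (lt_le_trans pa h3)).
  - by rewrite (le_lt_trans h2 pa) (le_lt_trans h4 pa).
have [ups _ eps] := rps; have pps := reading_pairwise rps.
pose out p := ~~ `[< B p >].
pose lo1 := [seq p <- ps | out p && (c <= p.2)].
pose lo2 := [seq p <- ps | out p && (p.2 < c)].
have m1 p : p \in lo1 <-> [/\ event D p, ~ B p & c <= p.2].
  rewrite mem_filter /out; split=> [/andP[/andP[/asboolPn nB cp] /eps ep]//|].
  by move=> [/eps -> nB ->]; rewrite andbT andbT; apply/asboolPn.
have m2 p : p \in lo2 <-> [/\ event D p, ~ B p & p.2 < c].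
  rewrite mem_filter /out; split=> [/andP[/andP[/asboolPn nB cp] /eps ep]//|].
  by move=> [/eps -> nB ->]; rewrite andbT andbT; apply/asboolPn.
have eDD p : [/\ event D p & ~ B p] <-> [/\ event D' p & ~ B p].
  by split=> -[ep nB]; split=> //; apply/(eO p (lt01_le01 (event_strip ep)) nB).
have m1' p : p \in lo1 <-> [/\ event D' p, ~ B p & c <= p.2].
  rewrite m1; split=> -[ep nB cp].
    by have [] := (eDD p).1 (conj ep nB).
  by have [] := (eDD p).2 (conj ep nB).
have m2' p : p \in lo2 <-> [/\ event D' p, ~ B p & p.2 < c].
  rewrite m2; split=> -[ep nB cp].
    by have [] := (eDD p).1 (conj ep nB).
  by have [] := (eDD p).2 (conj ep nB).
have C := @box_reads R k n hk hn _ D a b c d iota b0 d0 c0 cd1 cP (hP u) ps us lo1 lo2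
  rps rus (filter_uniq _ ups) (filter_uniq _ ups) (pairwise_filter _ pps)
  (pairwise_filter _ pps) m1 m2.
have C' := @box_reads R k n hk hn _ D' a b c d iota b0 d0 c0 cd1 cP' (hP v) ps' vs lo1 lo2
  rps' rvs (filter_uniq _ ups) (filter_uniq _ ups) (pairwise_filter _ pps)
  (pairwise_filter _ pps) m1' m2'.
apply: congr_trans C _; apply: congr_sym; apply: congr_trans C' _; apply: congr_sym.
have -> : map (letter hn D') lo1 = map (letter hn D) lo1.
  by apply/eq_in_map => p /m1[ep nB _]; exact: lO.
have -> : map (letter hn D') lo2 = map (letter hn D) lo2.
  by apply/eq_in_map => p /m2[ep nB _]; exact: lO.
apply: congr_ctx; rewrite -eu -ev.
set le1 := box_left_le _ cP _; set le2 := box_left_le _ cP' _.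
(* Both boxes use the same [iota], and a strand off its image misses the box at height [c], so it
   has the same abscissa there in both diagrams. *)
suff e : box_left D' a c iota = box_left D a c iota.
  by move: (le2); rewrite e => le2'; rewrite (bool_irrelevance le2' le1); exact: move_shift.
apply: eq_card => l; rewrite !inE; case: (boolP (l \in codom iota)) => //= lc.
have cw : c <= c <= c + d by apply/andP; split; lra.
have c01 : 0 <= c <= 1 by apply/andP; split; lra.
rewrite eB// => Bl; move/negP: lc; apply.
exact: (box_codom c0 cd1 cP cw Bl).
Qed.

End LocalReplacement.

Section EquivCongr.
Context {R : realType} {n : nat} (hn : (0 < n)%N).
Implicit Types (D : diagram R n).

(** Two readings of one diagram differ only in the order of events at a common height, and the
    letters of these commute. *)
Lemma reads_uniq D w w' : reads hn D w -> reads hn D w' -> congr w w'.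
Proof.
move=> [ps rp ->] [ps' rp' ->].
apply: (@same_reading_congr _ _ _ _ _ _ _ id id) rp rp' _ _ _ => // p q ep eq pq h h'.
apply: separated_commute; apply: same_height_separated => //.
by apply/eqP; rewrite eq_le h h'.
Qed.

Lemma stvb_move_gt0 k (u v : seq (stvb_gen k)) : stvb_move u v -> (0 < k)%N.
Proof.
have c (i : 'I_k.-1) : (0 < k)%N by apply: leq_trans (leq_pred k); case: i => i /ltn_predK <-.
by case=> [i|i|i j _|i|i j _|i j _|[i hi]|i|i|i|i j _|i j _|i];
  do ?[exact: (c i)|exact: leq_ltn_trans hi].
Qed.

Lemma diagram_equiv_congr D D' w w' : diagram_equiv D D' ->
  reads hn D w -> reads hn D' w' -> congr w w'.
Proof.
move=> DD'; elim: DD' w w' => [{}D {}D' [iso|[k [u [v [uv lr]]]]]|{}D|{}D {}D' _ IH|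
    D1 D2 D3 _ IH1 _ IH2] w w' rw rw'.
- exact: isotopic_congr iso rw rw'.
- refine (@local_replacement_congr R k n (stvb_move_gt0 uv) hn u v D D' w w' uv lr rw rw').
- exact: reads_uniq rw rw'.
- by apply: congr_sym; exact: IH.
- by have [w2 rw2] := reads_exists hn D2; apply: congr_trans (IH1 _ _ rw rw2) (IH2 _ _ rw2 rw').
Qed.

End EquivCongr.

(** * Vertical isotopies *)

Section FiberHomeo.
Context {R : realType}.
Implicit Types (phi : R -> R -> R) (u v x : R).

Lemma IVT_surj (f : R -> R) v : continuous f -> (exists x, f x <= v) ->
  (exists x, v <= f x) -> {homo f : x y / x < y} -> exists x, f x = v.
Proof.
move=> cf [a fa] [b fb] mf.
have ab : a <= b.
  by rewrite leNgt; apply/negP => /mf; rewrite ltNge (le_trans fa fb).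
have [|x _ fx] := IVT ab (continuous_subspaceT cf) (v := v); last by exists x.
by rewrite ge_min fa le_max fb orbT.
Qed.

(* Strict monotonicity in each fibre bounds the inverse between the values at
   two nearby fixed abscissas, which makes it jointly continuous. *)
Lemma fiber_homeo phi :
  continuous (fun p : R * R => phi p.1 p.2) ->
  (forall u, {homo phi u : x y / x < y}) ->
  (forall u v, exists x, phi u x = v) ->
  exists g : R -> R -> R, [/\ forall u x, g u (phi u x) = x,
    forall u v, phi u (g u v) = v & continuous (fun p : R * R => g p.1 p.2)].
Proof.
move=> cphi mphi sphi.
pose g u v := sval (cid (sphi u v)).
have phig u v : phi u (g u v) = v by rewrite /g; case: cid.
have inj u : injective (phi u).
  move=> x y e; apply/eqP; rewrite eq_le !leNgt; apply/andP.
  by split; apply/negP => /(mphi u); rewrite e ltxx.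
have gphi u x : g u (phi u x) = x by apply: (inj u).
suff cg (p0 : (R * R)%type) e : 0 < e ->
    \forall q \near p0, `|g p0.1 p0.2 - g q.1 q.2| < e.
  by exists g; split=> // p0; apply/cvgrPdist_lt => e; exact: cg.
move=> e0.
have lin x : continuous (fun p : R * R => p.2 - phi p.1 x).
  have c : continuous (fun p : R * R => phi p.1 x).
    pose q (p : R * R) := (p.1, x).
    have cq : continuous q.
      by apply: continuous_pair; [move=> p; exact: cvg_fst|exact: cst_continuous].
    by move=> p; exact: (continuous_comp (cq p) (cphi (q p))).
  by move=> p; apply: cvgB; [exact: cvg_snd|exact: c].
set u0 := p0.1; set v0 := p0.2; set x0 := g u0 v0.
have h1 : 0 < v0 - phi u0 (x0 - e).
  by rewrite subr_gt0 -[ltRHS](phig u0) mphi// ltrBlDr ltrDl.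
have h2 : v0 - phi u0 (x0 + e) < 0.
  by rewrite subr_lt0 -[ltLHS](phig u0) mphi// ltrDl.
have n1 := @cvgr_gt _ _ (nbhs p0) _ _ _ (lin (x0 - e) p0) _ h1.
have n2 := @cvgr_lt _ _ (nbhs p0) _ _ _ (lin (x0 + e) p0) _ h2.
have lt u v x : phi u x < v -> x < g u v.
  move=> h; rewrite ltNge; apply/negP; rewrite le_eqVlt => /orP[/eqP eg|/(mphi u)].
    by move: h; rewrite -eg phig ltxx.
  by rewrite phig => /(lt_trans h); rewrite ltxx.
have gt u v x : v < phi u x -> g u v < x.
  move=> h; rewrite ltNge; apply/negP; rewrite le_eqVlt => /orP[/eqP eg|/(mphi u)].
    by move: h; rewrite eg phig ltxx.
  by rewrite phig => /(lt_trans h); rewrite ltxx.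
near=> q; rewrite ltr_distlC; apply/andP; split; [apply: lt|apply: gt].
  by rewrite -subr_gt0; near: q; exact: n1.
by rewrite -subr_lt0; near: q; exact: n2.
Unshelve. all: by end_near.
Qed.

End FiberHomeo.

(** * Images of diagrams under homeomorphisms of the strip *)

Section Transport.
Context {R : realType} {n : nat}.

(** A homeomorphism need not respect graphs or derivatives. So the functions [st] describing the
    image strands are supplied, with their smoothness and transversality; endpoints, absence of
    triple points, labels and bars are carried along by [h] and its inverse. *)
Lemma transport (D : diagram R n) (h : R * R -> R * R) (st : 'I_n -> R -> R) :
  self_homeomorphism strip h ->
  (forall p, p.2 = 0 \/ p.2 = 1 -> h p = p) ->
  (forall j p, strip p -> st j (h p).2 = (h p).1 <-> strand D j p.2 = p.1) ->
  (forall j, piecewise_smooth (st j) 0 1) ->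
  (forall (j k : 'I_n) y, 0 <= y <= 1 -> j != k -> st j y = st k y ->
    exists a b : R, [/\ is_derive y 1 (st j) a, is_derive y 1 (st k) b & a != b]) ->
  exists2 D' : diagram R n, strand D' = st & carries strip h id D D'.
Proof.
move=> [_ [g _ hg]] hb on ps tr.
have i1 : 0 <= (1 : R) <= 1 by rewrite ler01 lexx.
have i0 : 0 <= (0 : R) <= 1 by rewrite ler01 lexx.
have top j : st j 1 = endpoint R j.
  have := (on j (endpoint R j, 1) i1).2; rewrite hb /=; last by right.
  by apply; rewrite strand_top.
have bot j : st j 0 = endpoint R (strand_perm D j).
  have := (on j (endpoint R (strand_perm D j), 0) i0).2; rewrite hb /=; last by left.
  by apply; rewrite strand_bottom.
have lift j (y : R) : 0 <= y <= 1 -> let p := g (st j y, y) in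
    [/\ strip p, h p = (st j y, y) & strand D j p.2 = p.1].
  move=> y01; have [_ sg _ hgp] := hg (st j y, y) y01.
  by split=> //; apply/on => //; rewrite hgp.
have dbl (j k l : 'I_n) y : 0 <= y <= 1 -> j != k -> k != l -> j != l ->
    ~ (st j y = st k y /\ st k y = st l y).
  move=> y01 jk kl jl [e1 e2].
  have [sp hp jp] := lift j _ y01; have [_ _ kp] := lift k _ y01.
  have [_ _ lp] := lift l _ y01; move: kp lp; rewrite -e2 -e1 => kp lp.
  by apply: (@strand_double _ _ D j k l _ sp) => //; rewrite jp kp lp.
have bfin : finite_set (h @` bars D) by apply: finite_image; exact: bars_finite.
have bstrip p : bars D p -> strip p by move=> /bars_on[/lt01_le01].
have bon p : (h @` bars D) p -> 0 < p.2 < 1 /\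
    exists j, st j p.2 = p.1 /\ forall k, k != j -> st k p.2 != p.1.
  move=> [q bq <-]; have [/andP[q0 q1] [j [jq nq]]] := bars_on bq.
  have sq := bstrip _ bq; split.
    have [shq _ ghq _] := hg q sq; have /andP[h0 h1] := shq; rewrite !lt_neqAle h0 h1 !andbT.
    (* A point sent to the boundary is on the boundary, since [h] is injective and fixes the
       boundary pointwise. *)
    have bd (c : R) : c = 0 \/ c = 1 -> (h q).2 = c -> q.2 = c.
      move=> c01 e; have := hb (h q); rewrite e => /(_ c01) hh.
      have [_ _ ghh _] := hg (h q) shq.
      by rewrite hh ghq in ghh; rewrite ghh.
    apply/andP; split; apply/eqP => e.
      by move: q0; rewrite (bd 0) ?ltxx//; left.
    by move: q1; rewrite (bd 1) ?ltxx//; right.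
  exists j; split; first exact/on.
  by move=> k kj; apply/eqP => /(on k q sq)/eqP; apply/negP; exact: nq.
exists (@Diagram R n st (strand_perm D) (fun p => label D (g p)) (h @` bars D)
  top bot ps dbl tr bfin bon) => //.
move=> p sp; have [shp _ ghp _] := hg p sp; split.
- move=> l; split=> [[_ /(on l p sp) lp]|[j -> [_ jp]]]; first by exists l.
  by split=> //; exact/on.
- by move=> _ /=; rewrite ghp.
- split=> [[q bq e]|bp]; last by exists p.
  have [_ _ ghq _] := hg q (bstrip _ bq).
  by rewrite -ghp -e ghq.
Qed.

End Transport.

(** * Piecewise affine changes of height *)

Section PiecewiseAffine.
Context {R : realType}.
Implicit Types (f g phi : R -> R) (a b c : R).

(** This class is closed under inversion and under interpolation with the identity, and
    precomposition with its members keeps strands piecewise smooth. *)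
Inductive increasing_pl phi : R -> R -> Prop :=
  | ipl_piece a b c e : a < b -> 0 < c -> (forall y, a <= y <= b -> phi y = c * y + e) ->
      increasing_pl phi a b
  | ipl_glue a b c : increasing_pl phi a b -> increasing_pl phi b c ->
      increasing_pl phi a c.

Lemma ipl_lt phi a b : increasing_pl phi a b -> a < b.
Proof. by elim=> // {}a {}b c _ ab _; exact: lt_trans. Qed.

Lemma ipl_eq phi phi' a b : increasing_pl phi a b ->
  (forall y, a <= y <= b -> phi y = phi' y) -> increasing_pl phi' a b.
Proof.
elim=> [{}a {}b c e ab c0 h|{}a {}b c ab IH1 bc IH2] e'.
  by apply: (ipl_piece ab c0) => y yab; rewrite -e' ?h.
have [/ltW lab /ltW lbc] := (ipl_lt ab, ipl_lt bc).
apply: (@ipl_glue _ _ b).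
  by apply: IH1 => y /andP[h1 h2]; apply: e'; rewrite h1 (le_trans h2).
by apply: IH2 => y /andP[h1 h2]; apply: e'; rewrite h2 (le_trans _ h1).
Qed.

Lemma ipl_mono phi a b x y : increasing_pl phi a b -> a <= x -> x < y -> y <= b ->
  phi x < phi y.
Proof.
move=> pl; elim: pl x y => [{}a {}b c e ab c0 h|{}a {}b c ab IH1 bc IH2] x y ax xy yb.
  rewrite !h; [by rewrite ltrD2r ltr_pM2l| |].
    by rewrite yb (le_trans ax (ltW xy)).
  by rewrite ax (le_trans (ltW xy) yb).
case: (leP y b) => yb'; first exact: IH1.
case: (leP b x) => bx; first exact: IH2.
by apply: (@lt_trans _ _ (phi b)); [exact: IH1|exact: IH2].
Qed.

Lemma ipl_interp phi a b s : increasing_pl phi a b -> 0 <= s <= 1 ->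
  increasing_pl (fun y => y + s * (phi y - y)) a b.
Proof.
move=> pl /andP[s0 s1]; elim: pl => [{}a {}b c e ab c0 h|{}a {}b c _ IH1 _ IH2].
  apply: (@ipl_piece _ _ _ (1 - s + s * c) (s * e)) => //.
    by have [s1'|s1'] := ltP s 1; nra.
  by move=> y /h ->; ring.
exact: ipl_glue IH1 IH2.
Qed.

Lemma psmooth_affine a b c e : a <= b -> piecewise_smooth (fun y => c * y + e) a b.
Proof.
by move=> ab; exact: (@psmooth_piece _ _ _ _ _ ab (@smooth_affine _ c e) (fun _ _ => erefl)).
Qed.

Lemma ipl_psmooth phi a b : increasing_pl phi a b -> piecewise_smooth phi a b.
Proof.
elim=> [{}a {}b c e ab c0 h|{}a {}b c _ IH1 _ IH2]; last exact: psmooth_glue IH1 IH2.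
by apply: psmooth_eq (psmooth_affine c e (ltW ab)) _ => y; rewrite in_itv/= => /h ->.
Qed.

Lemma psmooth_restrict f a b a' b' : piecewise_smooth f a b ->
  a <= a' -> a' <= b' -> b' <= b -> piecewise_smooth f a' b'.
Proof.
move=> pf; elim: pf a' b' => [{}a {}b h ab hh fh|{}a {}b c ab IH1 bc IH2] a' b' aa ab' bb.
  apply: (psmooth_piece ab' hh) => y; rewrite in_itv/= => /andP[h1 h2].
  by apply: fh; rewrite in_itv/= (le_trans aa h1) (le_trans h2 bb).
case: (leP b' b) => h1; first exact: IH1.
case: (leP b a') => h2; first exact: IH2.
by apply: (@psmooth_glue _ _ _ b); [apply: IH1 => //; exact: ltW|apply: IH2 => //; exact: ltW].
Qed.

Lemma ipl_comp f phi a b : increasing_pl phi a b ->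
  piecewise_smooth f (phi a) (phi b) -> piecewise_smooth (f \o phi) a b.
Proof.
elim=> [{}a {}b c e ab c0 h|{}a {}b c ab IH1 bc IH2] pf.
  have := psmooth_comp_affine e c0 pf.
  have -> : (phi a - e) / c = a.
    by rewrite h ?lexx ?ltW// addrK mulrC mulKf// gt_eqF.
  have -> : (phi b - e) / c = b.
    by rewrite h ?lexx ?ltW// addrK mulrC mulKf// gt_eqF.
  by move/psmooth_eq; apply => y; rewrite in_itv/= => /h /= ->.
have [lab lbc] := (ipl_lt ab, ipl_lt bc).
have m1 : phi a <= phi b by apply/ltW/(ipl_mono ab).
have m2 : phi b <= phi c by apply/ltW/(ipl_mono bc).
apply: (@psmooth_glue _ _ _ b); [apply: IH1|apply: IH2];
  exact: psmooth_restrict pf _ _ _.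
Qed.

Lemma ipl_inv phi g a b : increasing_pl phi a b ->
  (forall y, a <= y <= b -> g (phi y) = y) -> increasing_pl g (phi a) (phi b).
Proof.
elim=> [{}a {}b c e ab c0 h|{}a {}b c ab IH1 bc IH2] gK.
  rewrite !h ?lexx ?ltW//.
  apply: (@ipl_piece _ _ _ c^-1 (- e / c)); rewrite ?invr_gt0//.
    by rewrite ltrD2r ltr_pM2l.
  move=> y /andP[y1 y2]; have yE : y = phi ((y - e) / c).
    rewrite h; first by rewrite mulrC divfK ?gt_eqF// subrK.
    by rewrite ler_pdivlMr// ler_pdivrMr// lerBrDr lerBlDr mulrC y1 mulrC y2.
  rewrite {1}yE gK; first by rewrite mulrDl mulrC.
  by rewrite ler_pdivlMr// ler_pdivrMr// lerBrDr lerBlDr mulrC y1 mulrC y2.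
have [/ltW lab /ltW lbc] := (ipl_lt ab, ipl_lt bc).
apply: (@ipl_glue _ _ (phi b)).
  by apply: IH1 => y /andP[h1 h2]; apply: gK; rewrite h1 (le_trans h2).
by apply: IH2 => y /andP[h1 h2]; apply: gK; rewrite h2 (le_trans _ h1).
Qed.

Lemma ipl_inverse phi a b : increasing_pl phi a b -> exists g,
  [/\ increasing_pl g (phi a) (phi b), forall y, a <= y <= b -> g (phi y) = y &
      forall z, phi a <= z <= phi b -> a <= g z <= b /\ phi (g z) = z].
Proof.
move=> pl; have /ltW ab := ipl_lt pl.
have ex z : phi a <= z <= phi b -> exists y, a <= y <= b /\ phi y = z.
  move=> zab; have := psmooth_continuous (ipl_psmooth pl) => cphi.
  have [|y] := IVT ab (continuous_subspaceT cphi) (v := z).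
    by rewrite /= !clamp_id ?lexx ?ab// ge_min le_max; case/andP: zab => -> ->; rewrite orbT.
  by rewrite in_itv/= => yab /=; rewrite clamp_id// => e; exists y.
pose g z := if pselect (exists y, a <= y <= b /\ phi y = z) is left e
  then sval (cid e) else 0.
have gP z : phi a <= z <= phi b -> a <= g z <= b /\ phi (g z) = z.
  by move=> /ex ez; rewrite /g; case: pselect => // e; case: cid.
have gK y : a <= y <= b -> g (phi y) = y.
  move=> yab; have /andP[ay yb] := yab.
  have le u v : a <= u -> u <= v -> v <= b -> phi u <= phi v.
    by move=> au; rewrite le_eqVlt => /orP[/eqP -> //|uv vb]; exact/ltW/(ipl_mono pl).
  have [|/andP[ag gb] e] := gP (phi y); first by rewrite !le ?lexx.
  apply/eqP; rewrite eq_le !leNgt; apply/andP; split; apply/negP => h.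
    by have := ipl_mono pl ay h gb; rewrite e ltxx.
  by have := ipl_mono pl ag h yb; rewrite e ltxx.
by exists g; split=> //; exact: ipl_inv.
Qed.

End PiecewiseAffine.

Section ContinuousFst.
Context {R : realType}.

Lemma continuous_of_fst (f : R -> R) : continuous f -> continuous (fun p : R * R => f p.1).
Proof.
have c : continuous (fst : R * R -> R) by move=> p; exact: cvg_fst.
by move=> cf p; exact: (continuous_comp (c p) (cf p.1)).
Qed.

Lemma continuous_of_snd (f : R -> R) : continuous f -> continuous (fun p : R * R => f p.2).
Proof.
have c : continuous (snd : R * R -> R) by move=> p; exact: cvg_snd.
by move=> cf p; exact: (continuous_comp (c p) (cf p.2)).
Qed.

End ContinuousFst.

(** * Isotopies along vertical lines *)

Section VerticalTransport.
Context {R : realType} {n : nat}.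
Variables (D : diagram R n) (psi : R -> R).
Hypotheses (plpsi : increasing_pl psi 0 1) (psi0 : psi 0 = 0) (psi1 : psi 1 = 1).

(** A point of abscissa [x] makes the fraction [chi x] of the displacement prescribed by [psi]; thus
    [chi] confines a change of height to a part of the strip. *)
Definition vertical_map (chi : R -> R) (p : R * R) : R * R :=
  (p.1, p.2 + chi p.1 * (psi (clamp 0 1 p.2) - clamp 0 1 p.2)).

Let phi (k y : R) : R := y + k * (psi (clamp 0 1 y) - clamp 0 1 y).

Let i01 : 0 <= (0 : R) <= 1. Proof. by rewrite ler01 lexx. Qed.
Let i11 : 0 <= (1 : R) <= 1. Proof. by rewrite ler01 lexx. Qed.

Let psi_le x y : 0 <= x -> x <= y -> y <= 1 -> psi x <= psi y.
Proof.
move=> x0; rewrite le_eqVlt => /orP[/eqP -> //|xy] y1.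
exact/ltW/(ipl_mono plpsi).
Qed.

Let psi_itv y : 0 <= y <= 1 -> 0 <= psi y <= 1.
Proof.
by move=> /andP[y0 y1]; rewrite -{1}psi0 -psi1 !psi_le.
Qed.

Let clamp_le (x y : R) : x <= y ->
  clamp 0 1 x <= clamp 0 1 y /\ x - clamp 0 1 x <= y - clamp 0 1 y.
Proof.
by move=> xy; rewrite /clamp; case: (leP 1 x) => ?; case: (leP 1 y) => ?;
  case: (leP (0 : R) 1) => ?; case: (leP 0 x) => ?; case: (leP 0 y) => ?; split; lra.
Qed.

(** With [c] the clamp of [y], the map is the sum of [y - c] and of a convex combination of [c] and
    [psi c]. Both terms are nondecreasing, the first strictly where [c] is constant and the second
    where it is not. *)
Let phi_mono k : 0 <= k <= 1 -> {homo phi k : x y / x < y}.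
Proof.
move=> /andP[k0 k1] x y xy; have [c1 c2] := clamp_le (ltW xy).
have /andP[x0 x1] := clamp_itv x ler01; have /andP[y0 y1] := clamp_itv y ler01.
rewrite /phi; set cx := clamp 0 1 x in c1 c2 x0 x1 *; set cy := clamp 0 1 y in c1 c2 y0 y1 *.
have [cxy|cxy] := eqVneq cx cy; first by rewrite cxy in c2 *; lra.
have lt : cx < cy by rewrite lt_neqAle cxy c1.
have plt : psi cx < psi cy by exact: (ipl_mono plpsi).
by have [kk|kk] := ltP k 1; nra.
Qed.

Let phi_id k y : 0 <= y <= 1 -> phi k y = y + k * (psi y - y).
Proof. by move=> y01; rewrite /phi clamp_id. Qed.

Let phi_itv k y : 0 <= k <= 1 -> 0 <= y <= 1 -> 0 <= phi k y <= 1.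
Proof.
move=> /andP[? ?] y01; rewrite phi_id//; have /andP[? ?] := psi_itv y01.
by move/andP: y01 => [? ?]; apply/andP; split; nra.
Qed.

Let psic_continuous : continuous (psi \o clamp 0 1).
Proof. exact: psmooth_continuous (ipl_psmooth plpsi). Qed.

Let delta_continuous : continuous (fun y => psi (clamp 0 1 y) - clamp 0 1 y).
Proof. by move=> y; apply: cvgB; [exact: psic_continuous|exact: continuous_clamp]. Qed.

Lemma vertical_continuous (chi : R -> R) : continuous chi ->
  continuous (fun q : R * (R * R) =>
    (q.2.1, q.2.2 + q.1 * chi q.2.1 * (psi (clamp 0 1 q.2.2) - clamp 0 1 q.2.2))).
Proof.
move=> cchi.
have c2 : continuous (snd : R * (R * R) -> R * R) by move=> q; exact: cvg_snd.
have c1 : continuous (fst : R * (R * R) -> R) by move=> q; exact: cvg_fst.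
have lift (f : R * R -> R) : continuous f -> continuous (fun q : R * (R * R) => f q.2).
  by move=> cf q; exact: (continuous_comp (c2 q) (cf q.2)).
apply: continuous_pair; first by apply: lift => p; exact: cvg_fst.
move=> q; apply: cvgD; first by apply: (lift snd) => p; exact: cvg_snd.
apply: cvgM; last first.
  exact: (lift (fun p => _ p.2) (continuous_of_snd delta_continuous)).
apply: cvgM; first exact: c1.
exact: (lift _ (continuous_of_fst cchi)).
Qed.

Lemma vertical_homeomorphism (chi : R -> R) : continuous chi ->
  (forall x, 0 <= chi x <= 1) -> self_homeomorphism strip (vertical_map chi).
Proof.
move=> cchi chi01.
have cphi : continuous (fun p : R * R => phi (chi p.1) p.2).
  move=> p; apply: cvgD; first exact: cvg_snd.
  have := continuous_of_snd delta_continuous => cd.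
  by apply: cvgM; [exact: (continuous_of_fst cchi)|exact: (cd p)].
have cphi2 u : continuous (phi (chi u)).
  by move=> y; apply: cvgD => //; apply: cvgM; [exact: cvg_cst|exact: delta_continuous].
have dist u y : `|phi (chi u) y - y| <= 1.
  rewrite /phi addrC addKr; have /andP[? ?] := chi01 u.
  have cy := clamp_itv y ler01; have /andP[? ?] := psi_itv cy.
  by move/andP: cy => [? ?]; rewrite ler_norml; apply/andP; split; nra.
have [g [gphi phig cg]] : exists g : R -> R -> R, [/\ forall u x, g u (phi (chi u) x) = x,
    forall u v, phi (chi u) (g u v) = v & continuous (fun p : R * R => g p.1 p.2)].
  apply: (@fiber_homeo _ (fun u => phi (chi u))) => //.
    by move=> u; exact: phi_mono.
  move=> u v; apply: IVT_surj (cphi2 u) _ _ (phi_mono (chi01 u)).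
    by exists (v - 1); have := dist u (v - 1); rewrite ler_norml => /andP[_]; lra.
  by exists (v + 1); have := dist u (v + 1); rewrite ler_norml => /andP[+ _]; lra.
split.
  apply: continuous_subspaceT; apply: continuous_pair => //.
  by move=> p; exact: cvg_fst.
exists (fun p => (p.1, g p.1 p.2)).
  apply: continuous_subspaceT; apply: continuous_pair => //.
  by move=> p; exact: cvg_fst.
move=> [x y] sp; split=> /=.
- exact: phi_itv.
- rewrite /strip /=; apply/andP; rewrite !leNgt; split; apply/negP => /(phi_mono (chi01 x)).
    rewrite phig phi_id// psi0 subrr mulr0 addr0.
    by move/andP: sp => [/= y0 _]; rewrite ltNge y0.
  rewrite phig phi_id// psi1 subrr mulr0 addr0.
  by move/andP: sp => [/= _ y1]; rewrite ltNge y1.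
- by rewrite /vertical_map /= gphi.
- by rewrite /vertical_map /=; congr (_, _); exact: phig.
Qed.

Lemma vertical_boundary chi p : p.2 = 0 \/ p.2 = 1 -> vertical_map chi p = p.
Proof.
case: p => x y /= [->|->]; rewrite /vertical_map /= clamp_id//.
  by rewrite psi0 subrr mulr0 addr0.
by rewrite psi1 subrr mulr0 addr0.
Qed.

(* A strand along which chi is constant where psi moves the heights is
   reparametrized by the height map; two strands that cross must be moved in
   the same way near the crossing, where moreover psi has to be smooth. *)
Lemma vertical_transport (chi : R -> R) (s : 'I_n -> R) : continuous chi ->
  (forall x, 0 <= chi x <= 1) -> (forall j, 0 <= s j <= 1) ->
  (forall j y, 0 <= y <= 1 -> chi (strand D j y) = s j \/ psi y = y) ->
  (forall j k y, 0 <= y <= 1 -> j != k -> strand D j y = strand D k y ->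
    exists c e, [/\ 0 < c, \forall z \near y, psi z = c * z + e & s j = s k \/ c = 1]) ->
  exists D' : diagram R n, carries strip (vertical_map chi) id D D'.
Proof.
move=> cchi chi01 s01 hs hc.
have hh := vertical_homeomorphism cchi chi01.
pose psis j y := y + s j * (psi y - y).
have pls j : increasing_pl (psis j) 0 1 by exact: ipl_interp.
have psis0 j : psis j 0 = 0 by rewrite /psis psi0 subrr mulr0 addr0.
have psis1 j : psis j 1 = 1 by rewrite /psis psi1 subrr mulr0 addr0.
have [g gP] := choice (fun j => ipl_inverse (pls j)).
have gK j y : 0 <= y <= 1 -> g j (psis j y) = y by have [_ + _] := gP j; apply.
have Kg j z : 0 <= z <= 1 -> 0 <= g j z <= 1 /\ psis j (g j z) = z.
  by have [_ _ +] := gP j; rewrite psis0 psis1; apply.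
have g0 j : g j 0 = 0 by rewrite -[in LHS](psis0 j) gK.
have g1 j : g j 1 = 1 by rewrite -[in LHS](psis1 j) gK.
have phiE j y : 0 <= y <= 1 -> phi (chi (strand D j y)) y = psis j y.
  by move=> y01; rewrite phi_id// /psis; case: (hs j y y01) => ->//; rewrite subrr !mulr0.
have onj j p : strip p -> strand D j (g j (vertical_map chi p).2) = p.1 ->
    g j (vertical_map chi p).2 = p.2.
  move=> sp; set y' := (vertical_map chi p).2.
  have y'01 : 0 <= y' <= 1 by exact: phi_itv.
  have [gy gE] := Kg j _ y'01; move=> e; have := phiE j _ gy.
  rewrite gE e; case: (ltgtP (g j y') p.2) => // lt.
    by have := phi_mono (chi01 p.1) lt => + e'; rewrite e' ltxx.
  by have := phi_mono (chi01 p.1) lt => + e'; rewrite e' ltxx.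
have on j p : strip p -> (strand D j \o g j) (vertical_map chi p).2 = (vertical_map chi p).1 <->
    strand D j p.2 = p.1.
  move=> sp; split=> /= [e|e]; first by rewrite -(onj j p sp e).
  have -> : (p.2 + chi p.1 * (psi (clamp 0 1 p.2) - clamp 0 1 p.2)) = psis j p.2.
    by rewrite -[LHS]/(phi (chi p.1) p.2) -e phiE.
  by rewrite gK.
have ps j : piecewise_smooth (strand D j \o g j) 0 1.
  have [plg _ _] := gP j; rewrite psis0 psis1 in plg.
  by apply: ipl_comp plg _; rewrite g0 g1; exact: strand_psmooth.
have der l (y c e a : R) : 0 < y < 1 -> 0 < c -> (\forall z \near y, psi z = c * z + e) ->
    is_derive y 1 (strand D l) a ->
    is_derive (psis l y) 1 (strand D l \o g l) ((1 - s l + s l * c)^-1 * a).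
  move=> y01 c0 npsi da; set cs := 1 - s l + s l * c.
  have cs0 : 0 < cs.
    by have /andP[? ?] := s01 l; rewrite /cs; have [?|?] := ltP (s l) 1; nra.
  set d := - (s l * e) / cs.
  have yE : cs^-1 * psis l y + d = y.
    rewrite /psis (nbhs_singleton npsi) /d /cs; field; exact: lt0r_neq0.
  have ca : continuous (fun z => cs^-1 * z + d).
    move=> z; apply: cvgD; last exact: cvg_cst.
    by apply: cvgM; [exact: cvg_cst|exact: cvg_id].
  rewrite -yE in da; apply: near_eq_is_derive (is_derive_comp_affine da).
  have cy : (cs^-1 * z + d) @[z --> psis l y] --> y by rewrite -[X in _ --> X]yE; exact: ca.
  have /andP[y0 y1] := y01.
  have n3 : \forall z \near psis l y, psi (cs^-1 * z + d) = c * (cs^-1 * z + d) + e.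
    exact: cy npsi.
  near=> z; rewrite /=.
  have w0 : 0 < cs^-1 * z + d by near: z; exact: (cvgr_gt y).
  have w1 : cs^-1 * z + d < 1 by near: z; exact: (cvgr_lt y).
  have w2 : psi (cs^-1 * z + d) = c * (cs^-1 * z + d) + e by near: z.
  have zE : z = psis l (cs^-1 * z + d).
    rewrite /psis w2 /d /cs; field; exact: lt0r_neq0.
  by rewrite [in g l z]zE gK// (ltW w0) (ltW w1).
have tr (j k : 'I_n) y : 0 <= y <= 1 -> j != k ->
    (strand D j \o g j) y = (strand D k \o g k) y ->
    exists a b : R, [/\ is_derive y 1 (strand D j \o g j) a,
      is_derive y 1 (strand D k \o g k) b & a != b].
  move=> y01 jk e; have [q sq hq] := carry_surj hh (y01 : strip ((strand D j \o g j) y, y)).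
  have hq2 : (vertical_map chi q).2 = y by rewrite hq.
  have hq1 : (vertical_map chi q).1 = (strand D j \o g j) y by rewrite hq.
  have gj : g j y = q.2 by rewrite -hq2; apply: onj => //; rewrite hq2.
  have gk : g k y = q.2 by rewrite -hq2; apply: onj => //; rewrite hq2 -/((_ \o _) y) -e.
  have [/= qj _] := Kg j _ y01; rewrite gj in qj.
  have eq : strand D j q.2 = strand D k q.2 by move: e; rewrite /= gj gk.
  have [a [b [da db ab]]] := strand_transverse qj jk eq.
  have [c [c' [c0 npsi sc]]] := hc j k q.2 qj jk eq.
  have q01 := double_interior qj jk eq.
  have yj : psis j q.2 = y by rewrite -gj; have [] := Kg j _ y01.
  have yk : psis k q.2 = y by rewrite -gk; have [] := Kg k _ y01.
  have dj := der j _ _ _ _ q01 c0 npsi da; have dk := der k _ _ _ _ q01 c0 npsi db.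
  rewrite yj in dj; rewrite yk in dk.
  (* Both strands are reparametrized with the same slope at the crossing, so their derivatives are
     divided by the same number and stay distinct. *)
  have cse : 1 - s j + s j * c = 1 - s k + s k * c.
    by case: sc => ->//; rewrite !mulr1 !subrK.
  rewrite -cse in dk; exists ((1 - s j + s j * c)^-1 * a), ((1 - s j + s j * c)^-1 * b).
  split=> //; apply: contra ab => /eqP/mulfI -> //.
  rewrite invr_eq0 gt_eqF//.
  by have /andP[? ?] := s01 j; have [?|?] := ltP (s j) 1; nra.
have [D' _ cD'] := transport hh (@vertical_boundary chi) on ps tr.
by exists D'.
Unshelve. all: by end_near. Qed.

(** Replacing [chi] and [s] by [t * chi] and [t * s] preserves the hypotheses, so the same transport
    gives the diagram at every time [t]. *)
Lemma vertical_isotopy (chi : R -> R) (s : 'I_n -> R) : continuous chi ->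
  (forall x, 0 <= chi x <= 1) -> (forall j, 0 <= s j <= 1) ->
  (forall j y, 0 <= y <= 1 -> chi (strand D j y) = s j \/ psi y = y) ->
  (forall j k y, 0 <= y <= 1 -> j != k -> strand D j y = strand D k y ->
    exists c e, [/\ 0 < c, \forall z \near y, psi z = c * z + e & s j = s k \/ c = 1]) ->
  exists D' : diagram R n, isotopic D D' /\ carries strip (vertical_map chi) id D D'.
Proof.
move=> cchi chi01 s01 hs hc.
have [D' cD'] := vertical_transport cchi chi01 s01 hs hc.
exists D'; split=> //; exists (fun t => vertical_map (fun x => t * chi x)); split.
- exact/continuous_subspaceT/vertical_continuous.
- move=> t /andP[t0 t1].
  have ct : continuous (fun x => t * chi x).
    by move=> x; apply: cvgM; [exact: cvg_cst|exact: cchi].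
  have t01 x : 0 <= t * chi x <= 1.
    by have /andP[? ?] := chi01 x; apply/andP; split; nra.
  split; [exact: vertical_homeomorphism|exact: vertical_boundary|].
  apply: (@vertical_transport _ (fun j => t * s j)) => //.
  + by move=> j; have /andP[? ?] := s01 j; apply/andP; split; nra.
  + by move=> j y /(hs j)[->|->]; [left|right].
  + move=> j k y y01 jk /(hc j k y y01 jk)[c [e [c0 ne sc]]]; exists c, e; split=> //.
    by case: sc => ->; [left|right].
- by move=> p _; rewrite /vertical_map mul0r mul0r addr0 -surjective_pairing.
- have -> : (fun x => 1 * chi x) = chi by apply/funext => x; rewrite mul1r.
  exact: cD'.
Qed.

End VerticalTransport.

(** * Interpolation that is affine near the nodes *)

Section Nodes.
Context {R : realType}.

Definition affine_near (psi : R -> R) (y : R) : Prop :=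
  exists c e, 0 < c /\ \forall z \near y, psi z = c * z + e.

Let lt2 (p q : R * R) : bool := (p.1 < q.1) && (p.2 < q.2).

(** Segments from node to node would break at the nodes. Instead the segment reaching a node [z] is
    prolonged to a point [v] just beyond it, where the next one starts, so that the breaks fall
    strictly between nodes. *)
Lemma ipl_nodes (zs : seq (R * R)) (a b : R * R) : path lt2 a (rcons zs b) ->
  exists psi, [/\ increasing_pl psi a.1 b.1, psi a.1 = a.2, psi b.1 = b.2 &
    forall q, q \in zs -> psi q.1 = q.2 /\ affine_near psi q.1].
Proof.
elim: zs a => [|z zs IH] a /=.
  rewrite andbT => /andP[ab1 ab2]; pose c := (b.2 - a.2) / (b.1 - a.1).
  have ba : b.1 - a.1 != 0 by rewrite subr_eq0 gt_eqF.
  exists (fun y => c * y + (a.2 - c * a.1)); split=> //.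
  - by apply: (@ipl_piece _ _ _ _ c (a.2 - c * a.1)); rewrite // divr_gt0 ?subr_gt0.
  - by ring.
  - by rewrite /c; field.
move=> /andP[/andP[az1 az2] pz].
pose c := (z.2 - a.2) / (z.1 - a.1).
have za : z.1 - a.1 != 0 by rewrite subr_eq0 gt_eqF.
have c0 : 0 < c by rewrite divr_gt0 ?subr_gt0.
have zE : c * z.1 + (a.2 - c * a.1) = z.2 by rewrite /c; field.
clearbody c; set w := head b zs.
have [/andP[zw1 zw2] hd] : lt2 z w /\ (forall v, lt2 v w -> path lt2 v (rcons zs b)).
  by move: pz; rewrite /w; case: (zs) => [|w' zs'] /=;
    [rewrite andbT|case/andP]; move=> ? *; split=> // v ->.
(* At most half of the room up to the next node [w] is used in each coordinate, so that [v] is still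
   below [w] in both. *)
pose d := Num.min ((w.1 - z.1) / 2) ((w.2 - z.2) / (2 * c)).
have d0 : 0 < d.
  by rewrite lt_min; apply/andP; split; apply: divr_gt0 => //; rewrite ?subr_gt0// mulr_gt0.
have d1 : d <= (w.1 - z.1) / 2 by rewrite ge_min lexx.
have d2 : c * d <= (w.2 - z.2) / 2.
  have h : d <= (w.2 - z.2) / (2 * c) by rewrite ge_min lexx orbT.
  rewrite ler_pdivlMr ?mulr_gt0// in h.
  have e : d * (2 * c) = c * d * 2 by ring.
  by rewrite ler_pdivlMr// -e.
clearbody d w; pose v := (z.1 + d, z.2 + c * d).
have /hd pv : lt2 v w by rewrite /lt2 /v /=; apply/andP; split; lra.
have [psi [pl pv1 pb pn]] := IH v pv.
pose phi y := if y <= v.1 then c * y + (a.2 - c * a.1) else psi y.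
have phiv : phi v.1 = psi v.1.
  by rewrite /phi lexx pv1 /v /= -zE; ring.
have phigt y : v.1 <= y -> phi y = psi y.
  by rewrite le_eqVlt => /orP[/eqP <-//|vy]; rewrite /phi leNgt vy.
have av : a.1 < v.1 by rewrite /v /=; lra.
have vb := ipl_lt pl.
exists phi; split.
- apply: (@ipl_glue _ _ _ v.1).
    apply: (@ipl_piece _ _ _ _ c (a.2 - c * a.1)) => // y /andP[_ yv].
    by rewrite /phi yv.
  by apply: ipl_eq pl _ => y /andP[vy _]; rewrite phigt.
- by rewrite /phi (ltW av); ring.
- by rewrite phigt ?(ltW vb).
- move=> q; rewrite inE => /orP[/eqP ->|qz].
    split; first by rewrite /phi /v /= lerDl (ltW d0).
    exists c, (a.2 - c * a.1); split=> //; near=> y; rewrite /phi.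
    have -> // : y <= v.1; apply/ltW; near: y; apply: lt_nbhsl.
    by rewrite /v /= ltrDl.
  have vq : v.1 < q.1.
    have tr : transitive lt2.
      by move=> x1 x2 x3 /andP[? ?] /andP[? ?]; apply/andP; split; lra.
    have /allP/(_ q) := order_path_min tr pv.
    by rewrite mem_rcons inE qz orbT => /(_ isT)/andP[].
  have [qE [c' [e' [c'0 nq]]]] := pn q qz; split; first by rewrite phigt ?(ltW vq).
  exists c', e'; split=> //; near=> y; rewrite phigt; first by near: y.
  by apply/ltW; near: y; exact: lt_nbhsr.
Unshelve. all: by end_near. Qed.

End Nodes.

(** * Separation of the heights of the events *)

Section Strictify.
Context {R : realType} {n : nat} (hn : (0 < n)%N).
Implicit Types (D : diagram R n) (p q : R * R).

Lemma carry_reading D (D' : diagram R n) h ps : self_homeomorphism strip h ->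
  (forall p, p.2 = 0 \/ p.2 = 1 -> h p = p) -> carries strip h id D D' ->
  reading D ps -> sorted (fun p q => q.2 <= p.2) (map h ps) ->
  reading D' (map h ps) /\ map (letter hn D') (map h ps) = map (letter hn D) ps.
Proof.
move=> hh hb hc [ups _ eps] so.
have st p : p \in ps -> strip p by move=> /eps/event_strip/lt01_le01.
split; last first.
  rewrite -map_comp; apply/eq_in_map => p pps /=.
  by apply: (carry_letter hh hb hc); [exact: st|exact/eps].
split=> //.
  by rewrite map_inj_in_uniq// => p q /st sp /st sq; exact: carry_inj hh _ _ sp sq.
move=> p; split=> [/mapP[q qps ->]|ep].
  by apply/(carry_event hc (st _ qps)); exact/eps.
have sp := lt01_le01 (event_strip ep); have [q sq e] := carry_surj hh sp.
by rewrite -e; apply: map_f; apply/eps/(carry_event hc sq); rewrite e.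
Qed.

Lemma event_on D p : event D p -> exists j, strand D j p.2 = p.1.
Proof. by case=> [[j [_ [_ [_ jp] _]]]|/bars_on[_ [j [jp _]]]]; exists j. Qed.

(** The map [psi] moves only the heights of a window in which all events are at the height of [e],
    and there [chi] vanishes on the strands that do not pass through [e]. Hence the other events
    stay, even those at the same height. *)
Lemma tube_shift D e b : event D e -> e.2 < b ->
  exists (D' : diagram R n) h, [/\ isotopic D D', self_homeomorphism strip h,
    (forall p, p.2 = 0 \/ p.2 = 1 -> h p = p) /\ carries strip h id D D',
    e.2 < (h e).2 < b & forall q, event D q -> q != e -> h q = q].
Proof.
move=> ee eb; set x0 := e.1; set y0 := e.2.
have /andP[y00 y01] := event_strip ee; rewrite -/y0 in y00 y01.
have y0i : 0 <= y0 <= 1 by rewrite !ltW.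
(* The other strands are more than [3 * r] away at the height of [e], so they remain beyond [2 * r]
   nearby, while those through [e] stay within [r]. Below, [chi] falls from 1 to 0 between these two
   distances. *)
have [r [r0 hr]] : exists r, 0 < r /\
    forall l, strand D l y0 != x0 -> 3 * r < `|strand D l y0 - x0|.
  have : \forall r \near (0 : R)^'+, forall l, strand D l y0 != x0 ->
      3 * r < `|strand D l y0 - x0|.
    apply: filter_forall => l; have [->|ne] := eqVneq (strand D l y0) x0.
      by apply: nearW.
    have d0 : 0 < `|strand D l y0 - x0| / 3 by rewrite divr_gt0// normr_gt0 subr_eq0.
    by apply: filterS (nbhs_right_lt d0) => r h _; rewrite mulrC -ltr_pdivlMr.
  move=> h; near (0 : R)^'+ => r; exists r; split; last by near: r.
  by near: r; exact: nbhs_right_gt.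
have [ps [_ _ eps]] := reading_exists D.
have near1 : \forall z \near y0, [/\ 0 < z, z < 1, z < b,
    (forall l, if strand D l y0 == x0 then `|strandc D l z - x0| < r
               else 2 * r < `|strandc D l z - x0|) &
    forall i : 'I_(size ps), (nth (0, 0) ps i).2 = z -> z = y0].
  near=> z; split.
  - by near: z; exact: lt_nbhsr.
  - by near: z; exact: lt_nbhsl.
  - by near: z; exact: lt_nbhsl.
  - near: z; apply: filter_forall => l.
    have cl : (fun z => strandc D l z - x0) @ y0 --> strand D l y0 - x0.
      rewrite -(strandcE D l y0i).
      by apply: cvgB; [exact: strandc_continuous|exact: cvg_cst].
    have cn : `|strandc D l z - x0| @[z --> y0] --> `|strand D l y0 - x0|.
        exact: cvg_norm cl.
      case: eqVneq => [el|ne].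
      have lt : `|strand D l y0 - x0| < r by rewrite el subrr normr0.
      by apply: filterS (cvgr_lt _ cn _ lt) => z h.
    have lt : 2 * r < `|strand D l y0 - x0|.
      by apply: lt_trans (hr l ne); rewrite ltr_pM2r// ltr_nat.
    by apply: filterS (cvgr_gt _ cn _ lt) => z h.
  - near: z; apply: filter_forall => i.
    have [->|ne] := eqVneq (nth (0, 0) ps i).2 y0; first exact: nearW.
    have ci : z - (nth (0, 0) ps i).2 @[z --> y0] --> y0 - (nth (0, 0) ps i).2.
      by apply: cvgB; [exact: cvg_id|exact: cvg_cst].
    have ne0 : y0 - (nth (0, 0) ps i).2 != 0 by rewrite subr_eq0 eq_sym.
    by apply: filterS (cvgr_neq0 _ ci ne0) => z + e'; rewrite e' subrr eqxx.
move: near1 => [d /= d0 hd].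
have {}hd z : `|z - y0| < d -> [/\ 0 < z, z < 1, z < b,
    (forall l, if strand D l y0 == x0 then `|strand D l z - x0| < r
               else 2 * r < `|strand D l z - x0|) &
    forall q, event D q -> q.2 = z -> z = y0].
  rewrite distrC => /hd[z0 z1 zb zl zp]; split=> //.
    by move=> l; have := zl l; rewrite strandcE// !ltW.
  move=> q /eps qps qz; have qi : (index q ps < size ps)%N by rewrite index_mem.
  have := zp (Ordinal qi).
  by rewrite /= nth_index//; apply.
pose d2 := d / 2; have d20 : 0 < d2 by rewrite divr_gt0.
have d2d : d2 < d by rewrite /d2; lra.
pose al := y0 - d2; pose be := y0 + d2.
have win z : al <= z <= be -> `|z - y0| < d.
  move=> /andP[h1 h2]; apply: le_lt_trans d2d; rewrite ler_norml.
  by rewrite /al /be in h1 h2; apply/andP; split; lra.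
(* The ends of the window are fixed, and the height of [e] rises halfway to the upper end. *)
have nodes : path (fun p q : R * R => (p.1 < q.1) && (p.2 < q.2)) (al, al)
    (rcons [:: (y0, y0 + d2 / 2)] (be, be)).
  by rewrite /= andbT /al /be; apply/andP; split; apply/andP; split; lra.
have [psi0 [pl pal pbe pn]] := ipl_nodes nodes.
have [/= py0 [c [c' [c0 nc]]]] := pn _ (mem_head _ _).
move: pl pal pbe => /= pl pal pbe.
pose psi z := if al <= z <= be then psi0 z else z.
have alb : al < be by rewrite /al /be; lra.
have alw : al <= al <= be by rewrite lexx ltW.
have bew : al <= be <= be by rewrite lexx ltW.
have [al0 _ _ _ _] := hd al (win al alw); have [_ be1 beb _ _] := hd be (win be bew).
have psiin z : al <= z <= be -> psi z = psi0 z by rewrite /psi => ->.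
have psiout z : z <= al \/ be <= z -> psi z = z.
  rewrite /psi; case: ifP => // /andP[h1 h2] h3.
  case: h3 => h3; first by have -> : z = al by apply/eqP; rewrite eq_le h3 h1.
  by have -> : z = be by apply/eqP; rewrite eq_le h3 h2.
have plpsi : increasing_pl psi 0 1.
  have idpl a a' : a < a' -> (a' <= al \/ be <= a) -> increasing_pl psi a a'.
    move=> aa' h; apply: (@ipl_piece _ _ _ _ 1 0) => // z /andP[h1 h2].
    rewrite mul1r addr0 psiout//; case: h => h; [left|right].
      exact: le_trans h2 h.
    exact: le_trans h h1.
  apply: (@ipl_glue _ _ _ al); first by apply: idpl => //; left.
  apply: (@ipl_glue _ _ _ be); last by apply: idpl => //; right.
  by apply: ipl_eq pl _ => z /psiin.
have p0 : psi 0 = 0 by apply: psiout; left; exact: ltW.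
have p1 : psi 1 = 1 by apply: psiout; right; exact: ltW.
pose chi x : R := clamp 0 1 (2 - `|x - x0| / r).
have chi01 x : 0 <= chi x <= 1 by exact: clamp_itv.
have cchi : continuous chi.
  move=> x; apply: (@continuous_comp _ _ _ (fun x => 2 - `|x - x0| / r));
    last exact: continuous_clamp.
  apply: cvgB; first exact: cvg_cst.
  apply: cvgM; last exact: cvg_cst.
  by apply: cvg_norm; apply: cvgB; [exact: cvg_id|exact: cvg_cst].
have chi1 x : `|x - x0| < r -> chi x = 1.
  move=> h; have h' : `|x - x0| / r < 1 by rewrite ltr_pdivrMr// mul1r.
  rewrite /chi /clamp (min_idPl _) ?(max_idPr _)//; lra.
have chi0 x : 2 * r < `|x - x0| -> chi x = 0.
  move=> h; have h' : 2 < `|x - x0| / r by rewrite ltr_pdivlMr.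
  by rewrite /chi /clamp (min_idPr _) ?(max_idPl _)//; lra.
pose s l : R := if strand D l y0 == x0 then 1 else 0.
have s01 l : 0 <= s l <= 1 by rewrite /s; case: ifP; rewrite lexx ler01.
have out z : ~~ (al <= z <= be) -> z < al \/ be < z.
  by rewrite negb_and -!ltNge => /orP.
have chis z l : al <= z <= be -> chi (strand D l z) = s l.
  move=> /win/hd[_ _ _ /(_ l) + _]; rewrite /s.
  by case: ifP => _; [exact: chi1|exact: chi0].
have [||D' [iso cD']] := @vertical_isotopy R n D psi plpsi p0 p1 chi s cchi chi01 s01.
- move=> j z z01; case: (boolP (al <= z <= be)) => zi; [left; exact: chis|right].
  by apply: psiout; case: (out _ zi) => /ltW; [left|right].
- move=> j k z z01 jk jkz; case: (boolP (al <= z <= be)) => zi.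
    have ez : event D (strand D j z, z).
      by left; exists j, k; split=> //; split=> //=; rewrite jkz.
    have [_ _ _ _ /(_ _ ez erefl) zy] := hd z (win z zi).
    exists c, c'; split=> //; last first.
      by left; rewrite /s -zy jkz.
    rewrite zy; near=> w; rewrite psiin; first by near: w.
    apply/andP; split; apply/ltW; near: w.
      by apply: lt_nbhsr; rewrite /al; lra.
    by apply: lt_nbhsl; rewrite /be; lra.
  exists 1, 0; split=> //; last by right.
  case: (out _ zi) => zo; near=> w; rewrite mul1r addr0 psiout//.
    by left; apply/ltW; near: w; exact: lt_nbhsl.
  by right; apply/ltW; near: w; exact: lt_nbhsr.
exists D', (vertical_map psi chi); split=> //.
- exact: vertical_homeomorphism.
- by split=> //; exact: vertical_boundary.
- have ye : al <= y0 <= be by rewrite /al /be; apply/andP; split; lra.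
  rewrite /vertical_map /= -/x0 -/y0 clamp_id// psiin// py0 chi1 ?subrr ?normr0//.
  by rewrite mul1r; apply/andP; split; rewrite /be in beb; lra.
- move=> q eq qe; have q01 := event_strip eq.
  rewrite /vertical_map clamp_id ?lt01_le01//.
  case: (boolP (al <= q.2 <= be)) => qi; last first.
    rewrite psiout; first by rewrite subrr mulr0 addr0 -surjective_pairing.
    by case: (out _ qi) => /ltW; [left|right].
  have [_ _ _ hl /(_ q eq erefl) qy] := hd _ (win _ qi).
  have [l lq] := event_on eq; rewrite qy in lq.
  have ne : strand D l y0 != x0.
    apply: contra qe => /eqP e'; apply/eqP.
    by rewrite [LHS]surjective_pairing [RHS]surjective_pairing -lq qy -/x0 -/y0 e'.
  have /= := hl l; rewrite (negPf ne) qy lq => /chi0 ->.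
  by rewrite mul0r addr0 -qy -surjective_pairing.
Unshelve. all: by end_near. Qed.

Definition sreading D ps : Prop := reading D ps /\ sorted (fun p q => q.2 < p.2) ps.

(** [L1] is the part whose heights are already separated. The head of [L2] is raised a little,
    staying below [L1]; it gets strictly above the rest of [L2] and joins [L1]. *)
Lemma strictify_suffix D L1 L2 : reading D (L1 ++ L2) ->
  pairwise (fun p q => q.2 < p.2) L1 ->
  (forall p q, p \in L1 -> q \in L2 -> q.2 < p.2) ->
  exists (D' : diagram R n) ps, [/\ diagram_equiv D D', sreading D' ps &
    map (letter hn D') ps = map (letter hn D) (L1 ++ L2)].
Proof.
have tr : transitive (fun p q : R * R => q.2 < p.2).
  by move=> q p r /= pq qr; exact: lt_trans qr pq.
elim: L2 L1 D => [|e L2 IH] L1 D rD p1 p12.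
  exists D, (L1 ++ [::]); split=> //; first exact: rst_refl.
  by split=> //; rewrite cats0 sorted_pairwise.
have [u12 so12 e12] := rD.
have ee : event D e by apply/e12; rewrite mem_cat mem_head orbT.
have [b [eb hb]] : exists b, e.2 < b /\ forall p, p \in L1 -> b <= p.2.
  elim: (L1) p12 => [|p L IHL] h; first by exists (e.2 + 1); split=> //; rewrite ltrDl.
  have [|b [eb hb]] := IHL; first by move=> p' q pL; apply: h; rewrite inE pL orbT.
  exists (Num.min p.2 b); split; first by rewrite lt_min eb h ?mem_head.
  by move=> q; rewrite inE => /orP[/eqP ->|/hb]; rewrite ge_min ?lexx// => ->; rewrite orbT.
have [D' [h [iso hh [hbd hc] /andP[he1 he2] hq]]] := tube_shift ee eb.
have idL p : p \in L1 ++ L2 -> h p = p.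
  move=> pL; apply: hq; first by apply/e12; move: pL; rewrite !mem_cat inE => /orP[] ->; rewrite ?orbT.
  apply: contraTneq pL => ->; move: u12; rewrite cat_uniq /= mem_cat !negb_or.
  by move=> /and3P[_ /andP[-> _] /andP[-> _]].
have mapE : map h (L1 ++ e :: L2) = rcons L1 (h e) ++ L2.
  rewrite cat_rcons map_cat /=; congr (_ ++ _ :: _).
    by apply: map_id_in => p pL; apply: idL; rewrite mem_cat pL.
  by apply: map_id_in => p pL; apply: idL; rewrite mem_cat pL orbT.
have sL2 p : p \in L2 -> p.2 <= e.2.
  move=> pL; have := reading_pairwise rD; rewrite pairwise_cat => /and3P[_ _] /=.
  by move=> /andP[/allP/(_ p pL)].
have p1' : pairwise (fun p q => q.2 < p.2) (rcons L1 (h e)).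
  rewrite -cats1 pairwise_cat p1 /= !andbT; apply/allrelP => p q pL.
  by rewrite inE => /eqP ->; apply: lt_le_trans he2 (hb p pL).
have p12' p q : p \in rcons L1 (h e) -> q \in L2 -> q.2 < p.2.
  rewrite mem_rcons inE => /orP[/eqP -> qL|pL qL].
    exact: le_lt_trans (sL2 q qL) he1.
  by apply: p12 => //; rewrite inE qL orbT.
have [|rD' lD'] := carry_reading hh hbd hc rD.
  rewrite mapE sorted_pairwise; last by move=> q p r /= pq qr; exact: le_trans qr pq.
  rewrite pairwise_cat; apply/and3P; split.
  - by apply/allrelP => p q pL qL; apply/ltW/p12'.
  - by apply: sub_pairwise p1' => p q /= /ltW.
  - by have := reading_pairwise rD; rewrite pairwise_cat => /and3P[_ _] /= /andP[_].
rewrite mapE in rD' lD'.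
have [D2 [ps [eq2 sr2 l2]]] := IH _ _ rD' p1' p12'.
exists D2, ps; split=> //; last by rewrite l2 lD'.
by apply: rst_trans eq2; apply: rst_step; left.
Qed.

Lemma strictify D w : reads hn D w -> exists (D' : diagram R n) ps,
  [/\ diagram_equiv D D', sreading D' ps & w = map (letter hn D') ps].
Proof.
move=> [ps rps ->]; have [//|D' [qs [e s l]]] := @strictify_suffix D [::] ps rps isT.
by exists D', qs.
Qed.

End Strictify.

(** * The order of the strands *)

Section Order.
Context {R : realType} {n : nat}.

Lemma nbhs_right_nbhs (P : set R) (s : R) :
  (\forall z \near s, P z) -> \forall z \near s^'+, P z.
Proof. by rewrite near_withinE; apply: filterS. Qed.

Lemma nbhs_left_nbhs (P : set R) (s : R) :
  (\forall z \near s, P z) -> \forall z \near s^'-, P z.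
Proof. by rewrite near_withinE; apply: filterS. Qed.

Implicit Types (D F : diagram R n) (j k l m : 'I_n).

(* The order of two strands that meet at height s is eps above s and the
   opposite one below. *)
Definition orders F (s : R) (eps : 'I_n * 'I_n -> bool) (z : R) : Prop :=
  forall jk : 'I_n * 'I_n, 0 <= z <= 1 ->
    (strand F jk.1 s < strand F jk.2 s -> strand F jk.1 z < strand F jk.2 z) /\
    (jk.1 != jk.2 -> strand F jk.1 s = strand F jk.2 s -> z != s ->
      (strand F jk.1 z < strand F jk.2 z) = (eps jk == (s < z)) /\
      strand F jk.1 z != strand F jk.2 z).

Lemma local_order F (s : R) : 0 <= s <= 1 ->
  exists eps, \forall z \near s, orders F s eps z.
Proof.
move=> s01.
have /choice[eps heps] (jk : 'I_n * 'I_n) : exists b : bool, \forall z \near s,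
    0 <= z <= 1 ->
    (strand F jk.1 s < strand F jk.2 s -> strand F jk.1 z < strand F jk.2 z) /\
    (jk.1 != jk.2 -> strand F jk.1 s = strand F jk.2 s -> z != s ->
      (strand F jk.1 z < strand F jk.2 z) = (b == (s < z)) /\
      strand F jk.1 z != strand F jk.2 z).
  case: jk => j k /=; have cjk : continuous (fun z => strandc F j z - strandc F k z).
    by move=> z; apply: cvgB; exact: strandc_continuous.
  have cs : (strandc F j z - strandc F k z) @[z --> s] --> strand F j s - strand F k s.
    by rewrite -(strandcE F j s01) -(strandcE F k s01); exact: cjk.
  have [e|ne] := eqVneq (strand F j s) (strand F k s); last first.
    exists true; case: (ltP (strand F j s) (strand F k s)) => lt.
      rewrite -subr_lt0 in lt; apply: filterS (cvgr_lt _ cs _ lt) => z h z01.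
      rewrite !strandcE// subr_lt0 in h; split=> // _ e.
      by move: ne; rewrite e eqxx.
    by near=> z => _; split=> // _ e; move: ne; rewrite e eqxx.
  have [<-|jk] := eqVneq j k; first by exists true; near=> z => _; rewrite ltxx.
  have [a [b [da db ab]]] := strand_transverse s01 jk e.
  have ab0 : a - b != 0 by rewrite subr_eq0.
  (* The difference of the strands has the sign of [a - b], the difference of their derivatives,
     just above the crossing, and the opposite sign just below. *)
  exists (a - b < 0); apply: filterS (is_derive_sign (is_derive_sub da db) ab0) => z h z01.
  rewrite e ltxx; split=> // _ _ zs; move: (h zs); rewrite e subrr subr0.
  rewrite -[strand F j z < _]subr_lt0 -[strand F j z == _]subr_eq0; set u := strand F j z - _ => {}h.
  have u0 : u != 0 by apply: contraTneq h => ->; rewrite mulr0 mul0r ltxx.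
  split=> //; move: h; rewrite -mulrA.
  case: (ltgtP (a - b) 0) ab0 => // A0 _; case: (ltgtP u 0) u0 => // U0 _.
  - by rewrite (nmulr_rgt0 _ A0) (nmulr_rlt0 _ U0) subr_gt0 => ->.
  - by rewrite (nmulr_rgt0 _ A0) (pmulr_rlt0 _ U0) subr_lt0 => sz; rewrite ltNge (ltW sz).
  - by rewrite (pmulr_rgt0 _ A0) (nmulr_rgt0 _ U0) subr_lt0 => sz; rewrite ltNge (ltW sz).
  - by rewrite (pmulr_rgt0 _ A0) (pmulr_rgt0 _ U0) subr_gt0 => ->.
by exists eps; exact: (filter_forall (nbhs_filter s) heps).
Unshelve. all: by end_near. Qed.

Definition rank F (z : R) j : nat := #|[pred m | strand F m z < strand F j z]|.

Lemma rank_lt F z j k : strand F j z < strand F k z -> (rank F z j < rank F z k)%N.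
Proof.
move=> jk; apply: proper_card; apply/properP; split.
  by apply/fintype.subsetP => m; rewrite !inE => /lt_trans; apply.
by exists j; rewrite !inE// ltxx.
Qed.

Lemma rank_pos F z j : rank F z j = pos F (strand F j z, z).
Proof. by []. Qed.

Lemma rank_inj F z j k : rank F z j = rank F z k -> strand F j z = strand F k z.
Proof.
by move=> e; case: (ltgtP (strand F j z) (strand F k z)) => // /rank_lt;
  rewrite e ltnn.
Qed.

Let tame F (s z : R) : Prop := forall j k,
  (strand F j s < strand F k s -> strand F j z < strand F k z) /\
  (j != k -> strand F j z != strand F k z).

(** The strands left of the meeting point at height [s] are still left of [j] at [z]. Besides them
    only the partner [k] can be there, since there are no triple points. *)
Let meet_rank F s z j k : 0 <= s <= 1 -> tame F s z -> j != k ->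
  strand F j s = strand F k s ->
  (pos F (strand F j s, s) <= rank F z j <= (pos F (strand F j s, s)).+1)%N.
Proof.
move=> s01 tm jk e; apply/andP; split.
  apply: subset_leq_card; apply/fintype.subsetP => m; rewrite !inE /= => h.
  by have [] := tm m j; move=> /(_ h).
rewrite -addn1 -(card1 k) -cardUI.
apply: leq_trans (leq_addr _ _); apply: subset_leq_card.
apply/fintype.subsetP => m; rewrite !inE /= => mj.
case: (ltgtP (strand F m s) (strand F j s)) => //= h.
  by have [/(_ h)] := tm j m; move=> h'; move: mj; rewrite ltNge (ltW h').
apply: contraT => mk; exfalso; apply: (@strand_double _ _ F m j k s s01) => //.
  by apply: contraTneq mj => ->; rewrite ltxx.
Qed.

Let two_values (i a b c : nat) : (i <= a <= i.+1)%N -> (i <= b <= i.+1)%N ->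
  (i <= c <= i.+1)%N -> a != b -> c = a \/ c = b.
Proof. by move=> ? ? ? /eqP; lia. Qed.

(** A double point of position [i] at height [s] is the meeting of the strands whose ranks at [z]
    are [i] and [i + 1]. The ranks at [z] and the positions agree in both diagrams, so the same two
    strands meet. *)
Let meet_transfer F F' s z : 0 <= s <= 1 -> tame F s z -> tame F' s z ->
  (forall j k, (strand F j z < strand F k z) = (strand F' j z < strand F' k z)) ->
  (forall p, double_point F p -> exists p', [/\ double_point F' p', p'.2 = p.2 &
     pos F' p' = pos F p]) ->
  forall j k, j != k -> strand F j s = strand F k s -> strand F' j s = strand F' k s.
Proof.
move=> s01 tF tF' so dt j k jk e.
have rE l : rank F z l = rank F' z l.
  by apply: eq_card => m; rewrite !inE so.
have rne G l l' : tame G s z -> l != l' -> rank G z l != rank G z l'.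
  move=> tG ll'; have [_ /(_ ll')] := tG l l'.
  by apply: contra => /eqP/rank_inj ->.
have [|[x y] [[j' [k' [jk' [_ /= jp] [_ /= kp]]]] /= ys pp]] := dt (strand F j s, s).
  by exists j, k; split=> //; split=> //=; rewrite e.
rewrite ys in jp kp pp.
have mj := meet_rank s01 tF jk e.
have kj : k != j by rewrite eq_sym.
have := meet_rank s01 tF kj (esym e); rewrite -e => mk.
rewrite !rE -pp in mj mk.
have e' : strand F' j' s = strand F' k' s by rewrite jp kp.
have mj' := meet_rank s01 tF' jk' e'.
have kj' : k' != j' by rewrite eq_sym.
have := meet_rank s01 tF' kj' (esym e'); rewrite -e' jp => mk'.
rewrite jp in mj'.
have E l : (pos F' (x, s) <= rank F' z l <= (pos F' (x, s)).+1)%N -> strand F' l s = x.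
  move=> ml; have := two_values mj' mk' ml (rne _ _ _ tF' jk').
  have inj l1 l2 : rank F' z l1 = rank F' z l2 -> l1 = l2.
    by move=> e1; apply/eqP; apply: contraT => /(rne F' _ _ tF'); rewrite e1 eqxx.
  by case=> /inj ->.
by rewrite (E j mj) (E k mk).
Qed.

(** Continuous induction downwards from the top, where the endpoints give the order. Let [s] be the
    supremum of the heights where the orders differ: they agree above [s], so the same strands meet
    at [s] and the order at [s] is common; then it is also common just below, a contradiction. *)
Lemma same_crossings_same_order D D' :
  (forall p, double_point D p -> exists p', [/\ double_point D' p', p'.2 = p.2 &
     pos D' p' = pos D p]) ->
  (forall p, double_point D' p -> exists p', [/\ double_point D p', p'.2 = p.2 &
     pos D p' = pos D' p]) ->
  forall (y : R) j k, 0 <= y <= 1 ->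
    (strand D j y < strand D k y) = (strand D' j y < strand D' k y).
Proof.
move=> dt dt' y0 j0 k0 y01; apply/eqP; apply: contraT => bad0; exfalso.
pose same z := forall j k, (strand D j z < strand D k z) = (strand D' j z < strand D' k z).
pose B : set R := [set z | 0 <= z <= 1 /\ ~ same z].
have By0 : B y0 by split=> // /(_ j0 k0)/eqP; exact/negP.
have B1 : ubound B 1 by move=> z [/andP[]].
have supB : has_sup B by split; [exists y0|exists 1].
pose s := sup B.
have s1 : s <= 1 by apply: ge_sup => //; exists y0.
have s0 : 0 <= s.
  by have /andP[h _] := y01; apply: le_trans h _; apply: ub_le_sup => //; exists 1.
have s01 : 0 <= s <= 1 by rewrite s0 s1.
have above z : s < z -> z <= 1 -> same z.
  move=> sz z1; apply: contrapT => nz.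
  have : z <= s by apply: ub_le_sup; [exists 1|split=> //; rewrite z1 (le_trans s0 (ltW sz))].
  by rewrite leNgt sz.
have [eps nD] := local_order D s01; have [eps' nD'] := local_order D' s01.
have sames : same s.
  have [e1|ne1] := eqVneq s 1; first by move=> j k; rewrite e1 !strand_top.
  have {}s1 : s < 1 by rewrite lt_neqAle ne1.
  have [z [sz z1 zD zD']] : exists z, [/\ s < z, z <= 1, tame D s z & tame D' s z].
    near s^'+ => z; exists z.
    have sz : s < z by near: z; exact: nbhs_right_gt.
    have z1 : z <= 1 by near: z; exact: nbhs_right_le.
    have z01 : 0 <= z <= 1 by rewrite z1 (le_trans s0 (ltW sz)).
    have tm G ep : orders G s ep z -> tame G s z.
      move=> oG; have h jk := oG jk z01; move=> j k; have [h1 h2] := h (j, k); split=> // jk.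
      case: (ltgtP (strand G j s) (strand G k s)) => hs.
      - by rewrite lt_eqF// h1.
      - by have [h3 _] := h (k, j); rewrite gt_eqF// h3.
      - by have [] := h2 jk hs _; rewrite // gt_eqF.
    split=> //.
      by apply: (tm D eps); near: z; exact: nbhs_right_nbhs nD.
    by apply: (tm D' eps'); near: z; exact: nbhs_right_nbhs nD'.
  have sz' := above z sz z1.
  have T := meet_transfer s01 zD zD' sz' dt.
  have T' := meet_transfer s01 zD' zD (fun j k => esym (sz' j k)) dt'.
  have imp (G G' : diagram R n) : tame G s z -> tame G' s z ->
      (forall j k, (strand G j z < strand G k z) = (strand G' j z < strand G' k z)) ->
      (forall j k, j != k -> strand G' j s = strand G' k s -> strand G j s = strand G k s) ->
      forall j k, strand G j s < strand G k s -> strand G' j s < strand G' k s.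
    move=> tG tG' sG TG j k lt; have [/(_ lt) + _] := tG j k; rewrite sG => ltz.
    have jk : j != k by apply: contraTneq lt => ->; rewrite ltxx.
    case: (ltgtP (strand G' j s) (strand G' k s)) => // h.
      by have [/(_ h) + _] := tG' k j; rewrite ltNge (ltW ltz).
    by move: lt; rewrite (TG j k jk h) ltxx.
  move=> j k; apply/idP/idP; first exact: (imp D D').
  by apply: (imp D' D) => // j' k'; rewrite sz'.
have [e0|ne0] := eqVneq s 0.
  have y00 : y0 = 0.
    apply/eqP; rewrite eq_le; have /andP[-> _] := y01; rewrite andbT -e0.
    by apply: ub_le_sup => //; exists 1.
  by move/negP: bad0; apply; apply/eqP; rewrite y00 -e0; exact: sames.
have {}s0 : 0 < s by rewrite lt_neqAle eq_sym ne0.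
have agree j k : j != k -> strand D j s = strand D k s -> strand D' j s = strand D' k s.
  move=> _ e; apply/eqP; rewrite eq_le !leNgt -!sames e ltxx.
  by [].
(* A transverse meeting inverts the order of the pair, so the common order just above [s] determines
   the one just below. *)
have epsE j k : j != k -> strand D j s = strand D k s -> eps (j, k) = eps' (j, k).
  move=> jk e; have e' := agree j k jk e.
  have s1' : s < 1.
    rewrite lt_neqAle s1 andbT; apply: contraNneq jk => s1'.
    by move: e; rewrite s1' !strand_top => /endpoint_inj ->.
  near s^'+ => z.
  have sz : s < z by near: z; exact: nbhs_right_gt.
  have z1 : z <= 1 by near: z; exact: nbhs_right_le.
  have z01 : 0 <= z <= 1 by rewrite z1 (le_trans (ltW s0) (ltW sz)).
  have zs : z != s by rewrite gt_eqF.
  have oD : orders D s eps z by near: z; exact: nbhs_right_nbhs nD.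
  have oD' : orders D' s eps' z by near: z; exact: nbhs_right_nbhs nD'.
  have [_ h1] := oD (j, k) z01; have [_ h2] := oD' (j, k) z01.
  have [h1' _] := h1 jk e zs; have [h2' _] := h2 jk e' zs.
  move: h1' h2'; rewrite /= (above z sz z1) sz => ->.
  by case: (eps _); case: (eps' _).
have : \forall z \near s^'-, same z.
  near=> z.
  have zs : z < s by near: z; exact: nbhs_left_lt.
  have z0 : 0 <= z by near: z; exact: nbhs_left_ge.
  have z01 : 0 <= z <= 1 by rewrite z0 (le_trans (ltW zs) s1).
  have zs' : z != s by rewrite lt_eqF.
  have oD : orders D s eps z by near: z; exact: nbhs_left_nbhs nD.
  have oD' : orders D' s eps' z by near: z; exact: nbhs_left_nbhs nD'.
  have h1 jk := oD jk z01; have h2 jk := oD' jk z01.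
  move=> j k; have [<-|jk] := eqVneq j k; first by rewrite !ltxx.
  case: (ltgtP (strand D j s) (strand D k s)) => hs.
  - have [/(_ hs) /= -> _] := h1 (j, k); have := hs; rewrite sames => hs'.
    by have [/(_ hs') /= -> _] := h2 (j, k).
  - have [/(_ hs) /= g1 _] := h1 (k, j); have := hs; rewrite sames => hs'.
    have [/(_ hs') /= g2 _] := h2 (k, j).
    by rewrite !ltNge (ltW g1) (ltW g2).
  - have [_ /(_ jk hs zs')[/= -> _]] := h1 (j, k).
    have [_ /(_ jk (agree j k jk hs) zs')[/= -> _]] := h2 (j, k).
    by rewrite epsE.
move=> nl; have [d /= d0 hd] := nl.
have [z Bz zs] := sup_adherent d0 supB.
have zs' : z <= s by apply: ub_le_sup => //; exists 1.
move: Bz => [z01]; apply; have [->|zs2] := eqVneq z s; first exact: sames.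
apply: hd; last by rewrite lt_neqAle zs2.
by rewrite /= ger0_norm ?subr_ge0//; rewrite -/s in zs; lra.
Unshelve. all: by end_near. Qed.

End Order.

(** * Horizontal isotopies *)

Section LinearCombination.
Context {R : realType}.
Implicit Types (f g h : R -> R) (a b x y s t : R).

Lemma smooth_lincomb h k s t : smooth h -> smooth k ->
  smooth (fun y => s * h y + t * k y).
Proof.
move=> sh sk.
have D m x : is_derive x 1 (fun y => s * derive1n m h y + t * derive1n m k y)
    (s * derive1n m.+1 h x + t * derive1n m.+1 k x).
  have Dh : is_derive x 1 (derive1n m h) (derive1n m.+1 h x).
    by rewrite derive1nS derive1E; apply: derivableP; exact: sh.
  have Dk : is_derive x 1 (derive1n m k) (derive1n m.+1 k x).
    by rewrite derive1nS derive1E; apply: derivableP; exact: sk.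
  by apply: is_deriveD; apply: is_deriveZ.
have E m : derive1n m (fun y => s * h y + t * k y) =
    (fun y => s * derive1n m h y + t * derive1n m k y).
  elim: m => [|m IH]; first by [].
  rewrite derive1nS IH; apply/funext => y; rewrite derive1E.
  by have [] := D m y.
by move=> m x; rewrite E; have [] := D m x.
Qed.

Lemma psmooth_lincomb f g a b s t : piecewise_smooth f a b ->
  piecewise_smooth g a b -> piecewise_smooth (fun y => s * f y + t * g y) a b.
Proof.
elim=> [{}a {}b h ab hh fh|{}a {}b c ab IH1 bc IH2] pg; last first.
  have [lab lbc] := (psmooth_le ab, psmooth_le bc).
  apply: (@psmooth_glue _ _ _ b); [apply: IH1|apply: IH2];
    exact: psmooth_restrict pg _ _ _.
elim: pg fh {ab} => [{}a {}b k ab hk gk|{}a {}b c ab IH1 bc IH2] fh.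
  apply: (@psmooth_piece _ _ _ _ (fun y => s * h y + t * k y) ab (smooth_lincomb hh hk)) => y yab.
  by rewrite fh// gk.
have [lab lbc] := (psmooth_le ab, psmooth_le bc).
apply: (@psmooth_glue _ _ _ b).
  apply: IH1 => y; rewrite in_itv/= => /andP[ay yb]; apply: fh.
  by rewrite in_itv/= ay (le_trans yb).
apply: IH2 => y; rewrite in_itv/= => /andP[by_ yc]; apply: fh.
by rewrite in_itv/= yc (le_trans lab).
Qed.

End LinearCombination.

(** * Ratios of the gaps between strands *)

Section RatioBound.
Context {R : realType} {n : nat}.
Implicit Types (D : diagram R n) (j k : 'I_n).

Definition same_order D D' : Prop := forall (y : R) j k, 0 <= y <= 1 ->
  (strand D j y < strand D k y) = (strand D' j y < strand D' k y).

Lemma same_order_eq D D' y j k : same_order D D' -> 0 <= y <= 1 ->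
  strand D j y = strand D k y -> strand D' j y = strand D' k y.
Proof.
move=> so y01 e; apply/eqP; rewrite eq_le !leNgt -!so// e ltxx.
by [].
Qed.

Lemma same_order_sym D D' : same_order D D' -> same_order D' D.
Proof. by move=> so y j k y01; rewrite so. Qed.

(** At the bottom the rank of a strand is the index of its endpoint, so equal orders give equal
    permutations. *)
Lemma same_order_bottom D D' j : same_order D D' -> strand D j 0 = strand D' j 0.
Proof.
move=> so; have i0 : 0 <= (0 : R) <= 1 by rewrite lexx ler01.
have rk (F : diagram R n) : rank F 0 j = strand_perm F j.
  rewrite /rank -[RHS](card_ord_lt (ltnW (ltn_ord (strand_perm F j)))) -!sum1_card.
  rewrite [RHS](reindex_inj (@perm_inj _ (strand_perm F))).
  by apply: eq_bigl => m; rewrite !inE !strand_bottom endpoint_lt.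
have e : rank D 0 j = rank D' 0 j by apply: eq_card => m; rewrite !inE so.
by rewrite !strand_bottom /endpoint -!rk e.
Qed.

Definition discrepancy D D' (y : R) : R := \sum_j `|strandc D' j y - strandc D j y|.

(** The discrepancy controls the gap ratios near the ends; the second term keeps the slack positive
    at inner heights, where the discrepancy may vanish although the ratios do not tend to 1. *)
Definition slack D D' (y : R) : R := discrepancy D D' y + clamp 0 1 y * (1 - clamp 0 1 y).

Lemma discrepancy_ge0 D D' y : 0 <= discrepancy D D' y.
Proof. by apply: sumr_ge0 => j _; exact: normr_ge0. Qed.

Lemma discrepancy_ge D D' y j : `|strandc D' j y - strandc D j y| <= discrepancy D D' y.
Proof.
rewrite /discrepancy (bigD1 j)//= lerDl; apply: sumr_ge0 => k _; exact: normr_ge0.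
Qed.

Lemma discrepancyC D D' y : discrepancy D D' y = discrepancy D' D y.
Proof. by apply: eq_bigr => j _; rewrite distrC. Qed.

Lemma slack_ge0 D D' y : 0 <= slack D D' y.
Proof.
apply: addr_ge0; first exact: discrepancy_ge0.
by have /andP[? ?] := clamp_itv y (@ler01 R); rewrite mulr_ge0// subr_ge0.
Qed.

Lemma continuous_slack D D' : continuous (slack D D').
Proof.
move=> y; apply: cvgD.
  have : continuous (fun y => \sum_j `|strandc D' j y - strandc D j y|).
    elim: (index_enum _) => [|j r IH] z.
      under eq_fun do rewrite big_nil.
      exact: cvg_cst.
    under eq_fun do rewrite big_cons.
    by apply: cvgD; [apply: cvg_norm; apply: cvgB; exact: strandc_continuous|exact: IH].
  exact.
apply: cvgM; first exact: continuous_clamp.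
by apply: cvgB; [exact: cvg_cst|exact: continuous_clamp].
Qed.

Let gap D j k (y : R) : R := strandc D j y - strandc D k y.

Let continuous_gap D j k : continuous (gap D j k).
Proof. by move=> y; apply: cvgB; exact: strandc_continuous. Qed.

(** At a crossing both gaps vanish to first order: that of [D'] is at most linear, that of [D] at
    least linear by transversality. Elsewhere the gap of [D] is bounded below. *)
Let local_ratio D D' j k (y0 : R) : same_order D D' -> j != k -> 0 < y0 < 1 ->
  exists C : R, \forall y \near y0, `|gap D' j k y| <= C * `|gap D j k y|.
Proof.
move=> so jk y01; have y01' := lt01_le01 y01.
have [e|ne] := eqVneq (strand D j y0) (strand D k y0).
  have e' := same_order_eq so y01' e.
  have [a [b [da db ab]]] := strand_transverse y01' jk e.
  have [a' [b' [da' db' ab']]] := strand_transverse y01' jk e'.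
  have c0 : 0 < `|a - b| / 2 by rewrite divr_gt0// normr_gt0 subr_eq0.
  have n1 := is_derive_near_le (is_derive_sub da db) c0.
  have n2 := is_derive_near_le (is_derive_sub da' db') ltr01.
  exists ((`|a' - b'| + 1) / (`|a - b| / 2)).
  have s1 := strandc_interior D j y01; have s2 := strandc_interior D k y01.
  have s3 := strandc_interior D' j y01; have s4 := strandc_interior D' k y01.
  near=> y.
  have : `|(strand D j y - strand D k y) - (strand D j y0 - strand D k y0)
     - (a - b) * (y - y0)| <= `|a - b| / 2 * `|y - y0| by near: y.
  have : `|(strand D' j y - strand D' k y) - (strand D' j y0 - strand D' k y0)
     - (a' - b') * (y - y0)| <= 1 * `|y - y0| by near: y.
  have -> : strand D j y = strandc D j y by near: y.
  have -> : strand D k y = strandc D k y by near: y.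
  have -> : strand D' j y = strandc D' j y by near: y.
  have -> : strand D' k y = strandc D' k y by near: y.
  rewrite e e' !subrr !subr0 -/(gap D j k y) -/(gap D' j k y) mul1r => h2 h1.
  have l1 : `|a - b| / 2 * `|y - y0| <= `|gap D j k y|.
    have : `|(a - b) * (y - y0)| - `|gap D j k y| <= `|a - b| / 2 * `|y - y0|.
      by apply: le_trans h1; rewrite [leRHS]distrC; exact: lerB_dist.
    by rewrite normrM; lra.
  have l2 : `|gap D' j k y| <= (`|a' - b'| + 1) * `|y - y0|.
    have : `|gap D' j k y| - `|(a' - b') * (y - y0)| <= `|y - y0|.
      by apply: le_trans h2; exact: lerB_dist.
    by rewrite normrM mulrDl mul1r; lra.
  apply: le_trans l2 _; rewrite -mulrA ler_wpM2l ?addr_ge0//.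
  by rewrite mulrC ler_pdivlMr// mulrC.
have g0 : gap D j k y0 != 0 by rewrite /gap !strandcE// subr_eq0.
have c0 : 0 < `|gap D j k y0| by rewrite normr_gt0.
exists ((`|gap D' j k y0| + 1) / (`|gap D j k y0| / 2)).
have n1 : \forall y \near y0, `|gap D j k y0| / 2 < `|gap D j k y|.
  apply: (cvgr_gt _ (cvg_norm (@continuous_gap D j k y0))).
  by rewrite ltr_pdivrMr// ltr_pMr// ltr1n.
have n2 : \forall y \near y0, `|gap D' j k y| < `|gap D' j k y0| + 1.
  by apply: (cvgr_lt _ (cvg_norm (@continuous_gap D' j k y0))); rewrite ltrDl.
near=> y.
have h1 : `|gap D j k y0| / 2 < `|gap D j k y| by near: y.
have h2 : `|gap D' j k y| < `|gap D' j k y0| + 1 by near: y.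
apply: le_trans (ltW h2) _; rewrite -mulrA ler_peMr ?addr_ge0//.
by rewrite mulrC ler_pdivlMr ?divr_gt0// mul1r ltW.
Unshelve. all: by end_near. Qed.

(** Distinct endpoints are at distance at least 1, so near the ends the gap of [D] exceeds 1/2. The
    two gaps differ by at most twice the discrepancy, and 4 is the quotient of 2 by 1/2. *)
Let boundary_ratio D D' j k (y0 : R) : same_order D D' -> j != k -> y0 = 0 \/ y0 = 1 ->
  \forall y \near y0, `|gap D' j k y| <= (1 + 4 * discrepancy D D' y) * `|gap D j k y|.
Proof.
move=> so jk hy0.
have one (a b : 'I_n) : a != b -> 1 <= `|endpoint R a - endpoint R b|.
  have lt (a' b' : 'I_n) : (a' < b')%N -> 1 <= endpoint R b' - endpoint R a'.
    by move=> h; rewrite /endpoint -natrB ?ler1n ?subn_gt0 // ltnW.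
  rewrite -val_eqE neq_ltn => /orP[/lt h|/lt h].
    by rewrite distrC; apply: le_trans h (ler_norm _).
  by apply: le_trans h (ler_norm _).
have g1 : 1 <= `|gap D j k y0|.
  rewrite /gap; case: hy0 => ->; rewrite !strandcE ?lexx ?ler01//.
    by rewrite !strand_bottom one// (inj_eq perm_inj).
  by rewrite !strand_top one.
have n1 : \forall y \near y0, 2^-1 < `|gap D j k y|.
  apply: (cvgr_gt _ (cvg_norm (@continuous_gap D j k y0))).
  by apply: lt_le_trans g1; lra.
near=> y.
have h1 : 2^-1 < `|gap D j k y| by near: y.
have h2 : `|gap D' j k y| <= `|gap D j k y| + 2 * discrepancy D D' y.
  have -> : gap D' j k y = gap D j k y + ((strandc D' j y - strandc D j y) -
      (strandc D' k y - strandc D k y)) by rewrite /gap; ring.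
  apply: le_trans (ler_normD _ _) _; rewrite lerD2l; apply: le_trans (ler_normB _ _) _.
  by have := discrepancy_ge D D' y j; have := discrepancy_ge D D' y k; lra.
have := discrepancy_ge0 D D' y; move: h1 h2; set u := `|gap D j k y|.
by move: (discrepancy _ _ _) => r h1 h2 r0; nra.
Unshelve. all: by end_near. Qed.

Let ratio_local D D' j k (x : R) : same_order D D' -> j != k -> 0 <= x <= 1 ->
  exists K : R, \forall y \near x,
    `|gap D' j k y| <= (1 + K * slack D D' y) * `|gap D j k y|.
Proof.
move=> so jk x01; have [x0|x0] := eqVneq x 0; last have [x1|x1] := eqVneq x 1.
- exists 4; apply: filterS (boundary_ratio so jk (or_introl x0)) => y h.
  apply: le_trans h _; rewrite ler_wpM2r// lerD2l ler_wpM2l// lerDl.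
  by have /andP[? ?] := clamp_itv y (@ler01 R); rewrite mulr_ge0// subr_ge0.
- exists 4; apply: filterS (boundary_ratio so jk (or_intror x1)) => y h.
  apply: le_trans h _; rewrite ler_wpM2r// lerD2l ler_wpM2l// lerDl.
  by have /andP[? ?] := clamp_itv y (@ler01 R); rewrite mulr_ge0// subr_ge0.
have {}x01 : 0 < x < 1 by rewrite !lt_neqAle eq_sym x0 x1.
have [C nC] := local_ratio so jk x01.
have s0 : 0 < slack D D' x.
  apply: ltr_wpDl; first exact: discrepancy_ge0.
  rewrite clamp_id ?lt01_le01//; move/andP: x01 => [? ?].
  by rewrite mulr_gt0// subr_gt0.
have ns : \forall y \near x, slack D D' x / 2 < slack D D' y.
  apply: (cvgr_gt _ (@continuous_slack D D' x)).
  by rewrite ltr_pdivrMr// ltr_pMr// ltr1n.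
(* Near an inner height the slack exceeds half of its value there, so this multiple of it is at
   least [|C|]. *)
exists (`|C| / (slack D D' x / 2)); near=> y.
have h1 : `|gap D' j k y| <= C * `|gap D j k y| by near: y.
have h2 : slack D D' x / 2 < slack D D' y by near: y.
apply: le_trans h1 _; rewrite ler_wpM2r//; apply: le_trans (ler_norm C) _.
apply: (@le_trans _ _ (`|C| / (slack D D' x / 2) * slack D D' y)); last by rewrite lerDr.
rewrite -mulrA ler_peMr// mulrC ler_pdivlMr ?divr_gt0// mul1r ltW//.
Unshelve. all: by end_near. Qed.

(** A local bound persists for every larger [K], the slack being nonnegative. So compactness applies
    in the form of near covering, with the filter of large [K]. *)
Let ratio_bound_pair D D' j k : same_order D D' ->
  \forall K \near +oo, forall y, 0 <= y <= 1 ->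
    `|gap D' j k y| <= (1 + K * slack D D' y) * `|gap D j k y|.
Proof.
move=> so; have [->|jk] := eqVneq j k.
  by near=> K => y _; rewrite /gap !subrr normr0 mulr0.
have /compact_near_coveringP cK := @segment_compact R 0 1.
pose P (K y : R) := `|gap D' j k y| <= (1 + K * slack D D' y) * `|gap D j k y|.
have FF : Filter (pinfty_nbhs R) by exact: _.
have h : \forall K \near +oo, `[0, 1] `<=` P K.
  apply: (cK _ _ _ FF) => x; rewrite /= in_itv/= => x01.
  have [K0 nK] := ratio_local so jk x01.
  exists ([set y | P K0 y], [set K | K0 <= K]) => /=.
    by split=> //; exact: nbhs_pinfty_ge (num_real K0).
  move=> [y K] /= [Py KK]; rewrite /P; apply: le_trans Py _.
  by rewrite ler_wpM2r// lerD2l ler_wpM2r// slack_ge0.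
by apply: filterS h => K hK y y01; apply: hK; rewrite /= in_itv.
Unshelve. all: by end_near. Qed.

Lemma ratio_bound D D' : same_order D D' -> exists K : R, 0 <= K /\
  forall y j k, 0 <= y <= 1 ->
    `|strandc D' j y - strandc D' k y| <=
      (1 + K * slack D D' y) * `|strandc D j y - strandc D k y| /\
    `|strandc D j y - strandc D k y| <=
      (1 + K * slack D D' y) * `|strandc D' j y - strandc D' k y|.
Proof.
move=> so; have so' := same_order_sym so.
have sC y : slack D' D y = slack D D' y by rewrite /slack discrepancyC.
have n1 : \forall K \near +oo, forall jk : 'I_n * 'I_n, forall y, 0 <= y <= 1 ->
    `|gap D' jk.1 jk.2 y| <= (1 + K * slack D D' y) * `|gap D jk.1 jk.2 y|.
  by apply: filter_forall => jk; exact: ratio_bound_pair.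
have n2 : \forall K \near +oo, forall jk : 'I_n * 'I_n, forall y, 0 <= y <= 1 ->
    `|gap D jk.1 jk.2 y| <= (1 + K * slack D' D y) * `|gap D' jk.1 jk.2 y|.
  by apply: filter_forall => jk; exact: ratio_bound_pair.
near +oo_R => K.
have K0 : 0 <= K by near: K; exact: nbhs_pinfty_ge.
have h1 : forall jk : 'I_n * 'I_n, forall y, 0 <= y <= 1 ->
    `|gap D' jk.1 jk.2 y| <= (1 + K * slack D D' y) * `|gap D jk.1 jk.2 y| by near: K.
have h2 : forall jk : 'I_n * 'I_n, forall y, 0 <= y <= 1 ->
    `|gap D jk.1 jk.2 y| <= (1 + K * slack D' D y) * `|gap D' jk.1 jk.2 y| by near: K.
exists K; split=> // y j k y01; split; first exact: (h1 (j, k)).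
by have := h2 (j, k) y y01; rewrite sC.
Unshelve. all: by end_near. Qed.

End RatioBound.

Section ContinuousCompose.

Lemma continuous_compose (X Y Z : topologicalType) (f : X -> Y) (g : Y -> Z) :
  continuous f -> continuous g -> continuous (fun x => g (f x)).
Proof. by move=> cf cg x; exact: (continuous_comp (cf x) (cg (f x))). Qed.

Lemma continuous_minr (R : realType) (X : topologicalType) (f g : X -> R) :
  continuous f -> continuous g -> continuous (fun x => Num.min (f x) (g x)).
Proof. by move=> cf cg x; apply: continuous_min; [exact: cf|exact: cg]. Qed.

Lemma continuous_maxr (R : realType) (X : topologicalType) (f g : X -> R) :
  continuous f -> continuous g -> continuous (fun x => Num.max (f x) (g x)).
Proof. by move=> cf cg x; apply: continuous_max; [exact: cf|exact: cg]. Qed.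

End ContinuousCompose.

(** * The isotopy between two diagrams with the same order of strands *)

Section HorizontalIsotopy.
Context {R : realType} {n : nat} (hn : (0 < n)%N).
Variables (D D' : diagram R n) (K : R).
Hypotheses (so : same_order D D') (K0 : 0 <= K).
Hypothesis hK : forall (y : R) j k, 0 <= y <= 1 ->
  `|strandc D' j y - strandc D' k y| <=
    (1 + K * slack D D' y) * `|strandc D j y - strandc D k y| /\
  `|strandc D j y - strandc D k y| <=
    (1 + K * slack D D' y) * `|strandc D' j y - strandc D' k y|.

Let j0 : 'I_n := Ordinal hn.

Let M (y : R) : R := 1 + K * slack D D' y.

Let M1 y : 1 <= M y.
Proof. by rewrite lerDl mulr_ge0// slack_ge0. Qed.

Let M0 y : 0 < M y. Proof. exact: lt_le_trans (M1 y). Qed.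

Let continuous_M : continuous M.
Proof.
move=> y; apply: cvgD; first exact: cvg_cst.
by apply: cvgM; [exact: cvg_cst|exact: continuous_slack].
Qed.

(** As [M y] is at least 1, the slope is [M y] to the right of 0 and its inverse to the left. A gap
    of [D] is thus stretched to at least the gap of [D'] on the right, and shrunk to at most that
    gap on the left. *)
Let stretch (y u : R) : R := Num.max (M y * u) ((M y)^-1 * u).

Let stretch_lt y u v : u < v -> stretch y u < stretch y v.
Proof.
by move=> uv; rewrite /stretch gt_max !lt_max !ltr_pM2l ?invr_gt0// uv orbT.
Qed.

Let stretch0 y : stretch y 0 = 0.
Proof. by rewrite /stretch !mulr0 maxxx. Qed.

(* Away from their own strand the branches of the minimum are larger, by the
   bounds on the ratios of the gaps between strands. *)
Let branch j (y x : R) : R := strandc D' j y + stretch y (x - strandc D j y).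

Let psi (y x : R) : R := \big[Num.min/branch j0 y x]_(j < n) branch j y x.

Let psi_le y x j : psi y x <= branch j y x.
Proof. by rewrite /psi; apply: bigmin_le_cond. Qed.

Let psi_strand y j : 0 <= y <= 1 -> psi y (strandc D j y) = strandc D' j y.
Proof.
move=> y01; apply/eqP; rewrite eq_le; apply/andP; split.
  by apply: le_trans (psi_le y _ j) _; rewrite /branch subrr stretch0 addr0.
have le k : strandc D' j y <= branch k y (strandc D j y).
  have [h1 h2] := hK j k y01.
  rewrite /branch /stretch -lerBlDl le_max.
  case: (ltgtP (strandc D j y) (strandc D k y)) => lt.
  - apply/orP; right; have := lt; rewrite !strandcE// so// -!strandcE// => lt'.
    rewrite ler_pdivlMl//; move: h2; rewrite !ltr0_norm ?subr_lt0//.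
    by rewrite mulrN lerN2.
  - apply/orP; left; have := lt; rewrite !strandcE// so// -!strandcE// => lt'.
    by move: h1; rewrite !gtr0_norm ?subr_gt0.
  - by move: h1; rewrite lt subrr normr0 !mulr0 normr_le0 => /eqP ->; rewrite lexx.
by rewrite /psi; apply/le_bigmin.
Qed.

Let psi_lt y u v : u < v -> psi y u < psi y v.
Proof.
move=> uv; rewrite {2}/psi.
have lt j : psi y u < branch j y v.
  by apply: le_lt_trans (psi_le y u j) _; rewrite ltrD2l stretch_lt// ltrD2r.
by apply/lt_bigmin.
Qed.

(** There the slack vanishes and the two diagrams have the same endpoints, so every branch is the
    identity. *)
Let psi_boundary y x : y = 0 \/ y = 1 -> psi y x = x.
Proof.
move=> hy; have i0 : 0 <= (0 : R) <= 1 by rewrite lexx ler01.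
have i1 : 0 <= (1 : R) <= 1 by rewrite lexx ler01.
have e j : strandc D j y = strandc D' j y.
  case: hy => ->; rewrite !strandcE//; first exact: same_order_bottom.
  by rewrite !strand_top.
have My : M y = 1.
  rewrite /M /slack /discrepancy big1 => [|j _]; last by rewrite e subrr normr0.
  by case: hy => ->; rewrite clamp_id// ?mul0r ?subrr ?mulr0 addr0 mulr0 addr0.
have br j : branch j y x = x.
  by rewrite /branch /stretch My invr1 !mul1r maxxx e addrC subrK.
by rewrite /psi br; elim/big_rec: _ => // j z _ ->; rewrite br minxx.
Qed.

Let continuous_branch j : continuous (fun p : R * R => branch j p.1 p.2).
Proof.
have cD (F : diagram R n) : continuous (fun p : R * R => strandc F j p.1).
  by apply: continuous_of_fst; exact: strandc_continuous.
have cu : continuous (fun p : R * R => p.2 - strandc D j p.1).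
  by move=> p; apply: cvgB; [exact: cvg_snd|exact: cD].
have cM : continuous (fun p : R * R => M p.1).
  exact: continuous_of_fst continuous_M.
have cMV : continuous (fun p : R * R => (M p.1)^-1).
  by move=> p; apply: cvgV; [exact: lt0r_neq0|exact: cM].
have cm : continuous (fun p : R * R => stretch p.1 (p.2 - strandc D j p.1)).
  apply: continuous_maxr => p; first by apply: cvgM; [exact: cM|exact: cu].
  by apply: cvgM; [exact: cMV|exact: cu].
by move=> p; apply: cvgD; [exact: cD|exact: cm].
Qed.

Let continuous_psi : continuous (fun p : R * R => psi p.1 p.2).
Proof.
rewrite /psi; elim: (index_enum _) => [|j r IH].
  have -> : (fun p : R * R => \big[Num.min/branch j0 p.1 p.2]_(j <- [::]) branch j p.1 p.2)
      = (fun p => branch j0 p.1 p.2) by apply/funext => p; rewrite big_nil.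
  exact: continuous_branch.
have -> : (fun p : R * R => \big[Num.min/branch j0 p.1 p.2]_(i <- j :: r) branch i p.1 p.2)
    = (fun p => Num.min (branch j p.1 p.2)
        (\big[Num.min/branch j0 p.1 p.2]_(i <- r) branch i p.1 p.2)).
  by apply/funext => p; rewrite big_cons.
exact: (continuous_minr (@continuous_branch j) IH).
Qed.

Let slide (t y x : R) : R := (1 - t) * x + t * psi y x.

Let slide_lt t y u v : 0 <= t <= 1 -> u < v -> slide t y u < slide t y v.
Proof.
move=> /andP[t0 t1] uv; have := psi_lt y uv; rewrite /slide => h.
by have [t1'|t1'] := ltP t 1; nra.
Qed.

(** A single [x] satisfies both bounds, so that [slide t y x] is at most [v] for every [t] in
    [0, 1]. With [psi_large] this makes every [slide t y] surjective. *)
Let psi_small y v : exists2 x, x <= v & psi y x <= v.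
Proof.
set a := strandc D j0 y; set b := strandc D' j0 y.
have MM := M1 y; have MMp := M0 y.
(* To the left of its strand the branch has the inverse of [M y] as slope, so a descent by [|v - b|]
   takes a step of [M y] times that length. *)
exists (- `|v| - `|a| - M y * `|v - b|).
  have := ler_norm (- v); rewrite normrN.
  by have := normr_ge0 a; have := normr_ge0 (v - b) => *; nra.
apply: le_trans (psi_le y _ j0) _; rewrite /branch -/a -/b /stretch -lerBrDl ge_max.
set u := _ - a.
have u1 : u <= - (M y * `|v - b|).
  by rewrite /u; have := ler_norm (- a); rewrite normrN; have := normr_ge0 v => *; lra.
have h : (M y)^-1 * u <= v - b.
  rewrite ler_pdivrMl//; apply: le_trans u1 _; rewrite -mulrN ler_pM2l//.
  by rewrite lerNl; have := ler_norm (- (v - b)); rewrite normrN.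
rewrite h andbT; have u0 : u <= 0.
  by apply: le_trans u1 _; rewrite oppr_le0 mulr_ge0// ltW.
apply: le_trans h; rewrite -subr_ge0 -mulrBl; apply: mulr_le0 => //.
by rewrite subr_le0 (le_trans _ MM)// invf_le1.
Qed.

Let psi_large y v : exists2 x, v <= x & v <= psi y x.
Proof.
have MM := M1 y; have MMp := M0 y.
(* The minimum is at least [v] only if all branches are, so a sum over all strands replaces the
   single strand [j0] used for the upper bound. *)
pose S := \sum_(j < n) (`|strandc D j y| + M y * `|v - strandc D' j y|).
have S_ge j : `|strandc D j y| + M y * `|v - strandc D' j y| <= S.
  rewrite /S (bigD1 j)//= lerDl; apply: sumr_ge0 => k _.
  by rewrite addr_ge0// mulr_ge0// ltW.
have S0 : 0 <= S.
  by apply: sumr_ge0 => k _; rewrite addr_ge0// mulr_ge0// ltW.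
exists (`|v| + S); first by apply: le_trans (ler_norm v) _; rewrite lerDl.
have ge j : v <= branch j y (`|v| + S).
  rewrite /branch /stretch -lerBlDl le_max; apply/orP; right.
  rewrite ler_pdivlMl//.
  apply: (@le_trans _ _ (M y * `|v - strandc D' j y|)).
    by rewrite ler_pM2l// ler_norm.
  have := S_ge j; have := ler_norm (strandc D j y); have := normr_ge0 v.
  by move=> *; lra.
by rewrite /psi; apply/le_bigmin.
Qed.

Let continuous_slide : continuous (fun q : R * (R * R) => slide q.1 q.2.2 q.2.1).
Proof.
have c1 : continuous (fst : R * (R * R) -> R) by move=> q; exact: cvg_fst.
have c2 : continuous (snd : R * (R * R) -> R * R) by move=> q; exact: cvg_snd.
have cs : continuous (fun p : R * R => (p.2, p.1)).
  by apply: continuous_pair => p; [exact: cvg_snd|exact: cvg_fst].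
have cpsi : continuous (fun q : R * (R * R) => psi q.2.2 q.2.1).
  exact: (continuous_compose (continuous_compose c2 cs) continuous_psi).
have cx : continuous (fun q : R * (R * R) => q.2.1).
  exact: (continuous_compose c2 (fun p => @cvg_fst _ _ _ _ _)).
move=> q; apply: cvgD; apply: cvgM => //; [|exact: cx|exact: c1|exact: cpsi].
by apply: cvgB; [exact: cvg_cst|exact: c1].
Qed.

Let slide_map (t : R) (p : R * R) : R * R := (slide t p.2 p.1, p.2).

Let slide_homeomorphism t : 0 <= t <= 1 -> self_homeomorphism strip (slide_map t).
Proof.
move=> t01; have /andP[t0 t1] := t01.
have cphi : continuous (fun p : R * R => slide t p.1 p.2).
  have cq : continuous (fun p : R * R => (t, (p.2, p.1))).
    apply: continuous_pair; first exact: cst_continuous.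
    by apply: continuous_pair => p; [exact: cvg_snd|exact: cvg_fst].
  exact: (continuous_compose cq continuous_slide).
have c1 y : continuous (slide t y).
  have cq : continuous (fun x : R => (y, x)).
    by apply: continuous_pair => x; [exact: cvg_cst|exact: cvg_id].
  exact: (continuous_compose cq cphi).
have [g [gphi phig cg]] : exists g : R -> R -> R, [/\ forall u x, g u (slide t u x) = x,
    forall u v, slide t u (g u v) = v & continuous (fun p : R * R => g p.1 p.2)].
  apply: (@fiber_homeo _ (slide t)) => //; first by move=> u x x'; exact: slide_lt.
  move=> u v; apply: IVT_surj (c1 u) _ _ _; last by move=> x x'; exact: slide_lt.
    by have [x x1 x2] := psi_small u v; exists x; rewrite /slide; nra.
  by have [x x1 x2] := psi_large u v; exists x; rewrite /slide; nra.
have cs : continuous (fun p : R * R => (p.2, p.1)).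
  by apply: continuous_pair => p; [exact: cvg_snd|exact: cvg_fst].
split.
  apply: continuous_subspaceT; apply: continuous_pair => [p|p]; last exact: cvg_snd.
  exact: (continuous_compose cs cphi).
exists (fun p => (g p.2 p.1, p.2)).
  apply: continuous_subspaceT; apply: continuous_pair => [p|p]; last exact: cvg_snd.
  exact: (continuous_compose cs cg).
by move=> [x y] sp; split; rewrite //= /slide_map /= ?gphi ?phig.
Qed.

Let slide_boundary t p : p.2 = 0 \/ p.2 = 1 -> slide_map t p = p.
Proof.
case: p => x y /= hy; rewrite /slide_map /slide /= psi_boundary//.
by congr pair; ring.
Qed.

Let slide_inj t y u v : 0 <= t <= 1 -> slide t y u = slide t y v -> u = v.
Proof.
by move=> t01 e; case: (ltgtP u v) => // /(slide_lt y t01); rewrite e ltxx.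
Qed.

Let slide_strand t y j : 0 <= y <= 1 ->
  slide t y (strand D j y) = (1 - t) * strand D j y + t * strand D' j y.
Proof.
by move=> y01; have := psi_strand j y01; rewrite /slide !strandcE// => ->.
Qed.

Let slide_on t j p : 0 <= t <= 1 -> strip p ->
  (1 - t) * strand D j (slide_map t p).2 + t * strand D' j (slide_map t p).2 =
    (slide_map t p).1 <-> strand D j p.2 = p.1.
Proof.
by move=> t01 sp; rewrite /= -slide_strand//; split=> [/(slide_inj t01)|->].
Qed.

Let slide_transport t : 0 <= t <= 1 ->
  exists Dt : diagram R n, carries strip (slide_map t) id D Dt.
Proof.
move=> t01; have /andP[t0 t1] := t01.
have [|j k y y01 jk|Dt _ cDt] := @transport R n D (slide_map t)
  (fun j y => (1 - t) * strand D j y + t * strand D' j y)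
  (slide_homeomorphism t01) (@slide_boundary t) (fun j p sp => slide_on j t01 sp).
- by move=> j; apply: psmooth_lincomb; exact: strand_psmooth.
- rewrite -!slide_strand// => /(slide_inj t01) e; have e' := same_order_eq so y01 e.
  have [a [b [da db ab]]] := strand_transverse y01 jk e.
  have [a' [b' [da' db' ab']]] := strand_transverse y01 jk e'.
  exists ((1 - t) * a + t * a'), ((1 - t) * b + t * b'); split.
  + by apply: is_deriveD; apply: is_deriveZ.
  + by apply: is_deriveD; apply: is_deriveZ.
  have ab0 : a - b != 0 by rewrite subr_eq0.
  have ab0' : a' - b' != 0 by rewrite subr_eq0.
  have yi := double_interior y01 jk e; have /andP[y0 y1] := yi.
  have n1 := is_derive_sign (is_derive_sub da db) ab0.
  have n2 := is_derive_sign (is_derive_sub da' db') ab0'.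
  (* Just above the crossing [j] and [k] are in the same order in both diagrams. So [a - b] and
     [a' - b'] have the same sign, and their convex combination is nonzero. *)
  near y^'+ => z.
  have zy : y < z by near: z; exact: nbhs_right_gt.
  have z1 : z < 1 by near: z; exact: nbhs_right_lt.
  have z01 : 0 <= z <= 1 by rewrite (ltW z1) (ltW (lt_trans y0 zy)).
  have : z != y -> 0 < (a - b) * ((strand D j z - strand D k z) -
      (strand D j y - strand D k y)) * (z - y).
    by near: z; exact: nbhs_right_nbhs n1.
  have : z != y -> 0 < (a' - b') * ((strand D' j z - strand D' k z) -
      (strand D' j y - strand D' k y)) * (z - y).
    by near: z; exact: nbhs_right_nbhs n2.
  rewrite gt_eqF// => /(_ isT) + /(_ isT).
  have zy0 : 0 < z - y by rewrite subr_gt0.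
  rewrite e e' !subrr !subr0 !(pmulr_lgt0 _ zy0).
  have so1 := so j k z01; have so2 := so k j z01.
  move=> h' h; apply/eqP => eq.
  have {eq} eq : (1 - t) * (a - b) + t * (a' - b') = 0.
    by rewrite !mulrBr; move: eq => /eqP; rewrite -subr_eq0 => /eqP <-; ring.
  case: (ltgtP (a - b) 0) ab0 => // h0 _.
    move: h; rewrite nmulr_rgt0// subr_lt0 so1 => h.
    move: h'; rewrite nmulr_lgt0 ?subr_lt0// => h'.
    by have [t1'|t1'] := ltP t 1; nra.
  move: h; rewrite pmulr_rgt0// subr_gt0 so2 => h.
  move: h'; rewrite pmulr_lgt0 ?subr_gt0// => h'.
  by have [t1'|t1'] := ltP t 1; nra.
- by exists Dt.
Unshelve. all: by end_near. Qed.

Lemma horizontal_isotopy :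
  (forall j k y, 0 <= y <= 1 -> j != k -> strand D j y = strand D k y ->
     label D' (strand D' j y, y) = label D (strand D j y, y)) ->
  (forall j y, 0 <= y <= 1 ->
     bars D' (strand D' j y, y) <-> bars D (strand D j y, y)) ->
  isotopic D D'.
Proof.
move=> hl hb; have i1 : 0 <= (1 : R) <= 1 by rewrite lexx ler01.
exists slide_map; split.
- apply: continuous_subspaceT; apply: continuous_pair; first exact: continuous_slide.
  have c2 : continuous (snd : R * (R * R) -> R * R) by move=> q; exact: cvg_snd.
  by move=> q; apply: (continuous_comp (c2 q)); exact: cvg_snd.
- move=> t t01; split; [exact: slide_homeomorphism|exact: slide_boundary|].
  exact: slide_transport.
- by move=> [x y] _; rewrite /slide_map /slide /= subr0 mul1r mul0r addr0.
have on j p : strip p -> strand D' j (slide_map 1 p).2 = (slide_map 1 p).1 <->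
    strand D j p.2 = p.1.
  by move=> sp; rewrite -(slide_on j i1 sp) subrr mul0r add0r mul1r.
have pt j p : strip p -> strand D j p.2 = p.1 -> slide_map 1 p = (strand D' j p.2, p.2).
  by move=> sp /(on j p sp) /= ->.
move=> p sp; split.
- move=> l; split=> [[_ /(on l p sp) lp]|[j -> [_ jp]]]; first by exists l.
  by split=> //; exact/on.
- move=> [j [k [jk [_ jp] [_ kp]]]]; rewrite (pt j)// (hl j k)// ?jp ?kp//.
  by rewrite -surjective_pairing.
have pE j : strand D j p.2 = p.1 -> p = (strand D j p.2, p.2).
  by move=> ->; rewrite -surjective_pairing.
split=> bp.
  have [_ [j [/(on j p sp) jp _]]] := bars_on bp.
  by move: bp; rewrite (pt j)// => /(hb j p.2 sp); rewrite jp -surjective_pairing.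
have [_ [j [jp _]]] := bars_on bp.
by rewrite (pt j)//; apply/(hb j p.2 sp); rewrite jp -surjective_pairing.
Qed.

End HorizontalIsotopy.

(** * Diagrams with congruent words *)

Section SameWord.
Context {R : realType} {n : nat} (hn : (0 < n)%N).
Implicit Types (D : diagram R n) (p q : R * R).

Lemma sreading_inj D ps p q : sreading D ps -> p \in ps -> q \in ps -> p.2 = q.2 -> p = q.
Proof.
move=> [_]; rewrite sorted_pairwise; last by move=> b a c /= ab bc; exact: lt_trans bc ab.
elim: ps => //= e ps IH /andP[/allP he pw].
rewrite !inE => /orP[/eqP ->|pps] /orP[/eqP ->|qps] // e2; last exact: IH.
  by have := he _ qps; rewrite e2 ltxx.
by have := he _ pps; rewrite e2 ltxx.
Qed.

Definition matching D D' : Prop := forall p, event D p ->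
  exists p', [/\ event D' p', p'.2 = p.2 & letter hn D' p' = letter hn D p].

Lemma aligned_matching D D' ps ps' : reading D ps -> reading D' ps' ->
  map snd ps = map snd ps' -> map (letter hn D) ps = map (letter hn D') ps' ->
  matching D D'.
Proof.
move=> [_ _ eps] [_ _ eps'] h2 hl p /eps pps.
have sz : size ps = size ps' by rewrite -(size_map snd ps) h2 size_map.
have ip : (index p ps < size ps)%N by rewrite index_mem.
have ip' : (index p ps < size ps')%N by rewrite -sz.
exists (nth p ps' (index p ps)); split; first by apply/eps'; exact: mem_nth.
  rewrite -[LHS](nth_map p 0 snd)// -h2 (nth_map p)//.
  by rewrite nth_index.
rewrite -[LHS](nth_map p (gamma (Ordinal hn)) (letter hn D'))// -hl (nth_map p)//.
by rewrite nth_index.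
Qed.

Lemma matching_kind_pos D D' p p' : event D p -> event D' p' ->
  letter hn D' p' = letter hn D p -> kind_at D' p' = kind_at D p /\ pos D' p' = pos D p.
Proof.
by move=> /(letterP hn)[k i] /(letterP hn)[k' i'] e; rewrite -k -k' -i -i' e.
Qed.

Lemma kind_double D p c : kind_at D p = Some c -> double_point D p /\ label D p = c.
Proof. by rewrite /kind_at; case: asboolP => // dp [<-]. Qed.

Lemma double_kind D p : double_point D p -> kind_at D p = Some (label D p).
Proof. by move=> dp; rewrite /kind_at asboolT. Qed.

Lemma matching_double D D' : matching D D' -> forall p, double_point D p ->
  exists p', [/\ double_point D' p', p'.2 = p.2, pos D' p' = pos D p &
    label D' p' = label D p].
Proof.
move=> m p dp; have ep : event D p by left.
have [p' [ep' h2 l]] := m p ep; have [k i] := matching_kind_pos ep ep' l.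
by move: k; rewrite (double_kind dp) => /kind_double[dp' lp']; exists p'.
Qed.

(** A bar of position [i] lies on the strand of rank [i], and the ranks agree because the orders
    do. *)
Lemma matching_bars D D' : matching D D' -> same_order D D' ->
  forall j y, 0 <= y <= 1 -> bars D (strand D j y, y) -> bars D' (strand D' j y, y).
Proof.
move=> m so j y y01 b; have ep : event D (strand D j y, y) by right.
have [[x' y'] [ep' /= h2 l]] := m _ ep; have [k i] := matching_kind_pos ep ep' l.
have nd := bar_not_double b; rewrite h2 in ep' k i.
have [dp'|bp'] := ep'.
  by move: k; rewrite (double_kind dp') => /esym/kind_double[/nd].
have [_ [j' [jp' _]]] := bars_on bp'; rewrite /= in jp'.
have : rank D' y j' = rank D' y j.
  rewrite [LHS]rank_pos jp' i.
  by apply: eq_card => l'; rewrite !inE so.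
by move=> /rank_inj <-; rewrite jp'.
Qed.

Lemma aligned_isotopic D D' ps ps' : sreading D ps -> sreading D' ps' ->
  map snd ps = map snd ps' -> map (letter hn D) ps = map (letter hn D') ps' ->
  isotopic D D'.
Proof.
move=> srD srD' h2 hl; have [rD _] := srD; have [rD' _] := srD'.
have m := aligned_matching rD rD' h2 hl.
have m' := aligned_matching rD' rD (esym h2) (esym hl).
have so : same_order D D'.
  move=> y j k y01; apply: same_crossings_same_order => // p dp.
    by have [p' [? ? ? _]] := matching_double m dp; exists p'.
  by have [p' [? ? ? _]] := matching_double m' dp; exists p'.
have [K [K0 hK]] := ratio_bound so.
apply: (horizontal_isotopy hn so K0) => [y j k|j k y y01 jk e|j y y01].
- exact: hK.
- have dp : double_point D (strand D j y, y).
    by exists j, k; split=> //; split=> //=; rewrite e.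
  have dp' : double_point D' (strand D' j y, y).
    exists j, k; split=> //; split=> //=.
    exact: esym (same_order_eq so y01 e).
  have [p' [dq hq _ lq]] := matching_double m dp.
  have [_ _ eps'] := rD'.
  rewrite -lq; congr (label D' _); apply: (sreading_inj srD') => //; apply/eps'; by left.
- split; first exact: matching_bars (same_order_sym so) _ _ y01.
  exact: matching_bars.
Qed.

Lemma sreading_equiv D D' ps ps' : sreading D ps -> sreading D' ps' ->
  map (letter hn D) ps = map (letter hn D') ps' -> diagram_equiv D D'.
Proof.
move=> srD srD' hl; have [rD sD] := srD; have [rD' sD'] := srD'.
have [_ _ eps] := rD; have [_ _ eps'] := rD'.
have sz : size ps = size ps'.
  by rewrite -(size_map (letter hn D) ps) hl size_map.
pose zs := zip (map snd ps) (map snd ps').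
pose lt2 (p q : R * R) := (p.1 < q.1) && (p.2 < q.2).
have tr : transitive lt2.
  by move=> q p r /andP[a b] /andP[c d]; rewrite /lt2 (lt_trans a c) (lt_trans b d).
have szs : size (map snd ps) = size (map snd ps') by rewrite !size_map.
have zs01 q : q \in zs -> lt2 (0, 0) q && lt2 q (1, 1).
  move=> qz; have q1 : q.1 \in map snd ps.
    by have := map_f fst qz; rewrite -/(unzip1 zs) unzip1_zip ?szs.
  have q2 : q.2 \in map snd ps'.
    by have := map_f snd qz; rewrite -/(unzip2 zs) unzip2_zip ?szs.
  move: q1 q2; rewrite /lt2 => /mapP[p /eps/event_strip/andP[a b] ->] /mapP[p' /eps'/event_strip/andP[c d] ->].
  by rewrite /= a b c d.
(* Readings descend in height while the nodes of an interpolation ascend, hence the reversal. *)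
have sorted_zs : sorted lt2 (rev zs).
  rewrite rev_sorted; apply/(sortedP (0, 0)) => i.
  rewrite size_zip !size_map -sz minnn => isz.
  rewrite !nth_zip//; move/(sortedP (0, 0)): sD => /(_ i isz).
  move/(sortedP (0, 0)): sD' => /(_ i); rewrite -sz => /(_ isz).
  by rewrite /lt2 /= !(nth_map (0, 0)) -?sz// ?(ltnW isz)// => -> ->.
have pth : path lt2 (0, 0) (rcons (rev zs) (1, 1)).
  rewrite rcons_path path_min_sorted ?sorted_zs /=; last first.
    by apply/allP => q; rewrite mem_rev => /zs01/andP[].
  have : last (0, 0) (rev zs) \in (0, 0) :: rev zs by exact: mem_last.
  rewrite inE mem_rev => /orP[/eqP ->|/zs01/andP[_ //]].
  by rewrite /lt2 /= ltr01.
have [psi [/= pl p0 p1 pn]] := ipl_nodes pth.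
have {}pn q : q \in zs -> psi q.1 = q.2 /\ affine_near psi q.1.
  by move=> qz; apply: pn; rewrite mem_rev.
have c1 : continuous (fun _ : R => 1 : R) by move=> x; exact: cst_continuous.
have zE p : p \in ps -> exists2 p', p' \in ps' & (p.2, p'.2) \in zs.
  move=> pps; have ip : (index p ps < size ps)%N by rewrite index_mem.
  exists (nth p ps' (index p ps)); first by rewrite mem_nth// -sz.
  have -> : (p.2, (nth p ps' (index p ps)).2) = nth (p.2, p.2) zs (index p ps).
    by rewrite nth_zip// !(nth_map p) -?sz// nth_index.
  by apply: mem_nth; rewrite size_zip !size_map -sz minnn.
have i1 : 0 <= (1 : R) <= 1 by rewrite lexx ler01.
(* With [chi] constantly 1 all strands move alike, so [psi] only has to be affine near the
   crossings, whose heights are among the nodes. *)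
have [||D1 [iso cD1]] := @vertical_isotopy R n D psi pl p0 p1 (fun=> 1) (fun=> 1)
    c1 (fun=> i1) (fun=> i1).
- by move=> j y _; left.
- move=> j k y y01 jk e.
  have /eps pps : event D (strand D j y, y).
    by left; exists j, k; split=> //; split=> //=; rewrite e.
  have [p' _ /pn[_ [c [e' [c0 ne]]]]] := zE _ pps.
  by exists c, e'; split=> //; left.
have hh := vertical_homeomorphism pl p0 p1 c1 (fun=> i1).
have hb := @vertical_boundary R psi p0 p1 (fun=> 1).
set h := vertical_map psi (fun=> 1) in cD1 hh hb.
have h2 : map snd (map h ps) = map snd ps'.
  apply: (@eq_from_nth _ 0); first by rewrite !size_map.
  move=> i; rewrite !size_map => isz; rewrite (nth_map (0, 0)) ?size_map//.
  have isz' : (i < size ps')%N by rewrite -sz.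
  rewrite !(nth_map (0, 0))//; set p := nth (0, 0) ps i.
  have /event_strip/lt01_le01 p01 : event D p by apply/eps; exact: mem_nth.
  rewrite /h /vertical_map /= mul1r clamp_id// addrC subrK.
  have /pn[] // : (p.2, (nth (0, 0) ps' i).2) \in zs.
  have -> : (p.2, (nth (0, 0) ps' i).2) = nth (0, 0) zs i.
    by rewrite nth_zip// !(nth_map (0, 0)).
  by apply: mem_nth; rewrite size_zip !size_map -sz minnn.
have srt : sorted (fun p q : R * R => q.2 < p.2) (map h ps).
  have : sorted (fun x y : R => y < x) (map snd (map h ps)).
    by rewrite h2 sorted_map; exact: sD'.
  by rewrite sorted_map.
have [|rD1 lD1] := carry_reading hn hh hb cD1 rD.
  by apply: sub_sorted srt => p q /ltW.
have eq1 : diagram_equiv D D1 by apply: rst_step; left.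
apply: rst_trans eq1 _; apply: rst_step; left.
by apply: (@aligned_isotopic D1 D' (map h ps) ps') => //; rewrite lD1.
Qed.

Lemma reads_equiv D D' w : reads hn D w -> reads hn D' w -> diagram_equiv D D'.
Proof.
move=> /strictify[D1 [ps [e1 s1 w1]]] /strictify[D2 [ps' [e2 s2 w2]]].
apply: rst_trans e1 _; apply: rst_trans (rst_sym _ _ _ _ e2).
by apply: sreading_equiv s1 s2 _; rewrite -w1 -w2.
Qed.

End SameWord.

(** * Local moves inside a product of words *)

Section MoveReplacement.
Context {R : realType} {n : nat}.
Implicit Types (u v w a b : seq (stvb_gen n)).
Local Notation wd := (@word_diagram R n).

(** Each side is the conjugate of one transposition by the other; both are the exchange of the two
    outer positions. *)
Lemma braid_swap (i j : 'I_n.-1) : j = i.+1 :> nat ->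
  (swap i * (swap j * swap i) = swap j * (swap i * swap j))%g.
Proof.
move=> ij; have e : pos_l j = pos_r i by exact: val_inj.
have conj (s t : {perm 'I_n}) (x y : 'I_n) : t = tperm x y ->
    (t * (s * t) = s ^ t)%g.
  by move=> ->; rewrite conjgE tpermV mulgA.
rewrite (@conj _ _ _ _ erefl) (@conj _ (swap j) _ _ erefl) !tpermJ.
rewrite /swap e tpermR tpermL !tpermD //.
all: by rewrite -val_eqE /= ?ij; lia.
Qed.

Lemma word_perm_cons x w : strand_perm (wd (x :: w)) =
  (strand_perm (elementary_diagram (R := R) x) * strand_perm (wd w))%g.
Proof. by []. Qed.

(** Below the box the strands must be the same before and after the replacement, so the two words
    must induce the same permutation. *)
Lemma move_perm u v : stvb_move u v -> strand_perm (wd u) = strand_perm (wd v).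
Proof.
have s2 (i : 'I_n.-1) : (swap i * swap i = 1)%g by exact: tperm2.
have nilE : strand_perm (wd [::]) = 1%g by [].
by case=> *; rewrite !word_perm_cons nilE /= ?mulg1 ?mul1g ?s2 ?mulg1//;
  exact: braid_swap.
Qed.

Lemma move_replacement a b u v : stvb_move u v ->
  local_replacement (wd u) (wd v) (stack (wd a) (stack (wd u) (wd b)))
    (stack (wd a) (stack (wd v) (wd b))).
Proof.
move=> uv; have pE := move_perm uv.
(* In the nested stacks [wd a] fills the upper half, the middle word the heights from 1/4 to 1/2 and
   [wd b] the rest, with unchanged abscissas. Strand [j] of the middle word continues the strand
   that [wd a] sends to [j], hence the inverse permutation. *)
exists 0, 1, 4^-1, 4^-1, ((strand_perm (wd a))^-1)%g => A.
have upper w l (y : R) : 2^-1 <= y ->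
    strand (stack (wd a) (stack (wd w) (wd b))) l y = strand (wd a) l (2 * y - 1).
  by move=> h; exact: stack_strand_upper.
have middle w l (y : R) : 4^-1 <= y <= 2^-1 ->
    strand (stack (wd a) (stack (wd w) (wd b))) l y =
    strand (wd w) (strand_perm (wd a) l) (4 * y - 1).
  move=> /andP[h1 h2]; rewrite [LHS]stack_strand_lower// [LHS]stack_strand_upper; last lra.
  by congr strand; lra.
have lower w l (y : R) : y <= 4^-1 ->
    strand (stack (wd a) (stack (wd w) (wd b))) l y =
    strand (wd b) (strand_perm (wd w) (strand_perm (wd a) l)) (4 * y).
  move=> h; rewrite [LHS]stack_strand_lower; last lra.
  by rewrite [LHS]stack_strand_lower; [congr strand; lra|lra].
have box_carries w : carries (box n) A ((strand_perm (wd a))^-1)%g (wd w)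
    (stack (wd a) (stack (wd w) (wd b))).
  move=> p [_ /andP[p0 p1]].
  have Ap : 4^-1 <= (A p).2 <= 2^-1 by rewrite /A /=; apply/andP; split; lra.
  have Ae : 4 * (A p).2 - 1 = p.2 by rewrite /A /=; lra.
  have A1 : (A p).1 = p.1 by rewrite /A /= add0r mul1r.
  have sA : strip (A p) by rewrite /strip /=; apply/andP; split; lra.
  split.
  - move=> l; rewrite /on_strand middle// Ae A1; split=> [[_ lp]|[j -> [_ jp]]].
      exists (strand_perm (wd a) l); first by rewrite permK.
      by split=> //; rewrite /strip /= p0 p1.
    by split=> //; rewrite permKV.
  - move=> dp; have /event_strip/andP[q0 q1] : event (wd w) p by left.
    rewrite /= /stack_label /= (_ : 2^-1 <= 4^-1 + 4^-1 * p.2 = false); last first.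
      by apply/negbTE; rewrite -ltNge; lra.
    rewrite /stack_label /= (_ : 2^-1 <= 2 * (4^-1 + 4^-1 * p.2)); last lra.
    by case: p {dp p0 p1 Ap Ae A1 sA} q0 q1 => x y /= q0 q1; congr (label _ (_, _)); lra.
  - split.
      move=> [[q /bars_on[/andP[q0 q1] _] [_ e]]|[q [[r br <-]|[r br <-]] [e1 e2]]].
      + by exfalso; move: e; lra.
      + have -> // : p = r.
        by case: p r {p0 p1 Ap Ae A1 sA br} e1 e2 => x y [x' y'] /= e1 e2; congr pair; lra.
      + by have /bars_on[/andP[r0 r1] _] := br; exfalso; move: e2 => /=; lra.
    move=> bp; right; exists (p.1, (p.2 + 1) / 2); first by left; exists p.
    by rewrite /A /=; congr pair; lra.
have outside p : strip p -> ~ (A @` box n) p ->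
    [\/ 2^-1 < p.2, p.2 < 4^-1 |
      4^-1 <= p.2 <= 2^-1 /\ (p.1 < 0 \/ n.+1%:R < p.1)].
  move=> /andP[p0 p1] nB; case: (ltP 2^-1 p.2) => h1; first by constructor 1.
  case: (ltP p.2 4^-1) => h2; first by constructor 2.
  constructor 3; split; first by [].
  case: (ltP p.1 0) => h3; first by left.
  case: (ltP n.+1%:R p.1) => h4; first by right.
  case: nB; exists (p.1, 4 * p.2 - 1).
    by split=> /=; [rewrite h3 h4|apply/andP; split; lra].
  by rewrite /A /= [RHS]surjective_pairing; congr pair; lra.
have no_strand w p l : 4^-1 <= p.2 <= 2^-1 -> p.1 < 0 \/ n.+1%:R < p.1 ->
    strand (stack (wd a) (stack (wd w) (wd b))) l p.2 != p.1.
  move=> hp hx; rewrite middle//.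
  have y01 : 0 <= 4 * p.2 - 1 <= 1.
    by move/andP: hp => [? ?]; apply/andP; split; lra.
  have /andP[h1 h2] := word_diagram_itv w (strand_perm (wd a) l) y01.
  apply/eqP => e; rewrite e in h1 h2.
  case: hx => hx.
    by have := lt_trans hx (lt_le_trans ltr01 h1); rewrite ltxx.
  by move: h2; rewrite leNgt => /negP; apply; apply: le_lt_trans hx; rewrite ler_nat.
have same_strand p l : strip p -> ~ (A @` box n) p ->
    strand (stack (wd a) (stack (wd u) (wd b))) l p.2 = p.1 <->
    strand (stack (wd a) (stack (wd v) (wd b))) l p.2 = p.1.
  move=> sp /(outside p sp)[h|h|[h hx]].
  - by rewrite !upper ?ltW.
  - by rewrite !lower ?(ltW h)// pE.
  - by split=> /eqP e; exfalso; move: e; apply/negP; exact: no_strand.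
split=> //; first by split; lra.
move=> p [sp nB]; split.
- move=> l; split=> [[_ /(same_strand p l sp nB) lp]|[j -> [_ jp]]]; first by exists l.
  by split=> //; exact/same_strand.
- move=> [j [k [_ [_ jp] _]]]; have [h|h|[h hx]] := outside p sp nB.
  + by rewrite /= /stack_label (ltW h).
  + have h1 : (2^-1 <= p.2) = false by apply/negbTE; rewrite -ltNge; lra.
    have h2 : (2^-1 <= 2 * p.2) = false by apply/negbTE; rewrite -ltNge; lra.
    by rewrite /= /stack_label /= h1 /stack_label /= h2.
  + by move/eqP: jp; rewrite (negPf (no_strand u p j h hx)).
- have bars_out w w' : bars (stack (wd a) (stack (wd w) (wd b))) p ->
      bars (stack (wd a) (stack (wd w') (wd b))) p.
    move=> bp; have [_ [j [jp _]]] := bars_on bp.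
    have h : 2^-1 < p.2 \/ p.2 < 4^-1.
      have [h|h|[h hx]] := outside p sp nB; [by left|by right|].
      by move/eqP: jp; rewrite (negPf (no_strand w p j h hx)).
    case: bp => [[q bq e]|[q [[r br e']|[r br e']] e]].
    + by left; exists q.
    + have /bars_on[/andP[r0 r1] _] := br; exfalso.
      by case: h; rewrite -e -e' /=; lra.
    + by right; exists q => //; right; exists r.
  by split; exact: bars_out.
Qed.

End MoveReplacement.

(** * Classes of diagrams and classes of words *)

Section Congruence.
Context {R : realType} {n : nat} (hn : (0 < n)%N).
Implicit Types (D : diagram R n) (u v w a b : seq (stvb_gen n)).
Local Notation wd := (@word_diagram R n).

Lemma separated_equiv a b x y D D' : separated x y ->
  reads hn D (a ++ [:: x; y] ++ b) -> reads hn D' (a ++ [:: y; x] ++ b) ->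
  diagram_equiv D D'.
Proof.
move=> sxy rD rD'.
have [B [r1 r2]] : exists B : diagram R n,
    reads hn B [:: x; y] /\ reads hn B [:: y; x].
  case/orP: sxy => h; first by exists (beside h); exact: reads_beside.
  by exists (beside h); have [] := reads_beside (R := R) h hn.
have s z : reads hn B z -> reads hn (stack (wd a) (stack B (wd b))) (a ++ z ++ b).
  by move=> rz; do 2?[apply: reads_stack; rewrite ?reads_word//]; exact: reads_word.
exact: rst_trans (reads_equiv rD (s _ r1)) (reads_equiv (s _ r2) rD').
Qed.

Lemma move_equiv a b u v D D' : stvb_move u v ->
  reads hn D (a ++ u ++ b) -> reads hn D' (a ++ v ++ b) -> diagram_equiv D D'.
Proof.
move=> uv rD rD'.
have s w : reads hn (stack (wd a) (stack (wd w) (wd b))) (a ++ w ++ b).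
  by apply: reads_stack; [exact: reads_word|apply: reads_stack; exact: reads_word].
apply: rst_trans (reads_equiv rD (s u)) _; apply: rst_trans (reads_equiv (s v) rD').
by apply: rst_step; right; exists n, u, v; split=> //; exact: move_replacement.
Qed.

Lemma rel_equiv a b u v D D' : stvb_rel u v ->
  reads hn D (a ++ u ++ b) -> reads hn D' (a ++ v ++ b) -> diagram_equiv D D'.
Proof.
have bar (i : 'I_n.-1) (k : 'I_n) : k != pos_l i -> k != pos_r i ->
    (i + 2 <= k)%N || (k + 1 <= i)%N.
  by rewrite -!val_eqE /=; lia.
case; try (by move=> i; apply: move_equiv; constructor);
  try (by move=> i j ij; apply: move_equiv; constructor).
all: try by move=> i j ij; apply: separated_equiv;
  rewrite /separated /width /=; move: ij; rewrite /far; lia.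
- move=> k l; have [->|kl] := eqVneq k l; first by move=> r r'; exact: (reads_equiv r r').
  by apply: separated_equiv; rewrite /separated /width /=; move: kl; rewrite -val_eqE /=; lia.
all: move=> i k kl kr; apply: separated_equiv; rewrite /separated /width /=;
  by have := bar i k kl kr; lia.
Qed.

Lemma congr_equiv w w' D D' : congr w w' -> reads hn D w -> reads hn D' w' ->
  diagram_equiv D D'.
Proof.
move=> ww'; elim: ww' D D' => [{}w {}w' [a [b [l [r [lr -> ->]]]]]|{}w|{}w {}w' _ IH|
    w1 w2 w3 _ IH1 _ IH2] D D' rD rD'.
- exact: rel_equiv lr rD rD'.
- exact: reads_equiv rD rD'.
- by apply: rst_sym; exact: IH.
- exact: rst_trans (IH1 _ _ rD (reads_word hn w2)) (IH2 _ _ (reads_word hn w2) rD').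
Qed.

Lemma braid_classP D D' : braid_class D = braid_class D' <-> diagram_equiv D D'.
Proof.
split=> [/eqmodP|h]; first by move=> /asboolP.
by apply/eqmodP; apply/asboolP.
Qed.

(** This identifies classes of diagrams with words up to congruence; the monoid laws and the
    presentation become statements about concatenation. *)
Lemma braid_class_reads D D' w w' : reads hn D w -> reads hn D' w' ->
  braid_class D = braid_class D' <-> congr w w'.
Proof.
move=> rD rD'; rewrite braid_classP; split=> h.
  exact: diagram_equiv_congr h rD rD'.
exact: congr_equiv h rD rD'.
Qed.

Lemma braid_class_surj (x : STVB R n) : exists2 D, braid_class D = x &
  exists w, reads hn D w.
Proof. by exists (repr x); [exact: reprK|exact: reads_exists]. Qed.

(** Stacking concatenates words, and concatenation respects congruence, so the representatives
    chosen by [repr] can be exchanged for any others. *)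
Lemma stvb_mul_class D E : stvb_mul (braid_class D) (braid_class E) = braid_class (stack D E).
Proof.
rewrite /stvb_mul; set D1 := repr (braid_class D); set E1 := repr (braid_class E).
have eD : braid_class D1 = braid_class D by exact: reprK.
have eE : braid_class E1 = braid_class E by exact: reprK.
have [u rD] := reads_exists hn D; have [v rE] := reads_exists hn E.
have [u1 rD1] := reads_exists hn D1; have [v1 rE1] := reads_exists hn E1.
apply/(braid_class_reads (reads_stack rD1 rE1) (reads_stack rD rE)).
by apply: congr_cat; [exact/(braid_class_reads rD1 rD)|exact/(braid_class_reads rE1 rE)].
Qed.

Lemma eval_word_class w :
  eval_word (@stvb_mul R n) (stvb_one R n) (@elementary_braid R n) w = braid_class (wd w).
Proof.
elim: w => [|x w IH] //; rewrite /eval_word /= -/(eval_word _ _ _ w) IH.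
by rewrite /elementary_braid stvb_mul_class.
Qed.

End Congruence.

(* The first clause says that stacking is well defined on equivalence classes,
   so that stvb_mul does not depend on the choice of representatives. *)
Theorem theorem2p9 (R : realType) (n : nat) (hn : (0 < n)%N) :
  (forall D E : diagram R n,
     braid_class (stack D E) = stvb_mul (braid_class D) (braid_class E)) /\
  monoid_presented_by (@stvb_mul R n) (stvb_one R n) (@elementary_braid R n)
    (@stvb_rel n).
Proof.
split=> [D E|]; first by rewrite (stvb_mul_class hn).
have mulE := @stvb_mul_class R n hn.
split.
- move=> x y z; have [D <- [u rD]] := braid_class_surj hn x.
  have [E <- [v rE]] := braid_class_surj hn y; have [F <- [w rF]] := braid_class_surj hn z.
  rewrite !mulE; apply/(braid_class_reads (reads_stack rD (reads_stack rE rF))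
    (reads_stack (reads_stack rD rE) rF)).
  by rewrite catA; exact: congr_refl.
- move=> x; have [D <- [u rD]] := braid_class_surj hn x; rewrite mulE.
  apply/(braid_class_reads (reads_stack (reads_trivial hn) rD) rD); exact: congr_refl.
- move=> x; have [D <- [u rD]] := braid_class_surj hn x; rewrite mulE.
  apply/(braid_class_reads (reads_stack rD (reads_trivial hn)) rD).
  by rewrite cats0; exact: congr_refl.
- move=> x; have [D <- [w rD]] := braid_class_surj hn x; exists w.
  rewrite (eval_word_class hn); apply/(braid_class_reads (reads_word hn w) rD).
  exact: congr_refl.
- move=> u v; rewrite !(eval_word_class hn).
  exact: (braid_class_reads (reads_word hn u) (reads_word hn v)).
Qed.
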